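(* Let $G_1,G_2,\dots$ be a sequence of graphs with $e(G_j)\to\infty$ as $j\to\infty$. The sequence is sampling convergent if and only if the sequence $\mathrm{embed}(G_1),\mathrm{embed}(G_2),\dots$ converges weakly, that is, if and only if the canonical labelings $\mathsf{Lbl}(G_1),\mathsf{Lbl}(G_2),\dots$ converge in distribution as point processes on $\mathbb R_+^2$. Further, in that case, denoting the limiting distributions of $\mathrm{SmplD}(G_j,r)$ and $\mathrm{embed}(G_j)$ by $\eta_r$ and $\zeta$, respectively, if $H_r\sim\eta_r$ and $\xi\sim\zeta$ then $\mathsf{Lbl}_r(H_r)\overset{d}{=}\xi([0,r)^2\cap\cdot)$.
   Context: Graphs are finite, without multiple edges, but may have loops; $e(G)$ is the number of non-loop edges of $G$. An unlabeled graph is an isomorphism class of graphs; the set of finite unlabeled graphs is countable and discrete. Quantities depending on division by $e(G)$ are considered only when $e(G)\ge1$. $p$-sampling: $\mathsf{Smpl}(G,p)$ is the random unlabeled graph obtained by keeping each vertex of $G$ independently with probability $\min(p,1)$, taking the induced subgraph, discarding its isolated vertices (vertices contained in no edge, loop or non-loop), and forgetting labels. $\mathrm{SmplD}(G,s)$ is the probability distribution of $\mathsf{Smpl}(G,s/\sqrt{2e(G)})$. The sequence $G_1,G_2,\dots$ is sampling convergent if for every $s\in\mathbb R_+$ the distributions $\mathrm{SmplD}(G_j,s)$ converge weakly as $j\to\infty$ (to a probability distribution on finite unlabeled graphs). Random labelings: for $s>0$, $\mathsf{Lbl}_s(G)$ is the random counting measure $\sum_{(i,j)}\delta_{(U_i,U_j)}$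 on $\mathbb R_+^2$, where the sum is over the edges of $G$ with both orientations of each non-loop edge (and each loop once), and $U_i$ are i.i.d. uniform on $[0,s)$, one for each vertex $i$, independent of everything else. The canonical labeling is $\mathsf{Lbl}(G)=\mathsf{Lbl}_{\sqrt{2e(G)}}(G)$, and $\mathrm{embed}(G)$ is the distribution of $\mathsf{Lbl}(G)$. These are random elements of the space of locally finite counting measures on $\mathbb R_+^2$ with the vague topology (the coarsest topology making $\mu\mapsto\int f\,d\mu$ continuous for all continuous $f$ with bounded support), which is completely metrizable and separable; convergence in distribution is weak convergence with respect to this topology. *)

(* Defs.v *)
From HB Require Import structures.
From mathcomp Require Import all_boot all_order all_algebra generic_quotient.
From mathcomp Require Import all_classical all_reals all_analysis.
From mathcomp Require Import measurable_realfun lra.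

Set Implicit Arguments.
Unset Strict Implicit.
Unset Printing Implicit Defensive.

Import Order.TTheory GRing.Theory Num.Theory.
Import numFieldNormedType.Exports.

Local Open Scope classical_set_scope.
Local Open Scope ring_scope.
Local Open Scope quotient_scope.

(* Loops are the i with adj i i. *)
Record graph := Graph {
  nverts : nat;
  adj : rel 'I_nverts;
  adj_sym : symmetric adj }.

HB.instance Definition _ := gen_eqMixin graph.
HB.instance Definition _ := gen_choiceMixin graph.

(* The condition p.1 < p.2 counts each non-loop edge once and omits loops. *)
Definition edges (G : graph) : nat :=
  #|[set p : 'I_(nverts G) * 'I_(nverts G) | (p.1 < p.2)%N && adj p.1 p.2]|.

Definition isomorphic (G H : graph) : Prop :=
  exists2 f : 'I_(nverts G) -> 'I_(nverts H),
    bijective f & forall i j, adj (f i) (f j) = adj i j.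

Definition isomorphicb : rel graph := fun G H => `[< isomorphic G H >].

Lemma isomorphicb_refl : reflexive isomorphicb.
Proof. by move=> G; apply/asboolP; exists id => //; exists id. Qed.

Lemma isomorphicb_sym : symmetric isomorphicb.
Proof.
suff sub G H : isomorphicb G H -> isomorphicb H G.
  by move=> G H; apply/idP/idP; exact: sub.
move=> /asboolP[f [g fK gK] fadj]; apply/asboolP; exists g; first by exists f.
by move=> i j; rewrite -fadj !gK.
Qed.

Lemma isomorphicb_trans : transitive isomorphicb.
Proof.
move=> H G K /asboolP[f bf fadj] /asboolP[g bg gadj]; apply/asboolP.
exists (g \o f); first exact: bij_comp.
by move=> i j /=; rewrite gadj fadj.
Qed.

Canonical iso_equiv :=
  EquivRel isomorphicb isomorphicb_refl isomorphicb_sym isomorphicb_trans.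

Definition ugraph : Type := discrete_topology {eq_quot iso_equiv}.

Definition empty_graph : graph :=
  @Graph 0 (fun _ _ => false) (fun _ _ => erefl).

Definition unlabel (G : graph) : ugraph := \pi_({eq_quot iso_equiv}) G.

HB.instance Definition _ := DiscreteTopology.on ugraph.
HB.instance Definition _ := isPointed.Build ugraph (unlabel empty_graph).

Definition induced (G : graph) (S : {set 'I_(nverts G)}) : graph :=
  @Graph #|S| (fun i j => adj (enum_val i) (enum_val j))
    (fun i j => adj_sym (enum_val i) (enum_val j)).

(* The witness j may be i itself, so a vertex carrying a loop is kept. *)
Definition rm_isolated (G : graph) : graph :=
  induced [set i : 'I_(nverts G) | [exists j, adj i j]].

Notation borel T := (g_sigma_algebraType (@open T)).

Definition weak_cvg (R : realType) (T : ptopologicalType)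
    (P : nat -> probability (borel T) R) (Q : probability (borel T) R) : Prop :=
  forall f : T -> R, continuous f -> bounded_fun f ->
    (\int[P j]_x f x) @[j --> \oo] --> \int[Q]_x f x.

Definition weakly_convergent (R : realType) (T : ptopologicalType)
    (P : nat -> probability (borel T) R) : Prop :=
  exists Q, weak_cvg P Q.

Section iid.
Context d (T : measurableType d) (R : realType).

Section prodP.
Context d' (T' : measurableType d') (P : probability T R) (Q : probability T' R).
Definition prod_probability : set (T * T') -> \bar R := (P \x Q)%E.
HB.instance Definition _ := Measure.on prod_probability.
Lemma prod_probabilityT : prod_probability setT = 1%E.
Proof.
rewrite -setXTT [LHS]product_measure1E//=.
rewrite (@probability_setT _ _ _ P).
by rewrite -[RHS]mule1; congr (_ * _)%E; exact: probability_setT.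
Qed.
HB.instance Definition _ :=
  Measure_isProbability.Build _ _ _ prod_probability prod_probabilityT.
End prodP.

Definition consT n (x : T * n.-tuple T) : n.+1.-tuple T :=
  [tuple of x.1 :: x.2].

Lemma measurable_consT n : measurable_fun setT (@consT n).
Proof. exact: measurable_cons. Qed.

HB.instance Definition _ n :=
  isMeasurableFun.Build _ _ _ _ (@consT n) (@measurable_consT n).

(* The n-fold product measure, i.e. the joint law of n independent variables of
   law P; see iid_box. *)
Fixpoint iid (P : probability T R) n : probability (n.-tuple T) R :=
  match n with
  | 0 => \d_[tuple]
  | m.+1 => distribution (prod_probability P (iid P m)) (@consT m)
  end.

End iid.

Lemma iid_box d (T : measurableType d) (R : realType) (P : probability T R) n
    (A : 'I_n -> set T) : (forall i, measurable (A i)) ->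
  iid P n [set t | forall i, A i (tnth t i)] = (\prod_(i < n) P (A i))%E.
Proof.
elim: n A => [|n IH] A mA.
  by rewrite big_ord0 /= diracE mem_set//= => -[].
rewrite big_ord_recl -IH// /= /distribution /pushforward.
rewrite -product_measure1E//=; last first.
  rewrite (_ : mkset _ = \bigcap_(i in setT)
      ((fun t : n.-tuple T => tnth t i) @^-1` A (lift ord0 i))).
    apply: fin_bigcap_measurable => // i _; rewrite -[X in measurable X]setTI.
    exact: measurable_tnth.
  by apply/seteqP; split=> t /= tA i; [move=> _|]; apply: tA.
rewrite /prod_probability; congr ((_ \x _)%E _).
apply/seteqP; split=> -[x t] /=.
  move=> tA; split; first exact: (tA ord0).
  by move=> i; have := tA (lift ord0 i); rewrite tnthS.
by move=> [Ax At] i; case: (unliftP ord0 i) => [j|] -> //; rewrite tnthS.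
Qed.

Lemma measurable_tuple_bool n (A : set (n.-tuple bool)) : measurable A.
Proof.
rewrite (_ : A = \bigcup_(t in A) [set t]); last by rewrite bigcup_imset1 image_id.
apply: fin_bigcup_measurable => [|t _]; first exact: finite_finset.
rewrite (_ : [set t] = \bigcap_(i in setT)
    ((fun u : n.-tuple bool => tnth u i) @^-1` [set tnth t i])).
  apply: fin_bigcap_measurable => // i _; rewrite -[X in measurable X]setTI.
  exact: measurable_tnth.
apply/seteqP; split=> [u -> i|u ut]//; apply: eq_from_tnth => i; exact: ut.
Qed.

Definition kept_graph (G : graph) (b : (nverts G).-tuple bool) : borel ugraph :=
  unlabel (rm_isolated (induced [set i | tnth b i])).

Lemma measurable_kept_graph G : measurable_fun setT (@kept_graph G).
Proof. by move=> _ A _; exact: measurable_tuple_bool. Qed.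

HB.instance Definition _ G :=
  isMeasurableFun.Build _ _ _ _ (@kept_graph G) (@measurable_kept_graph G).

(* The law of the random unlabeled graph obtained by p-sampling. *)
Definition Smpl (R : realType) (G : graph) (p : R) :
    probability (borel ugraph) R :=
  distribution (iid (bernoulli_prob (Num.min p 1)) (nverts G)) (@kept_graph G).

Definition side (R : realType) (G : graph) : R := Num.sqrt (2 * (edges G)%:R).

(* If G has no non-loop edge then side R G = 0 and, by the convention x / 0 = 0,
   no vertex is kept; likewise embed R G then puts every label at 0. These values
   are conventional: they occur finitely often when edges (G j) tends to
   infinity. *)
Definition SmplD (R : realType) (G : graph) (s : R) := Smpl G (s / side R G).

Definition sampling_convergent (R : realType) (G : nat -> graph) : Prop :=
  forall s : R, 0 <= s -> weakly_convergent (fun j => SmplD (G j) s).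

Section pconf.
Context (R : realType).

Definition quadrant : set (R * R) := `[0, +oo[ `*` `[0, +oo[.

Lemma measurable_quadrant : measurable quadrant.
Proof. exact: measurableX. Qed.

(* A measure on the closed quadrant is represented by the measure on the plane
   that vanishes outside it; counting measures are those with values in the
   natural numbers or +oo. Two elements of pconf that agree on measurable sets but
   not on other sets are different terms, but they are topologically
   indistinguishable, hence belong to the same Borel sets. *)
Record pconf := PConf {
  pmeasure :> {measure set (R * R) -> \bar R};
  pconf_quadrant : pmeasure (~` quadrant) = 0%E;
  pconf_counting : forall A : set (R * R), measurable A ->
    pmeasure A = +oo%E \/ exists n : nat, pmeasure A = n%:R%:E;
  pconf_locfin : forall A : set (R * R), measurable A -> bounded_set A ->
    (pmeasure A < +oo)%E }.

HB.instance Definition _ := gen_eqMixin pconf.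
HB.instance Definition _ := gen_choiceMixin pconf.

(* Continuity and the support are relative to the quadrant. *)
Record test_fun := TestFun {
  test_val :> R * R -> R;
  test_continuous : {within quadrant, continuous test_val};
  test_bounded_support :
    bounded_set [set z : R * R | quadrant z /\ test_val z != 0] }.

Definition pintegral (mu : pconf) : {ptws test_fun -> R} :=
  fun f => \int[mu]_(z in quadrant) f z.

(* The vague topology: as {ptws test_fun -> R} carries the product topology, this
   is the coarsest topology for which every mu |-> pintegral mu f is
   continuous. *)
HB.instance Definition _ := Topological.copy pconf (initial_topology pintegral).

Definition mzero_pconf : pconf.
Proof.
by apply: (@PConf mzero) => // A *; [right; exists 0%N|rewrite /mzero ltry].
Defined.
HB.instance Definition _ := isPointed.Build pconf mzero_pconf.

End pconf.

Arguments quadrant {R}.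

Lemma epscontinuous_measurable (R : realType) n (T : ptopologicalType)
    (h : n.-tuple (measurableTypeR R) -> borel T) :
  (forall t (U : set T), open U -> U (h t) -> exists2 e : R, 0 < e &
     forall t', (forall i, `|tnth t' i - tnth t i| < e) -> U (h t')) ->
  measurable_fun setT h.
Proof.
move=> hc; apply: (@measurability _ _ _ (borel T) setT h (@open T)) => //.
move=> _ [U oU <-]; rewrite setTI.
pose box (q : n.-tuple rat * rat) : set (n.-tuple (measurableTypeR R)) :=
  [set t | forall i, `|tnth t i - ratr (tnth q.1 i)| < ratr q.2].
have mbox q : measurable (box q).
  rewrite (_ : box q = \bigcap_(i in setT)
      ((fun u : n.-tuple (measurableTypeR R) => tnth u i) @^-1`
        ball (ratr (tnth q.1 i) : R) (ratr q.2))).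
    apply: fin_bigcap_measurable => // i _; rewrite -[X in measurable X]setTI.
    by apply: measurable_tnth => //; by rewrite ball_itv; exact: measurable_itv.
  apply/seteqP; split=> [t tq i _|t tq i].
    by rewrite /= -ball_normE/= distrC tq.
  by have := tq i I; rewrite /= -ball_normE/= distrC.
rewrite (_ : h @^-1` U =
    \bigcup_q (if pselect (box q `<=` h @^-1` U) then box q else set0)).
  apply: countable_bigcupT_measurable => [|q]; first exact: countableP.
  by case: pselect => h0; [exact: mbox|exact: measurable0].
apply/seteqP; split; last first.
  by move=> t [q _]; case: pselect => // /[apply].
move=> t /= Ut; have [e e0 he] := hc _ _ oU Ut.
have e20 : 0 < e / 2 by rewrite divr_gt0.
have [d] := rat_in_itvoo e20; rewrite in_itv/= => /andP[d0 de].
have [c cP] : {c : 'I_n -> rat & forall i, `|tnth t i - ratr (c i)| < ratr d}.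
  apply: (@choice _ _ (fun i c => `|tnth t i - ratr c| < ratr d)) => i.
  have /rat_in_itvoo[c] : (tnth t i : R) < tnth t i + ratr d by rewrite ltrDl.
  rewrite in_itv/= => /andP[c1 c2]; exists c.
  by rewrite ltr_distlC (lt_le_trans _ (ltW c1)) ?ltrBlDr ?ltrDl//.
exists ([tuple c i | i < n], d) => //; case: pselect => [_ i|].
  by rewrite tnth_mktuple.
case=> t' /= t'b; apply: he => i.
rewrite (splitr e) -[X in `|X|](subrKA (ratr (c i))).
apply: (le_lt_trans (ler_normD _ _)); apply: ltrD.
  by have := t'b i; rewrite /= tnth_mktuple => /lt_trans; apply.
by rewrite distrC (lt_trans (cP i)).
Qed.

Lemma epscontinuous_measurableR (R : realType) (g : R * R -> R) :
  continuous g -> measurable_fun setT g.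
Proof.
move=> gc.
pose h (t : 2.-tuple (measurableTypeR R)) : borel R :=
  g (tnth t ord0, tnth t ord_max).
have mh : measurable_fun setT h.
  apply: epscontinuous_measurable => t U oU Ut.
  have := gc (tnth t ord0, tnth t ord_max) U (open_nbhs_nbhs (conj oU Ut)).
  move=> /nbhs_ballP[e /= e0 eU]; exists e => // t' t't; apply: eU.
  by split; rewrite /= -ball_normE /= distrC.
pose k (z : R * R) : 2.-tuple (measurableTypeR R) :=
  [tuple of z.1 :: [tuple of z.2 :: [tuple]]].
have mk : measurable_fun setT k.
  apply: measurable_cons => //; apply: measurable_cons => //.
rewrite (_ : g = h \o k); last by apply/funext => -[x y].
apply: (measurability _ (RGenOpens.measurableE R)).
move=> _ [_ [a [b ->] <-]]; rewrite setTI comp_preimage -[X in measurable X]setTI.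
apply: mk => //; rewrite -[X in measurable X]setTI; apply: mh => //.
by apply: sub_sigma_algebra; exact: interval_open.
Qed.

Section pconf_theory.
Context (R : realType).

(* uniform_prob is uniform on the closed interval [0, s], which differs from
   [0, s) by a null set; the value for s <= 0 is conventional. *)
Definition uniform_law (s : R) : probability (measurableTypeR R) R :=
  if pselect (0 < s) is left s0
  then [the probability _ _ of uniform_prob s0]
  else [the probability _ _ of \d_(0 : measurableTypeR R)].

(* Labels are almost surely nonnegative; clamp only makes the labeling a total
   function with values in the configurations on the quadrant. *)
Definition clamp (x : R) : R := Num.max 0 x.

Section Lbl.
Context (G : graph).
Implicit Type u : (nverts G).-tuple (measurableTypeR R).

Definition edge_point u (p : 'I_(nverts G) * 'I_(nverts G)) : R * R :=
  (clamp (tnth u p.1), clamp (tnth u p.2)).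

(* The sum over ordered pairs p counts each non-loop edge in both orientations and
   each loop once. *)
Definition lbl_measure u (A : set (R * R)) : \bar R :=
  (\sum_(p : 'I_(nverts G) * 'I_(nverts G) | adj p.1 p.2)
     \d_(edge_point u p) A)%E.

Let es : seq ('I_(nverts G) * 'I_(nverts G)) :=
  [seq p <- index_enum _ | adj p.1 p.2].

Let ms u (k : nat) : {measure set (R * R) -> \bar R} :=
  [the {measure set _ -> \bar _} of \d_(nth (0, 0) (map (edge_point u) es) k)].

Lemma lbl_measureE u : lbl_measure u = msum (ms u) (size es).
Proof.
apply/funext => A; rewrite /lbl_measure /msum -big_filter -/es.
rewrite -(big_map (edge_point u) xpredT (fun x => \d_x A)).
by rewrite (big_nth (0,0)) size_map big_mkord; apply: eq_bigr.
Qed.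

Let lbl0 u : lbl_measure u set0 = 0%E.
Proof. by rewrite lbl_measureE measure0. Qed.
Let lbl_ge0 u A : (0 <= lbl_measure u A)%E.
Proof. by rewrite lbl_measureE; exact: measure_ge0. Qed.
Let lbl_sigma_additive u : semi_sigma_additive (lbl_measure u).
Proof. by rewrite lbl_measureE; exact: measure_semi_sigma_additive. Qed.

HB.instance Definition _ u := isMeasure.Build _ _ _ (lbl_measure u)
  (lbl0 u) (lbl_ge0 u) (@lbl_sigma_additive u).

Lemma lbl_measure_nat u A : exists n : nat, lbl_measure u A = n%:R%:E.
Proof.
exists (\sum_(p : 'I_(nverts G) * 'I_(nverts G) | adj p.1 p.2)
   (edge_point u p \in A))%N.
rewrite natr_sum -sumEFin; apply: eq_bigr => p _.
by rewrite diracE; case: (_ \in A).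
Qed.

Lemma edge_point_quadrant u p : quadrant (edge_point u p).
Proof. by split; rewrite /= in_itv/= andbT /clamp le_max lexx. Qed.

Lemma lbl_measure_quadrant u : lbl_measure u (~` quadrant) = 0%E.
Proof.
rewrite /lbl_measure big1// => p _; rewrite diracE memNset//.
by apply; exact: edge_point_quadrant.
Qed.

Lemma lbl_measure_locfin u (A : set (R * R)) :
  measurable A -> bounded_set A -> (lbl_measure u A < +oo)%E.
Proof. by move=> _ _; have [n ->] := lbl_measure_nat u A; rewrite ltry. Qed.

Definition labeling u : borel (pconf R) :=
  @PConf R [the {measure set _ -> \bar _} of lbl_measure u]
    (lbl_measure_quadrant u)
    (fun A _ => or_intror (lbl_measure_nat u A))
    (@lbl_measure_locfin u).

Lemma lbl_integral u (g : R * R -> R) : measurable_fun setT g ->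
  \int[lbl_measure u]_(z in quadrant) g z =
  \sum_(p : 'I_(nverts G) * 'I_(nverts G) | adj p.1 p.2) g (edge_point u p).
Proof.
move=> mg; rewrite /Rintegral.
have mG : measurable_fun quadrant (fun z => (g z)%:E).
  by apply/measurable_EFinP; exact: measurable_funTS.
have H (f : R * R -> \bar R) : measurable_fun quadrant f -> (forall x, 0 <= f x)%E ->
    (\int[lbl_measure u]_(z in quadrant) f z =
     \sum_(p : 'I_(nverts G) * 'I_(nverts G) | adj p.1 p.2) f (edge_point u p))%E.
  move=> mf f0.
  rewrite (@eq_measure_integral _ _ _ _
    [the measure _ _ of msum (ms u) (size es)]).
    rewrite ge0_integral_measure_sum//; last exact: measurable_quadrant.
    rewrite -[RHS]big_filter -/es -(big_map (edge_point u) xpredT f).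
    rewrite (big_nth (0,0)) size_map big_mkord; apply: eq_bigr => k _.
    rewrite integral_dirac//; last exact: measurable_quadrant.
    rewrite diracE mem_set ?mul1e//.
    have /mapP[p _ ->] : nth (0, 0) (map (edge_point u) es) k
        \in map (edge_point u) es.
      by rewrite mem_nth// size_map.
    exact: edge_point_quadrant.
  by move=> A _ _; exact: (congr1 (@^~ A) (lbl_measureE u)).
rewrite integralE !H//; [|exact: measurable_funeneg|exact: measurable_funepos].
rewrite [X in (X - _)%E](_ : _ =
  (\sum_(p : 'I_(nverts G) * 'I_(nverts G) | adj p.1 p.2)
   Num.max (g (edge_point u p)) 0)%:E); last first.
  by rewrite -sumEFin; apply: eq_bigr => p _; rewrite funeposE EFin_max.
rewrite [X in (_ - X)%E](_ : _ =
  (\sum_(p : 'I_(nverts G) * 'I_(nverts G) | adj p.1 p.2)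
   Num.max (- g (edge_point u p)) 0)%:E); last first.
  by rewrite -sumEFin; apply: eq_bigr => p _; rewrite funenegE EFin_max.
rewrite -EFinB /= -sumrB; apply: eq_bigr => p _.
by case: (leP 0 (g _)) => h; rewrite ?maxEle; case: ifP; lra.
Qed.

Definition clamped (f : R * R -> R) (z : R * R) : R := f (clamp z.1, clamp z.2).

Lemma clamp_lip (x y : R) : `|clamp x - clamp y| <= `|x - y|.
Proof.
rewrite /clamp; case: (leP 0 x) => x0; case: (leP 0 y) => y0.
- by [].
- rewrite subr0 !ger0_norm//; lra.
- by rewrite sub0r normrN ger0_norm// distrC ger0_norm; lra.
- by rewrite subrr normr0.
Qed.

Lemma clamped_near (f : R * R -> R) (z : R * R) (U : set R) :
  {within quadrant, continuous f} -> nbhs (clamped f z) U ->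
  exists2 e : R, 0 < e & forall z' : R * R,
    `|z'.1 - z.1| < e -> `|z'.2 - z.2| < e -> U (clamped f z').
Proof.
move=> /subspace_continuousP fc Uz.
have qc (y : R * R) : quadrant (clamp y.1, clamp y.2).
  by split; rewrite /= in_itv/= andbT /clamp le_max lexx.
have /nbhs_ballP[e /= e0 eU] := fc _ (qc z) U Uz.
exists e => // z' z1 z2; apply: eU; last exact: qc.
by split; rewrite /= -ball_normE /= distrC (le_lt_trans (clamp_lip _ _)).
Qed.

Lemma clamped_continuous (f : R * R -> R) :
  {within quadrant, continuous f} -> continuous (clamped f).
Proof.
move=> fc z U /(clamped_near fc)[e e0 eU]; apply/nbhs_ballP; exists e => //.
move=> z' [] /=; rewrite -!ball_normE /= => z1 z2.
by apply: eU; rewrite distrC.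
Qed.

Lemma clamp_id x : 0 <= x -> clamp x = x.
Proof. by move=> /max_idPr. Qed.

Lemma clamp_ge0 x : 0 <= clamp x.
Proof. by rewrite /clamp le_max lexx. Qed.

Lemma measurable_labeling : measurable_fun setT labeling.
Proof.
apply: epscontinuous_measurable => u _ [V oV <-] Vu.
pose nearu : set_system ((nverts G).-tuple (measurableTypeR R)) :=
  filter_from [set e : R | 0 < e]
    (fun e => [set t | forall i, `|tnth t i - tnth u i| < e]).
have Fu : Filter nearu.
  apply: filter_from_filter; first by exists 1 => /=.
  move=> d e /= d0 e0; exists (Num.min d e); first by rewrite /= lt_min d0.
  by move=> t tde; split=> i; have := tde i; rewrite lt_min => /andP[].
suff : (fun t => pintegral (labeling t)) @ nearu --> pintegral (labeling u).
  move/(_ V (open_nbhs_nbhs (conj oV Vu))) => [e /= e0 eV].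
  by exists e.
apply/cvg_sup => f.
move=> A; rewrite nbhsE => -[D [[C oC <-] Cf]] /filterS; apply.
suff : (fun t => pintegral (labeling t) f) @ nearu --> pintegral (labeling u) f.
  by apply; exact: open_nbhs_nbhs.
have E t : pintegral (labeling t) f =
    \sum_(p : 'I_(nverts G) * 'I_(nverts G) | adj p.1 p.2)
      clamped f (tnth t p.1, tnth t p.2).
  transitivity (\int[lbl_measure t]_(z in quadrant) clamped f z); last first.
    rewrite lbl_integral; last first.
      apply: epscontinuous_measurableR; apply: clamped_continuous.
      exact: (@test_continuous R f).
    by apply: eq_bigr => p _; rewrite /clamped/= !(clamp_id (clamp_ge0 _)).
  apply: eq_Rintegral => -[x y] /set_mem[] /=.
  by rewrite !in_itv/= !andbT /clamped /= => x0 y0; rewrite !clamp_id.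
under eq_fun do rewrite E.
rewrite E; apply: cvg_big; first exact: add_continuous.
move=> p _ U; move=> /(clamped_near (@test_continuous _ f))[e e0 eU].
by exists e => // t tu; apply: eU; exact: tu.
Qed.

HB.instance Definition _ :=
  isMeasurableFun.Build _ _ _ _ labeling measurable_labeling.

(* The law of the random counting measure Lbl_s(G). *)
Definition Lbl (s : R) : probability (borel (pconf R)) R :=
  distribution (iid (uniform_law s) (nverts G)) labeling.
End Lbl.

Definition embed (G : graph) : probability (borel (pconf R)) R :=
  Lbl G (side R G).

(* The law of Lbl_r(H) for H of law eta and labels independent of H; the law of
   Lbl_r does not depend on the representative of the isomorphism class. *)
Definition Lbl_mix (r : R) (eta : probability (borel ugraph) R)
    (A : set (borel (pconf R))) : \bar R :=
  (\int[eta]_H Lbl (repr (H : {eq_quot iso_equiv})) r A)%E.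

Definition square (r : R) : set (R * R) := `[0, r[ `*` `[0, r[.

Lemma measurable_square r : measurable (square r).
Proof. exact: measurableX. Qed.

Section restrict_square.
Context (r : R) (mu : borel (pconf R)).
Let nu := mrestr (mu : pconf R) (measurable_square r).

Lemma restrict_square_quadrant : nu (~` quadrant) = 0%E.
Proof.
have mQ : measurable (~` quadrant : set (R * R)).
  by apply: measurableC; exact: measurable_quadrant.
apply/eqP; rewrite -measure_le0 -(pconf_quadrant (mu : pconf R)).
exact: (measureIl mu mQ (measurable_square r)).
Qed.

Lemma restrict_square_counting (A : set (R * R)) : measurable A ->
  nu A = +oo%E \/ exists n : nat, nu A = n%:R%:E.
Proof.
move=> mA; apply: pconf_counting; exact: measurableI (measurable_square r).
Qed.

Lemma restrict_square_locfin (A : set (R * R)) :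
  measurable A -> bounded_set A -> (nu A < +oo)%E.
Proof.
move=> mA bA; have := pconf_locfin (mu : pconf R) mA bA; apply: le_lt_trans.
exact: (measureIl mu mA (measurable_square r)).
Qed.

Definition restrict_square : borel (pconf R) :=
  @PConf R [the {measure set _ -> \bar _} of nu]
    restrict_square_quadrant restrict_square_counting restrict_square_locfin.
End restrict_square.
End pconf_theory.

(* Main.v *)
(* For s <= sqrt (2 e(G)), keeping the vertices with label below s is an
   s-sampling, and given the kept vertices their labels are uniform on [0, s); so
   the restriction of Lbl(G) to [0, s)^2 is distributed as Lbl_s(H) with H of law
   SmplD(G, s).

   If the samples converge, then so do, on every Borel set, the laws of the
   restrictions to [0, M)^2, as a weak limit on a discrete space is a limit on
   every set of graphs. The limits for different M are consistent. Up to
   coincidence on measurable sets, a configuration is encoded by bits, which makes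
   the limits extend to the law of a configuration on the quadrant. Weak
   convergence to it follows because an open set is the increasing union of the
   sets of configurations whose first N cell counts force membership in it, and
   these only depend on the restriction to a large square. Together with the
   uniqueness of weak limits on Borel sets this also identifies the limit law.

   Conversely, divide [0, s)^2 into a grid. If the labels of a graph without
   isolated vertices fall well inside distinct cells, then the nonempty cells of
   the grid recover the graph. Replacing nonemptiness by a continuous function of
   the configuration bounds SmplD(G_j, s)(A), up to an error that is small when the
   sample has few vertices compared with the size of the grid, by the integral of a
   bounded continuous function; doing so for A and for its complement shows that
   the masses of A form a Cauchy sequence. The number of vertices of the sample is
   tight because it is at most the mass of the square. *)

From HB Require Import structures.
From mathcomp Require Import all_boot all_order all_algebra generic_quotient.
From mathcomp Require Import all_classical all_reals all_analysis.
From mathcomp Require Import measurable_realfun lra.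
Require Import Defs.

Set Implicit Arguments.
Unset Strict Implicit.
Unset Printing Implicit Defensive.

Import Order.TTheory GRing.Theory Num.Theory.
Import numFieldNormedType.Exports.

Local Open Scope classical_set_scope.
Local Open Scope ring_scope.
Local Open Scope quotient_scope.

(** The vague topology enters only through countably many numbers, the counts in half-open grid
    cells. A set given by prescribed counts need not be open or closed, because a point may sit on
    the edge of a cell; but every vague neighbourhood of a configuration contains all configurations
    that share enough counts with it. Since the laws restricted to a square converge on every Borel
    set, and not only on sets with negligible boundary, such irregular sets still serve in the
    portmanteau criterion.

    Gluing the limits on squares becomes, after coding, a matter of consistent masses on binary
    words, realised by splitting intervals of [[0, 1[]. To make the coding canonical, the points of
    each annular shell are sorted by an injective real code.

    In the converse, labels near a grid line or in a common cell spoil the recovery of the graph.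
    With [M] cells per side and margins of [1 / M] of a cell, each of [k] labels loses at most
    [k / M] to collisions and [2 / M] to margins, whence the bound [1 - k (k + 2) / M]. *)

(** * Independent labels: boxes and selected coordinates *)

Section iid_theory.
Context (R : realType) d (T : measurableType d).

Lemma measurable_tuple_box n (A : 'I_n -> set T) :
  (forall i, measurable (A i)) ->
  measurable [set t : n.-tuple T | forall i, A i (tnth t i)].
Proof.
move=> mA; rewrite (_ : mkset _ = \bigcap_(i in setT)
    ((fun t : n.-tuple T => tnth t i) @^-1` (A i))).
  apply: fin_bigcap_measurable => // i _; rewrite -[X in measurable X]setTI.
  exact: measurable_tnth.
by apply/seteqP; split=> [t tA i _|t tA i]; exact: tA.
Qed.

Lemma tuple_measure_unique n (m1 m2 : {measure set (n.-tuple T) -> \bar R}) :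
  (m1 setT < +oo)%E ->
  (forall A : 'I_n -> set T, (forall i, measurable (A i)) ->
    m1 [set t | forall i, A i (tnth t i)] =
    m2 [set t | forall i, A i (tnth t i)]) ->
  forall C, measurable C -> m1 C = m2 C.
Proof.
move=> fin1 box12 C mC.
pose G : set (set (n.-tuple T)) :=
  [set [set t | forall i, A i (tnth t i)] | A in
    [set A : 'I_n -> set T | forall i, measurable (A i)]].
apply: (measure_unique G (fun=> setT)) => //.
- apply/seteqP; split.
    apply: smallest_sub; first exact: smallest_sigma_algebra.
    rewrite -bigcup_seq => X [i /= _ [A mA <-]].
    apply: sub_sigma_algebra.
    exists (fun j => if j == i then A else setT) => [j /=|]; first by case: ifP.
    rewrite setTI; apply/seteqP; split=> [t /(_ i)|t tA j]; rewrite /= ?eqxx//.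
    by case: eqP => // ->.
  apply: smallest_sub; first exact: sigma_algebra_measurable.
  by move=> _ [A mA <-]; exact: measurable_tuple_box.
- move=> _ _ [A mA <-] [B mB <-]; exists (fun i => A i `&` B i).
    by move=> i; apply: measurableI.
  apply/seteqP; split=> [t tAB|t [tA tB] i]; last by split.
  by split=> i; have [] := tAB i.
- by move=> _; exists (fun=> setT) => //; apply/seteqP.
- by rewrite bigcup_const//; exists 0%N.
- by move=> _ [A mA <-]; exact: box12.
Qed.

Definition subtuple m n (f : 'I_m -> 'I_n) (t : n.-tuple T) : m.-tuple T :=
  [tuple tnth t (f i) | i < m].

Lemma measurable_subtuple m n (f : 'I_m -> 'I_n) :
  measurable_fun setT (subtuple f).
Proof.
apply/measurable_fun_tnthP => i.
rewrite (_ : _ \o _ = fun t : n.-tuple T => tnth t (f i)).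
  exact: measurable_tnth.
by apply/funext => t /=; rewrite tnth_mktuple.
Qed.

HB.instance Definition _ m n f :=
  isMeasurableFun.Build _ _ _ _ (@subtuple m n f) (@measurable_subtuple m n f).

(** Conditioning coordinate by coordinate: if [P] given [D (f j)] is [Q], then given all the
    conditions [D i] the selected coordinates are i.i.d. of law [Q]. Independence makes both sides
    products on boxes, and boxes determine a finite measure. In the application [D i] says that a
    label lies below [s], or that it does not. *)
Lemma iid_subtuple m n (f : 'I_m -> 'I_n) (P Q : probability T R)
    (D : 'I_n -> set T) (c : 'I_n -> R) (C : set (m.-tuple T)) :
  injective f -> (forall i, measurable (D i)) -> (forall i, 0 <= c i) ->
  (forall i, P (D i) = (c i)%:E) ->
  (forall j B, measurable B -> P (D (f j) `&` B) = ((c (f j))%:E * Q B)%E) ->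
  measurable C ->
  iid P n [set t | (forall i, D i (tnth t i)) /\ C (subtuple f t)] =
  ((\prod_i c i)%:E * iid Q m C)%E.
Proof.
move=> finj mD c0 PD PDB mC.
have c00 : 0 <= \prod_i c i by apply: prodr_ge0.
have mDD := measurable_tuple_box mD.
pose m1 := pushforward (mrestr (iid P n) mDD) (subtuple f).
pose m2 := mscale (NngNum c00) (iid Q m).
have m1E X : measurable X -> m1 X =
    iid P n [set t | (forall i, D i (tnth t i)) /\ X (subtuple f t)].
  move=> mX; rewrite /m1 /pushforward /mrestr; congr (iid P n _).
  by apply/seteqP; split=> t /= [].
rewrite -m1E//; change (m1 C = m2 C); move: C mC.
apply: (@tuple_measure_unique m m1 m2).
  rewrite /m1 /pushforward /mrestr.
  by rewrite (le_lt_trans (probability_le1 _ _)) ?ltry// preimage_setT setTI.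
move=> A mA; apply: (etrans (m1E _ (measurable_tuple_box mA))).
(* The box in [m] coordinates becomes one in [n] coordinates by leaving those outside the image of
   [f] free. *)
pose A' i := if [pick j | f j == i] is Some j then A j else setT.
have A'f j : A' (f j) = A j.
  rewrite /A'; case: pickP => [j' /eqP/finj -> //|/(_ j)].
  by rewrite eqxx.
have mA' i : measurable (A' i) by rewrite /A'; case: pickP.
rewrite (_ : mkset _ = [set t | forall i, (D i `&` A' i) (tnth t i)]); last first.
  apply/seteqP; split=> [t [/= tD tA] i|t /= tDA].
    split; first exact: tD.
    rewrite /A'; case: pickP => // j /eqP <-.
    by have := tA j; rewrite tnth_mktuple.
  split=> i; first by have [] := tDA i.
  by rewrite tnth_mktuple; have [_] := tDA (f i); rewrite A'f.
have mDA i : measurable (D i `&` A' i) by exact: measurableI.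
apply: (etrans (iid_box P mDA)).
transitivity ((\prod_i c i)%:E * \prod_(j < m) Q (A j))%E; last first.
  by rewrite -(iid_box Q mA).
pose q i : \bar R := if [pick j | f j == i] is Some j then Q (A j) else 1%E.
rewrite (eq_bigr (fun i => ((c i)%:E * q i)%E)); last first.
  move=> i _; rewrite /A' /q; case: pickP => [j /eqP <-|_]; first exact: PDB.
  by rewrite setIT mule1 PD.
have qfin i : q i \is a fin_num.
  by rewrite /q; case: pickP => // j _; exact: fin_num_measure.
have -> : (\prod_(i < n) ((c i)%:E * q i) = (\prod_i c i)%:E * \prod_i q i)%E.
  by rewrite big_split/= prodEFin.
congr (_ * _)%E.
rewrite (bigID [pred i | i \in codom f])/= [X in (_ * X)%E]big1 ?mule1; last first.
  move=> i /negP icod; rewrite /q; case: pickP => // j /eqP fj.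
  by case: icod; rewrite -fj codom_f.
have -> : (\prod_(i in codom f) q i = \prod_(j < m) q (f j))%E.
  rewrite -big_filter.
  rewrite -[RHS](big_map f xpredT q).
  apply: perm_big; apply: uniq_perm.
  - by rewrite filter_uniq// index_enum_uniq.
  - by rewrite map_inj_uniq// index_enum_uniq.
  - move=> i; rewrite mem_filter mem_index_enum andbT.
    by apply/codomP/mapP => [[j ->]|[j _ ->]]; exists j => //; rewrite mem_index_enum.
apply: eq_bigr => j _; rewrite /q; case: pickP => [j' /eqP/finj -> //|/(_ j)].
by rewrite eqxx.
Qed.

Lemma iid_injective m n (f : 'I_m -> 'I_n) (P : probability T R)
    (C : set (m.-tuple T)) : injective f -> measurable C ->
  iid P n [set t | C (subtuple f t)] = iid P m C.
Proof.
move=> finj mC.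
have := @iid_subtuple m n f P P (fun=> setT) (fun=> 1) C finj.
rewrite big1// mul1e => <-//.
- by congr (iid P n _); apply/seteqP; split=> t //= [].
- by move=> i; exact: probability_setT.
- by move=> j B mB; rewrite setTI mul1e.
Qed.

End iid_theory.

(** * Borel sets of configurations *)

Section pconf_borel.
Context (R : realType).
Implicit Type mu nu : pconf R.

(** Although unbounded, a corner has finite mass under every configuration, as the mass lives on the
    quadrant. Corners form an intersection-stable generator of the Borel sets, and their indicators
    are increasing limits of continuous functions. *)
Definition corner (a b : R) : set (R * R) := [set z | z.1 < a /\ z.2 < b].

Lemma measurable_corner a b : measurable (corner a b).
Proof.
rewrite (_ : corner a b = `]-oo, a[ `*` `]-oo, b[); first exact: measurableX.
by apply/seteqP; split=> z /=; rewrite /corner /= !in_itv.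
Qed.

Lemma cornerI a b a' b' :
  corner a b `&` corner a' b' = corner (Num.min a a') (Num.min b b').
Proof.
apply/seteqP; split=> -[x y] /=; rewrite /corner/= !lt_min.
  by move=> [[-> ->] [-> ->]].
by move=> [/andP[-> ->] /andP[-> ->]].
Qed.

Definition corners : set (set (R * R)) :=
  [set corner p.1 p.2 | p in [set: R * R]].

Lemma measurable_corners : @measurable _ (R * R)%type = <<s corners >>.
Proof.
apply/seteqP; split; last first.
  apply: smallest_sub; first exact: sigma_algebra_measurable.
  by move=> _ [p _ <-]; exact: measurable_corner.
have mfs (f : g_sigma_algebraType corners -> measurableTypeR R) :
    (forall x, <<s corners >> [set z | f z < x]) -> measurable_fun setT f.
  move=> fx; apply: (measurability _ (RGenInftyO.measurableE R)).
  move=> _ [_ [x ->] <-]; rewrite setTI.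
  rewrite (_ : f @^-1` _ = [set z | f z < x]); first exact: fx.
  by apply/seteqP; split=> z /=; rewrite in_itv.
have corner_nat x : exists n : nat, x < n%:R :> R.
  by exists (Num.truncn x).+1; exact: Num.Theory.truncnS_gt.
have m1 : measurable_fun setT (fst : g_sigma_algebraType corners -> measurableTypeR R).
  apply: mfs => x.
  rewrite (_ : mkset _ = \bigcup_n corner x n%:R).
    apply: (@bigcupT_measurable _ (g_sigma_algebraType corners)) => n.
    by apply: sub_sigma_algebra; exists (x, n%:R).
  apply/seteqP; split=> [[u v] /= ux|[u v] [n _] []//].
  by have [n vn] := corner_nat v; exists n.
have m2 : measurable_fun setT (snd : g_sigma_algebraType corners -> measurableTypeR R).
  apply: mfs => x.
  rewrite (_ : mkset _ = \bigcup_n corner n%:R x).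
    apply: (@bigcupT_measurable _ (g_sigma_algebraType corners)) => n.
    by apply: sub_sigma_algebra; exists (n%:R, x).
  apply/seteqP; split=> [[u v] /= ux|[u v] [n _] []//].
  by have [n vn] := corner_nat u; exists n.
move=> A mA; have := measurable_fun_pair m1 m2 measurableT mA.
rewrite setTI (_ : _ @^-1` A = A)//.
by apply/seteqP; split=> -[].
Qed.

Lemma pconfIquadrant mu (A : set (R * R)) : measurable A ->
  mu (A `&` quadrant) = mu A.
Proof.
move=> mA; have mQ : measurable (~` quadrant : set (R * R)).
  by apply: measurableC; exact: measurable_quadrant.
rewrite -[in RHS](setIT A) -(setUv quadrant) setIUr.
rewrite measureU; [|exact: measurableI mA (@measurable_quadrant R)
  |exact: measurableI|by rewrite setIACA setICr setI0].
rewrite [X in (_ + X)%E](_ : _ = 0%E) ?adde0//.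
apply/eqP; rewrite -measure_le0 -(pconf_quadrant mu); apply: le_measure.
- by rewrite inE; exact: measurableI.
- by rewrite inE.
- by move=> z [].
Qed.

Lemma bounded_quadrant (A : set (R * R)) (c : R) :
  (forall z, A z -> quadrant z /\ (z.1 <= c /\ z.2 <= c)) -> bounded_set A.
Proof.
move=> Ac; exists c; split; first exact: num_real.
move=> M cM z /= /Ac[[]]; rewrite /= !in_itv/= !andbT => z1 z2 [z1c z2c].
rewrite prod_normE/= ge_max !ger0_norm//.
by rewrite !(le_trans _ (ltW cM)).
Qed.

Lemma pconf_corner_fin mu a b : (mu (corner a b) < +oo)%E.
Proof.
rewrite -pconfIquadrant; last exact: measurable_corner.
apply: pconf_locfin.
  exact: measurableI (measurable_corner a b) (@measurable_quadrant R).
apply: (@bounded_quadrant _ (Num.max a b)) => z [[z1 z2] qz]; split => //.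
by rewrite !le_max !(ltW z1, ltW z2) orbT.
Qed.

Lemma pconf_nat mu (A : set (R * R)) a b : measurable A -> A `<=` corner a b ->
  exists n : nat, mu A = n%:R%:E.
Proof.
move=> mA Aab; have [muA|//] := pconf_counting mu mA.
have := pconf_corner_fin mu a b; rewrite ltNge => /negP[].
rewrite -muA; apply: le_measure => //; rewrite inE//.
exact: measurable_corner.
Qed.

(** As [k] grows this increases to the indicator of [x < a]. It serves both for corners of the plane
    and for strict inequalities on test integrals. *)
Definition ramp (k : nat) (a x : R) : R :=
  Num.min 1 (k%:R * Num.max 0 (a - x)).

Lemma ramp_ge0 k a x : 0 <= ramp k a x.
Proof. by rewrite /ramp le_min ler01 mulr_ge0// le_max lexx. Qed.

Lemma ramp_le1 k a x : ramp k a x <= 1.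
Proof. by rewrite /ramp ge_min lexx. Qed.

Lemma ramp_eq0 k a x : a <= x -> ramp k a x = 0.
Proof.
by move=> ax; rewrite /ramp max_l ?subr_le0// mulr0 min_r ?ler01.
Qed.

Lemma ramp_homo a x : {homo (fun k => ramp k a x) : m n / (m <= n)%N >-> m <= n}.
Proof.
move=> m n mn; rewrite /ramp le_min ge_min lexx/= ge_min; apply/orP; right.
by rewrite ler_wpM2r ?ler_nat// le_max lexx.
Qed.

Lemma ramp_near1 a x : x < a -> \forall k \near \oo, ramp k a x = 1.
Proof.
move=> xa; have ax0 : 0 < a - x by rewrite subr_gt0.
near=> k; rewrite /ramp [Num.max _ _]max_r ?ltW// min_l//.
rewrite -ler_pdivrMr// mul1r; near: k.
exact: nbhs_infty_ger.
Unshelve. all: by end_near. Qed.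

Lemma continuous_minr (T : topologicalType) (f g : T -> R) :
  continuous f -> continuous g -> continuous (fun x => Num.min (f x) (g x)).
Proof. by move=> fc gc x; exact: (@continuous_min R T f g x (fc x) (gc x)). Qed.

Lemma continuous_maxr (T : topologicalType) (f g : T -> R) :
  continuous f -> continuous g -> continuous (fun x => Num.max (f x) (g x)).
Proof. by move=> fc gc x; exact: (@continuous_max R T f g x (fc x) (gc x)). Qed.

Lemma continuous_mulr (T : topologicalType) (f g : T -> R) :
  continuous f -> continuous g -> continuous (fun x => f x * g x).
Proof. by move=> fc gc x; apply: (@continuousM R T f g x); [exact: fc|exact: gc]. Qed.

Lemma ramp_continuous k a : continuous (ramp k a).
Proof.
apply: continuous_minr; first by move=> x; exact: cvg_cst.
apply: continuous_mulr; first by move=> x; exact: cvg_cst.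
apply: continuous_maxr; first by move=> x; exact: cvg_cst.
by move=> x; apply: continuousB; [exact: cvg_cst|exact: cvg_id].
Qed.

Lemma prod_test_continuous (g h : R -> R) :
  continuous g -> continuous h ->
  continuous (fun z : R * R => g z.1 * h z.2 : R).
Proof.
move=> gc hc z; apply: (@continuousM _ _ (g \o fst) (h \o snd)).
  by apply: continuous_comp; [exact: cvg_fst|exact: gc].
by apply: continuous_comp; [exact: cvg_snd|exact: hc].
Qed.

Section prod_test.
Variables (g h : R -> R) (c : R).
Hypotheses (gc : continuous g) (hc : continuous h).
Hypotheses (g0 : forall x, c < x -> g x = 0) (h0 : forall x, c < x -> h x = 0).

Lemma prod_test_support : bounded_set
  [set z : R * R | quadrant z /\ (fun z => g z.1 * h z.2 : R) z != 0].
Proof.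
apply: (@bounded_quadrant _ c) => z [qz]; rewrite mulf_eq0 negb_or => /andP[gz hz].
split => //; split; rewrite leNgt; apply/negP.
  by move/g0/eqP; rewrite (negbTE gz).
by move/h0/eqP; rewrite (negbTE hz).
Qed.

Definition prod_test : test_fun R :=
  TestFun (continuous_subspaceT (prod_test_continuous gc hc)) prod_test_support.
End prod_test.

Definition corner_test k a b : test_fun R :=
  @prod_test (ramp k a) (ramp k b) (Num.max a b)
    (@ramp_continuous k a) (@ramp_continuous k b)
    (fun x h => ramp_eq0 k (ltW (proj1 (andP (etrans (esym (gt_max _ _ _)) h)))))
    (fun x h => ramp_eq0 k (ltW (proj2 (andP (etrans (esym (gt_max _ _ _)) h))))).

End pconf_borel.

Section pconf_measurable.
Context (R : realType).
Implicit Type mu nu : pconf R.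

Lemma measurable_corner_test k a b D :
  measurable_fun D (fun z => (corner_test k a b z : R)%:E).
Proof.
apply/measurable_EFinP/measurable_funTS; apply: epscontinuous_measurableR.
by apply: prod_test_continuous; exact: ramp_continuous.
Qed.

Lemma corner_test_ge0 k a b (z : R * R) : 0 <= corner_test k a b z.
Proof. by rewrite mulr_ge0// ramp_ge0. Qed.

Lemma integral_corner mu a b :
  (\int[mu]_(z in quadrant) (\1_(corner a b) z)%:E = mu (corner a b))%E.
Proof.
rewrite integral_indic//; [|exact: measurable_quadrant|exact: measurable_corner].
by rewrite pconfIquadrant//; exact: measurable_corner.
Qed.

Lemma integral_corner_test mu k a b :
  (\int[mu]_(z in quadrant) (corner_test k a b z)%:E)%E =
    (pintegral mu (corner_test k a b))%:E.
Proof.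
have f_corner (z : R * R) : quadrant z ->
    ((corner_test k a b z)%:E <= (\1_(corner a b) z)%:E)%E.
  move=> _; rewrite lee_fin indicE; case: (boolP (z \in _)) => [_|].
    by rewrite /= -(mulr1 (1 : R)) ler_pM// ?ramp_ge0 ?ramp_le1.
  rewrite notin_setE/= => /not_andP[] /negP; rewrite -leNgt => h.
    by rewrite ramp_eq0// mul0r.
  by rewrite [X in _ * X]ramp_eq0// mulr0.
rewrite /pintegral /Rintegral fineK// ge0_fin_numE; last first.
  by apply: integral_ge0 => z _; rewrite lee_fin corner_test_ge0.
apply: le_lt_trans (pconf_corner_fin mu a b); rewrite -integral_corner.
apply: ge0_le_integral => //; [exact: measurable_quadrant
  |by move=> z _; rewrite lee_fin corner_test_ge0|exact: measurable_corner_test|].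
by apply/measurable_EFinP/measurable_funTS; apply: measurable_indic;
  exact: measurable_corner.
Qed.

Lemma corner_test_cvg mu a b :
  (pintegral mu (corner_test k a b))%:E @[k --> \oo] --> mu (corner a b).
Proof.
pose f k (z : R * R) : \bar R := (corner_test k a b z)%:E.
have mf k : measurable_fun quadrant (f k) by exact: measurable_corner_test.
have f0 k z : quadrant z -> (0 <= f k z)%E by rewrite lee_fin corner_test_ge0.
under eq_fun do rewrite -integral_corner_test.
rewrite -integral_corner.
rewrite (eq_integral (fun z => limn (f ^~ z))); last first.
  move=> z _; apply/esym/cvg_lim => //.
  rewrite indicE; case: (boolP (z \in _)) => [|/negP zab].
    rewrite inE => -[z1 z2]; apply: cvg_near_cst.
    near=> k; rewrite /f/= (near (ramp_near1 z1) k)//.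
    by rewrite (near (ramp_near1 z2) k)// mulr1.
  apply: cvg_near_cst; apply: nearW => k; rewrite /f/=.
  have /not_andP[] : ~ corner a b z by move/mem_set.
    by move/negP; rewrite -leNgt => h; rewrite ramp_eq0// mul0r.
  by move/negP; rewrite -leNgt => h; rewrite [X in _ * X]ramp_eq0// mulr0.
apply: cvg_monotone_convergence => //; first exact: measurable_quadrant.
move=> z _ m n mn; rewrite lee_fin ler_pM ?ramp_ge0//; exact: ramp_homo.
Unshelve. all: by end_near. Qed.

Lemma pconf_cvg_nat mu (A : set (R * R)) : measurable A ->
  mu (A `&` corner n%:R n%:R) @[n --> \oo] --> mu A.
Proof.
move=> mA.
rewrite [X in _ --> mu X](_ : A = \bigcup_n (A `&` corner n%:R n%:R)); last first.
  apply/seteqP; split=> [z Az|z [n _ []]//].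
  exists (maxn (Num.truncn z.1) (Num.truncn z.2)).+1 => //; split => //; split.
    rewrite (lt_le_trans (Num.Theory.truncnS_gt _))// ler_nat ltnS leq_maxl//.
  by rewrite (lt_le_trans (Num.Theory.truncnS_gt _))// ler_nat ltnS leq_maxr.
have mAn n : measurable (A `&` corner n%:R n%:R).
  by apply: measurableI => //; exact: measurable_corner.
apply: nondecreasing_cvg_mu => //; first exact: bigcupT_measurable.
move=> m n mn; apply/subsetPset => z [Az [z1 z2]]; split => //.
by split; [apply: lt_le_trans z1 _|apply: lt_le_trans z2 _]; rewrite ler_nat.
Qed.

(** Masses of corners are limits of test integrals, and a Dynkin argument reaches the other Borel
    sets. It is run inside [corner n n], where masses are finite and complements can be subtracted;
    letting [n] grow removes the cutoff. *)
Lemma measurable_pconf_eval d (T : measurableType d) (h : T -> pconf R)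
    (A : set (R * R)) :
  (forall f, measurable_fun setT (fun t => pintegral (h t) f)) ->
  measurable A -> measurable_fun setT (fun t => h t A).
Proof.
move=> mh mA.
have mcorner a b : measurable_fun setT (fun t => h t (corner a b)).
  apply: (emeasurable_fun_cvg
    (fun k t => (pintegral (h t) (corner_test k a b))%:E)) => [k|t _].
    exact/measurable_EFinP.
  exact: corner_test_cvg.
have mcn n : measurable_fun setT (fun t => h t (A `&` corner n%:R n%:R)).
  set B := corner n%:R n%:R.
  have mB : measurable B by exact: measurable_corner.
  have fB t (S : set (R * R)) : measurable S -> h t (S `&` B) \is a fin_num.
    move=> mS; rewrite ge0_fin_numE//.
    apply: le_lt_trans (pconf_corner_fin (h t) n%:R n%:R).
    by apply: measureIr => //; exact: measurable_corner.
  move: A mA.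
  suff H : forall A, <<s @corners R >> A -> measurable_fun setT (fun t => h t (A `&` B)).
    by move=> A; rewrite measurable_corners; exact: H.
  apply: (@dynkin_induction _ (R * R)%type (@corners R)
    (fun A => measurable_fun setT (fun t => h t (A `&` B)))).
  - exact: (measurable_corners R).
  - move=> _ _ [p _ <-] [q _ <-]; rewrite cornerI.
    by exists (Num.min p.1 q.1, Num.min p.2 q.2).
  - by under eq_fun do rewrite setTI; exact: mcorner.
  - by move=> _ [p _ <-]; under eq_fun do rewrite cornerI; exact: mcorner.
  - move=> S mS hS.
    rewrite (_ : (fun t => _) = (fun t => h t B - h t (S `&` B)))%E.
      exact: (emeasurable_funB (mcorner _ _) hS).
    apply/funext => t.
    have := fB t _ mS; have := fB t _ (measurableC mS).
    have -> : h t B = (h t (S `&` B) + h t (~` S `&` B))%E.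
      rewrite -measureU//; [|exact: measurableI|apply: measurableI => //; exact: measurableC|].
        by rewrite -setIUl setUv setTI.
      by rewrite setIACA setICr set0I.
    by move=> f1 f2; rewrite (addeC (h t (S `&` B))) addeK.
  - move=> F mF tF hF.
    rewrite (_ : (fun t => _) = (fun t => \sum_(0 <= k <oo) h t (F k `&` B)))%E.
      exact: (ge0_emeasurable_sum (P := xpredT)).
    apply/funext => t; rewrite setI_bigcupl measure_bigcup//.
      by apply: eq_eseriesl => k; rewrite in_setT.
    - by move=> k _; exact: measurableI.
    - exact: trivIset_setIr.
apply: (emeasurable_fun_cvg (fun n t => h t (A `&` corner n%:R n%:R))) => // t _.
exact: pconf_cvg_nat.
Qed.

End pconf_measurable.

(** * Grid cells and the vague topology *)

Section uniform_continuity.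
Context (R : realType).

Lemma uniform_continuous_square (g : R * R -> R) (c e : R) :
  continuous g -> 0 < e -> exists2 d : R, 0 < d &
    forall x y x' y', 0 <= x <= c -> 0 <= y <= c ->
      `|x' - x| <= d -> `|y' - y| <= d -> `|g (x', y') - g (x, y)| <= e.
Proof.
move=> gc e0.
pose P (d x y : R) := forall x' y', `|x' - x| <= d -> `|y' - y| <= d ->
   `|g (x', y') - g (x, y)| <= e.
have loc (x0 y0 : R) : \forall y \near y0 &
    xd \near filter_prod (nbhs x0) ((0 : R)^'+), P xd.2 xd.1 y.
  have e20 : 0 < e / 2 by rewrite divr_gt0.
  have /cvgr_dist_lt/(_ _ e20) := gc (x0, y0).
  move=> /nbhs_ballP[r /= r0 rg].
  have r20 : 0 < r / 2 by rewrite divr_gt0.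
  have ry : nbhs y0 [set y | `|y0 - y| < r / 2].
    by have := nbhsx_ballx y0 (r / 2) r20; rewrite -ball_normE.
  have rx : nbhs x0 [set y | `|x0 - y| < r / 2].
    by have := nbhsx_ballx x0 (r / 2) r20; rewrite -ball_normE.
  have rd : \forall d \near (0 : R)^'+, d < r / 2 by exact: nbhs_right_lt.
  exists ([set y | `|y0 - y| < r / 2],
    [set xd : R * R | `|x0 - xd.1| < r / 2 /\ xd.2 < r / 2]) => /=.
    split => //; exists ([set y | `|x0 - y| < r / 2], [set d | d < r / 2]) => //=.
  move=> [y [x d]] /= [yy0 [xx0 dr]] x' y' x'x y'y.
  have tri (u v w : R) : `|u - v| < r / 2 -> `|w - v| <= d -> `|u - w| < r.
    move=> uv wv; rewrite -(subrKA v) (le_lt_trans (ler_normD _ _))//.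
    by rewrite (splitr r) ltrD// distrC (le_lt_trans wv).
  have H1 : `|g (x0, y0) - g (x', y')| < e / 2.
    by apply: rg; split; rewrite /= -ball_normE/=; [exact: (tri _ x)|exact: (tri _ y)].
  have H2 : `|g (x0, y0) - g (x, y)| < e / 2.
    by apply: rg; split; rewrite /= -ball_normE/=;
      [apply: lt_trans xx0 _|apply: lt_trans yy0 _];
      rewrite ltr_pdivrMr// mulr_natr mulr2n ltrDl.
  rewrite -(subrKA (g (x0, y0))) (le_trans (ler_normD _ _))//.
  by rewrite [leRHS]splitr; apply: lerD; [rewrite distrC|]; exact: ltW.
have K : near_covering (`[0, c]%classic : set R).
  by apply/compact_near_coveringP; exact: segment_compact.
have : \forall d \near (0 : R)^'+, `[0, c]%classic `<=`
    [set x | `[0, c]%classic `<=` P d x].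
  (* Compactness of [[0, c]] in near-covering form is used once for [x] and once for [y]; the inner
     covering is parametrised by [x] together with the radius. *)
  apply: (K) => x0 _.
  apply: (K _ (filter_prod (nbhs x0) ((0 : R)^'+)) (fun xd y => P xd.2 xd.1 y)) => y0 _.
  exact: loc.
move=> [r /= r0 rP]; exists (r / 2); first by rewrite divr_gt0.
move=> x y x' y' xc yc; apply: (rP (r / 2)) => //=.
  by rewrite sub0r normrN ger0_norm ?divr_ge0 ?ltW// ltr_pdivrMr// mulr_natr mulr2n ltrDl.
by rewrite divr_gt0.
Qed.

End uniform_continuity.

Section cells.
Context (R : realType).
Implicit Type mu nu : pconf R.

Definition cell (m a b : nat) : set (R * R) :=
  [set z | a%:R <= m.+1%:R * z.1 < a.+1%:R /\ b%:R <= m.+1%:R * z.2 < b.+1%:R].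

Lemma cellE m a b : cell m a b =
  `[a%:R / m.+1%:R, a.+1%:R / m.+1%:R[ `*` `[b%:R / m.+1%:R, b.+1%:R / m.+1%:R[.
Proof.
by apply/seteqP; split=> z /=; rewrite /cell/= !in_itv/=
  !ler_pdivrMr// !ltr_pdivlMr// ![_ * m.+1%:R]mulrC.
Qed.

Lemma measurable_cell m a b : measurable (cell m a b).
Proof. by rewrite cellE; exact: measurableX. Qed.

(** A single enumeration runs through the cells of all meshes, so that a configuration is described
    by one sequence of counts and finitely many indices give access to any given mesh. *)
Definition celln (i : nat) : set (R * R) :=
  if unpickle i is Some (m, a, b) then cell m a b else set0.

Lemma celln_pickle m a b : celln (pickle (m, a, b)) = cell m a b.
Proof. by rewrite /celln pickleK. Qed.

Lemma measurable_celln i : measurable (celln i).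
Proof.
by rewrite /celln; case: unpickle => [[[m a] b]|//]; exact: measurable_cell.
Qed.

Lemma cell_corner m a b n : (a < n * m.+1)%N -> (b < n * m.+1)%N ->
  cell m a b `<=` corner n%:R n%:R.
Proof.
have H (k : nat) (x : R) : (k < n * m.+1)%N -> m.+1%:R * x < k.+1%:R -> x < n%:R :> R.
  move=> kn xk; rewrite -(ltr_pM2l (ltr0Sn R m)) (lt_le_trans xk)//.
  by rewrite -natrM ler_nat mulnC.
by move=> an bn z [/andP[_ z1] /andP[_ z2]]; split; [exact: H an z1|exact: H bn z2].
Qed.

Lemma celln_corner i : exists n : nat, celln i `<=` corner n%:R n%:R.
Proof.
rewrite /celln; case: unpickle => [[[m a] b]|]; last by exists 0%N.
exists (maxn a b).+1; apply: cell_corner; rewrite (leq_trans _ (leq_pmulr _ _))//.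
  by rewrite ltnS leq_maxl.
by rewrite ltnS leq_maxr.
Qed.

Lemma pconf_celln mu i : exists n : nat, mu (celln i) = n%:R%:E.
Proof.
have [n n1] := celln_corner i.
by apply: pconf_nat n1; exact: measurable_celln.
Qed.

Lemma square_cells n m : square (n%:R : R) =
  \big[setU/set0]_(p : 'I_(n * m.+1) * 'I_(n * m.+1)) cell m p.1 p.2.
Proof.
rewrite -bigcup_seq; apply/seteqP; split=> [z [/= z1 z2]|z [p _]].
  move: z1 z2; rewrite !in_itv/= => /andP[z10 z1] /andP[z20 z2].
  have tr (x : R) : 0 <= x -> x < n%:R -> (Num.truncn (m.+1%:R * x) < n * m.+1)%N.
    move=> x0 xn; rewrite truncn_lt_nat; last by rewrite mulr_ge0.
    by rewrite natrM mulrC ltr_pM2r// ltr0Sn.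
  exists (Ordinal (tr _ z10 z1), Ordinal (tr _ z20 z2)) => /=.
    by rewrite mem_index_enum.
  by split; rewrite /=; apply: truncn_itv; rewrite mulr_ge0.
move=> zp; have [z1 z2] := cell_corner (ltn_ord p.1) (ltn_ord p.2) zp.
move: zp => [/andP[z10 _] /andP[z20 _]].
have pos (k : nat) (x : R) : k%:R <= m.+1%:R * x -> 0 <= x.
  by move=> h; rewrite -(pmulr_rge0 _ (ltr0Sn R m)) (le_trans _ h).
by split; rewrite /= in_itv/= (z1, z2) andbT (pos _ _ z10, pos _ _ z20).
Qed.

Lemma trivIset_cell m (D : set (nat * nat)) :
  trivIset D (fun p => cell m p.1 p.2).
Proof.
move=> [a b] [a' b'] _ _ [z [/= [z1 z2] [z1' z2']]].
have E (u v : nat) (x : R) : u%:R <= x < u.+1%:R -> v%:R <= x < v.+1%:R -> u = v.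
  move=> /andP[h1 h2] /andP[h3 h4]; apply/eqP; rewrite eqn_leq -(ltnS u) -(ltnS v).
  by rewrite -2!(ltr_nat R) (le_lt_trans h1)// (le_lt_trans h3).
by rewrite (E _ _ _ z1 z1') (E _ _ _ z2 z2').
Qed.

Definition agree (N : nat) mu nu :=
  forall i, (i < N)%N -> mu (celln i) = nu (celln i).

Lemma cell_integral_le mu (g : R * R -> R) m a b e :
  continuous g ->
  (forall z, cell m a b z -> `|g z - g (a%:R / m.+1%:R, b%:R / m.+1%:R)| <= e) ->
  `|\int[mu]_(z in cell m a b) g z -
    g (a%:R / m.+1%:R, b%:R / m.+1%:R) * fine (mu (cell m a b))| <=
  e * fine (mu (cell m a b)).
Proof.
move=> gc ge; set w := g (_, _) in ge *.
have mc := measurable_cell m a b.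
have [n mun] : exists n : nat, mu (cell m a b) = n%:R%:E.
  by rewrite -celln_pickle; exact: pconf_celln.
have muy : (mu (cell m a b) < +oo)%E by rewrite mun ltry.
have bnd (h : R * R -> R) M : measurable_fun setT h ->
    (forall z, cell m a b z -> `|h z| <= M) ->
    mu.-integrable (cell m a b) (EFin \o h).
  move=> mh hM; apply: measurable_bounded_integrable => //.
    exact: measurable_funTS.
  exists M; split; first exact: num_real.
  by move=> x Mx z /hM/le_trans; apply; exact: ltW.
have mg : measurable_fun setT g by exact: epscontinuous_measurableR.
have ig : mu.-integrable (cell m a b) (EFin \o g).
  apply: (bnd _ (e + `|w|)) => // z /ge gz.
  by rewrite -(subrK w (g z)) (le_trans (ler_normD _ _))// lerD.
have iw : mu.-integrable (cell m a b) (EFin \o cst w).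
  by apply: (bnd _ `|w|) => // z.
rewrite -Rintegral_cst// -RintegralB// -[leRHS]Rintegral_cst//.
have igw : mu.-integrable (cell m a b) (EFin \o (fun z => g z - w)).
  apply: (bnd _ e) => //; exact: measurable_funB.
apply: le_trans (le_normr_Rintegral mc igw) _.
apply: le_Rintegral => //; last by apply: (bnd _ `|e|).
apply: (bnd _ e) => [|z /ge]; last by rewrite normr_id.
by apply: measurableT_comp => //; exact: measurable_funB.
Qed.

End cells.

Section vague_base.
Context (R : realType).
Implicit Type mu nu : pconf R.

Lemma trivIset_cell_ord k m (D : set ('I_k * 'I_k)) :
  trivIset D (fun p => cell m p.1 p.2 : set (R * R)).
Proof.
move=> [p1 p2] [q1 q2] _ _ pq.
have [/val_inj -> /val_inj ->//] := @trivIset_cell R m setT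
  (p1 : nat, p2 : nat) (q1 : nat, q2 : nat) I I pq.
Qed.

Lemma sum_cells mu n m :
  (\sum_(p : 'I_(n * m.+1) * 'I_(n * m.+1)) mu (cell m p.1 p.2) =
  mu (square n%:R))%E.
Proof.
have mc (p : 'I_(n * m.+1) * 'I_(n * m.+1)) : measurable (cell m p.1 p.2 : set (R * R)).
  exact: measurable_cell.
have := @integral_bigsetU_EFin _ _ _ mu _
  (fun p : 'I_(n * m.+1) * 'I_(n * m.+1) => cell m p.1 p.2) (cst 1) (index_enum _)
  mc (index_enum_uniq _) (@trivIset_cell_ord _ _ _).
rewrite -square_cells /= integral_cst; last exact: measurable_square.
rewrite mul1e => ->.
  by apply: eq_bigr => p _; rewrite integral_cst// mul1e.
exact/measurable_EFinP.
Qed.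

(** The Riemann sum sees [mu] only through its cell counts; its error is the oscillation of [f] on a
    cell times the mass of the square. *)
Lemma pintegral_cells mu (f : test_fun R) n m (e : R) :
  (forall z, quadrant z -> f z != 0 -> square n%:R z) ->
  (forall a b, (a < n * m.+1)%N -> (b < n * m.+1)%N -> forall z, cell m a b z ->
    `|clamped f z - clamped f (a%:R / m.+1%:R, b%:R / m.+1%:R)| <= e) ->
  `|pintegral mu f -
    \sum_(p : 'I_(n * m.+1) * 'I_(n * m.+1))
      clamped f (p.1%:R / m.+1%:R, p.2%:R / m.+1%:R) *
      fine (mu (cell m p.1 p.2))| <=
  e * \sum_(p : 'I_(n * m.+1) * 'I_(n * m.+1)) fine (mu (cell m p.1 p.2)).
Proof.
move=> fn fe; set g := clamped f.
have gc : continuous g by apply: clamped_continuous; exact: (@test_continuous R f).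
have mg : measurable_fun setT g by exact: epscontinuous_measurableR.
have sq : quadrant `&` square n%:R = square n%:R :> set (R * R).
  apply/seteqP; split=> [z []//|z [z1 z2]]; split; last by split.
  by move: z1 z2; rewrite /= !in_itv/= => /andP[z1 _] /andP[z2 _];
    split; rewrite /= in_itv/= andbT.
have mc (p : 'I_(n * m.+1) * 'I_(n * m.+1)) : measurable (cell m p.1 p.2 : set (R * R)).
  exact: measurable_cell.
have -> : pintegral mu f = \sum_(p : 'I_(n * m.+1) * 'I_(n * m.+1))
    \int[mu]_(z in cell m p.1 p.2) g z.
  transitivity (\int[mu]_(z in square n%:R) g z).
    rewrite -sq Rintegral_mkcondr; apply: eq_Rintegral => z /set_mem qz.
    rewrite patchE; case: ifPn => [_|].
      move: qz => [] /=; rewrite !in_itv/= !andbT => z1 z2.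
      by rewrite /g/clamped !clamp_id//; case: z z1 z2.
    rewrite notin_setE => nz; apply/eqP; apply: contrapT => /negP fz.
    by apply: nz; exact: fn.
  rewrite /Rintegral (square_cells R n m) integral_bigsetU_EFin//.
  - rewrite -sum_fine// => p _.
    have [k pk] : exists k : nat, mu (cell m p.1 p.2) = k%:R%:E.
      by rewrite -celln_pickle; exact: pconf_celln.
    apply: integrable_fin_num => //; apply: measurable_bounded_integrable => //.
    + by rewrite pk ltry.
    + exact: measurable_funTS.
    + exists (e + `|g (p.1%:R / m.+1%:R, p.2%:R / m.+1%:R)|).
      split; first exact: num_real.
      move=> x ex z zc; apply: le_trans (ltW ex).
      rewrite -(subrK (g (p.1%:R / m.+1%:R, p.2%:R / m.+1%:R)) (g z)).
      rewrite (le_trans (ler_normD _ _))// lerD// fe//.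
  - by rewrite index_enum_uniq.
  - exact: (@trivIset_cell_ord (n * m.+1) m).
  - by apply/measurable_EFinP; exact: measurable_funTS.
rewrite -sumrB mulr_sumr (le_trans (ler_norm_sum _ _ _))//.
by apply: ler_sum => p _; apply: cell_integral_le => // z; exact: fe.
Qed.

(** Configurations with equal counts on a fine mesh have equal Riemann sums, so their test integrals
    differ by at most two oscillation errors. The sets of this filter need not be neighbourhoods of
    [mu]: a point on the edge of a cell can leave it by a small move. *)
Lemma agree_cvg mu : filter_from setT (fun N => [set nu | agree N mu nu]) --> mu.
Proof.
set F := filter_from _ _.
have FF : Filter F.
  apply: filter_from_filter; first by exists 0%N.
  move=> i j _ _; exists (maxn i j) => // nu H; split=> k ki; apply: H.
    by rewrite (leq_trans ki)// leq_maxl.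
  by rewrite (leq_trans ki)// leq_maxr.
suff : (fun nu => pintegral nu) @ F --> pintegral mu.
  move=> H A; rewrite nbhsE => -[B [[C oC <-] Cmu]] /filterS; apply.
  by apply: H; exact: open_nbhs_nbhs.
apply/cvg_sup => f A; rewrite nbhsE => -[D [[C oC <-] Cf]] /filterS; apply.
suff : (fun nu => pintegral nu f) @ F --> pintegral mu f.
  by apply; exact: open_nbhs_nbhs.
have [c [_ fc]] := test_bounded_support f.
have [n cn] : exists n : nat, c + 1 < n%:R.
  by exists (Num.truncn (c + 1)).+1; exact: Num.Theory.truncnS_gt.
have fn z : quadrant z -> f z != 0 -> square n%:R z.
  move=> qz fz; have c1 : c < c + 1 by rewrite ltrDl.
  have := fc _ c1 z (conj qz fz).
  rewrite /= prod_normE/= ge_max => /andP[z1 z2].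
  move: qz => [] /=; rewrite !in_itv/= !andbT => z10 z20.
  by split; rewrite /= in_itv/= ?z10 ?z20/= (le_lt_trans _ cn)//
    (le_trans (ler_norm _)).
apply/cvgrPdist_le => /= e e0.
(* The added 1 keeps [M] positive when the square is empty. An oscillation of [e / 2 / M] costs
   [e / 2] for [mu], and as much for [nu], whose cell counts are the same. *)
set M := fine (mu (square n%:R)) + 1.
have M0 : 0 < M by rewrite ltr_wpDl// fine_ge0.
have e2 : 0 < e / 2 / M by rewrite !divr_gt0.
have gc : continuous (clamped f).
  by apply: clamped_continuous; exact: (@test_continuous R f).
have [d d0 gd] := @uniform_continuous_square R (clamped f) n%:R _ gc e2.
pose m := Num.truncn d^-1.
have md : (m.+1%:R)^-1 <= d.
  by rewrite -[leRHS]invrK lef_pV2 ?posrE ?invr_gt0// ltW// Num.Theory.truncnS_gt.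
have dist (k : nat) (x : R) : k%:R <= m.+1%:R * x < k.+1%:R ->
    `|x - k%:R / m.+1%:R| <= m.+1%:R^-1.
  move=> /andP[x1 x2]; rewrite ger0_norm.
    rewrite lerBlDl -[X in _ + X]mul1r -mulrDl natr1 ler_pdivlMr//.
    by rewrite mulrC ltW.
  by rewrite subr_ge0 ler_pdivrMr// mulrC.
have fe a b : (a < n * m.+1)%N -> (b < n * m.+1)%N -> forall z, cell m a b z ->
    `|clamped f z - clamped f (a%:R / m.+1%:R, b%:R / m.+1%:R)| <= e / 2 / M.
  move=> an bn [z1 z2] [/= za zb]; apply: gd.
  - by rewrite divr_ge0//= ler_pdivrMr// -natrM ler_nat ltnW.
  - by rewrite divr_ge0//= ler_pdivrMr// -natrM ler_nat ltnW.
  - by apply: le_trans md; exact: dist za.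
  - by apply: le_trans md; exact: dist zb.
have sumM : \sum_(p : 'I_(n * m.+1) * 'I_(n * m.+1)) fine (mu (cell m p.1 p.2)) <= M.
  rewrite /M -(sum_cells mu n m) -sum_fine; first by rewrite lerDl.
  move=> p _; rewrite -celln_pickle.
  by have [k ->] := pconf_celln mu (pickle (m, (p.1 : nat), (p.2 : nat))).
(* Agreement up to this index covers all cells of mesh [1 / m.+1] in the square of side [n]. *)
exists (\max_(p : 'I_(n * m.+1) * 'I_(n * m.+1)) (pickle (m, (p.1 : nat), (p.2 : nat))).+1)%N => //.
move=> nu munu /=.
have E (p : 'I_(n * m.+1) * 'I_(n * m.+1)) : mu (cell m p.1 p.2) = nu (cell m p.1 p.2).
  rewrite -celln_pickle; apply: munu.
  exact: (@leq_bigmax _ (fun p : 'I_(n * m.+1) * 'I_(n * m.+1) =>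
    (pickle (m, (p.1 : nat), (p.2 : nat))).+1) p).
have H1 := pintegral_cells mu fn fe; have H2 := pintegral_cells nu fn fe.
move: H2; under [X in `|_ - X| <= _ -> _]eq_bigr do rewrite -E.
under [X in _ <= _ * X -> _]eq_bigr do rewrite -E.
move=> H2; move: H1 H2; set S := \sum_p _ * _ => H1 H2.
rewrite -(subrKA S) (le_trans (ler_normD _ _))// [leRHS]splitr lerD//.
  rewrite (le_trans H1)// -[leRHS](divfK (lt0r_neq0 M0)) ler_wpM2l//.
  by rewrite ltW.
rewrite distrC (le_trans H2)// -[leRHS](divfK (lt0r_neq0 M0)) ler_wpM2l//.
by rewrite ltW.
Qed.

Definition inner N (V : set (pconf R)) : set (pconf R) :=
  [set mu | [set nu | agree N mu nu] `<=` V].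

Lemma inner_bigcup (V : set (pconf R)) : open V -> V = \bigcup_N inner N V.
Proof.
move=> oV; apply/seteqP; split=> [mu Vmu|mu [N _]]; last exact.
by have [N _ NV] := agree_cvg (open_nbhs_nbhs (conj oV Vmu)); exists N.
Qed.

Lemma inner_homo V : {homo (inner^~ V) : m n / (m <= n)%N >-> (m <= n)%O}.
Proof.
move=> m n mn; apply/subsetPset => mu Vmu nu munu; apply: Vmu => i im.
by apply: munu; exact: leq_trans mn.
Qed.

(** The first [N] counts are natural numbers, so they form a finite sequence [d]; the union is
    therefore countable and the set measurable. *)
Lemma innerE N V : inner N V = \bigcup_(d in [set d : seq nat |
    forall nu, (forall i, (i < N)%N -> nu (celln i) = (nth 0%N d i)%:R%:E) -> V nu])
  [set mu | forall i, (i < N)%N -> mu (celln i) = (nth 0%N d i)%:R%:E].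
Proof.
apply/seteqP; split=> [mu Vmu|mu [d dV mud] nu munu]; last first.
  by apply: dV => i iN; rewrite -munu// mud.
have [c muc] : {c : nat -> nat & forall i, mu (celln i) = (c i)%:R%:E}.
  by apply: (@choice _ _ (fun i n => mu (celln i) = n%:R%:E)); exact: pconf_celln.
have dE i : (i < N)%N -> nth 0%N (mkseq c N) i = c i by exact: nth_mkseq.
exists (mkseq c N) => [nu nud|i iN]; last by rewrite dE.
by apply: Vmu => i iN; rewrite nud// dE.
Qed.

Lemma measurable_preimage_inner d (T : measurableType d) (h : T -> pconf R) N V :
  (forall i, measurable_fun setT (fun t => h t (celln i))) ->
  measurable (h @^-1` inner N V).
Proof.
move=> mh; rewrite innerE preimage_bigcup bigcup_mkcond.
apply: countable_bigcupT_measurable => [|s]; first exact: countableP.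
case: ifP => _; last exact: measurable0.
rewrite (_ : _ @^-1` _ = \bigcap_(i in `I_N)
   ((fun t => h t (celln i)) @^-1` [set (nth 0%N s i)%:R%:E])); last first.
  by apply/seteqP; split.
by apply: fin_bigcap_measurable => // i _; rewrite -[X in measurable X]setTI; exact: mh.
Qed.

Lemma measurable_pconf d (T : measurableType d) (h : T -> borel (pconf R)) :
  (forall i, measurable_fun setT (fun t => (h t : pconf R) (celln i))) ->
  measurable_fun setT h.
Proof.
move=> mh; apply: (@measurability _ _ _ (borel (pconf R)) setT h (@open (pconf R))) => //.
move=> _ [V oV <-]; rewrite setTI (inner_bigcup oV) preimage_bigcup.
by apply: bigcupT_measurable => N; exact: measurable_preimage_inner.
Qed.

Lemma pintegral_continuous (f : test_fun R) :
  continuous (fun mu : pconf R => pintegral mu f).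
Proof.
move=> mu A; rewrite nbhsE => -[U [oU Uf] UA].
have : nbhs (pintegral mu : {ptws test_fun R -> R}) ((fun g : test_fun R -> R => g f) @^-1` U).
  have /cvg_sup/(_ f) : nbhs (pintegral mu : {ptws test_fun R -> R}) -->
      (pintegral mu : {ptws test_fun R -> R}) by [].
  apply; rewrite nbhsE; exists ((fun g : test_fun R -> R => g f) @^-1` U) => //.
  by split => //; exists U.
move=> H; have : nbhs mu [set nu : pconf R | U (pintegral nu f)].
  exact: (@initial_continuous (pconf R) _ (@pintegral R) mu _ H).
by apply: filterS => nu; exact: UA.
Qed.

Lemma measurable_pintegral (f : test_fun R) :
  measurable_fun setT (fun mu : borel (pconf R) => pintegral (mu : pconf R) f).
Proof.
apply: (measurability _ (RGenOpens.measurableE R)) => _ [_ [a [b ->] <-]].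
rewrite setTI; apply: sub_sigma_algebra.
by move/continuousP: (@pintegral_continuous f); apply; exact: interval_open.
Qed.

Lemma measurable_eval (A : set (R * R)) : measurable A ->
  measurable_fun setT (fun mu : borel (pconf R) => (mu : pconf R) A).
Proof. by move=> mA; apply: measurable_pconf_eval => // f; exact: measurable_pintegral. Qed.

Lemma measurable_restrict_square r :
  measurable_fun setT (@restrict_square R r).
Proof.
apply: measurable_pconf => i; apply: measurable_eval.
exact: measurableI (measurable_celln i) (measurable_square r).
Qed.

(** Open sets are pulled back along [pintegral], which uses the values on measurable sets only, and
    this invariance passes to the generated sigma-algebra. It stands in for equality of
    configurations, which as records may still differ on nonmeasurable sets. *)
Lemma pconf_eq_borel mu nu (C : set (borel (pconf R))) :
  (forall A, measurable A -> mu A = nu A) -> measurable C -> C mu <-> C nu.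
Proof.
move=> munu; move: C; apply: smallest_sub.
  split=> [|A [AB BA]|F FH]; first by [].
    by split=> -[_ nA]; split=> // /[dup]; [move/BA|move/AB].
  by split=> -[i _] /FH Fi; exists i.
have E : pintegral mu = pintegral nu.
  apply/funext => f; rewrite /pintegral /Rintegral; congr fine.
  by apply: eq_measure_integral => A mA _; exact: munu.
by move=> _ [C oC <-]; rewrite /preimage/= E.
Qed.

End vague_base.

(** * Weak convergence *)

Section weak_convergence.
Context (R : realType) (T : ptopologicalType).
Implicit Types (P Q : probability (borel T) R) (f : T -> R).

Lemma continuous_borel f : continuous f ->
  measurable_fun setT (f : borel T -> R).
Proof.
move=> fc; apply: (measurability _ (RGenOpens.measurableE R)) => _ [_ [a [b ->] <-]].
rewrite setTI; apply: sub_sigma_algebra.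
by move/continuousP: fc; apply; exact: interval_open.
Qed.

Lemma integrable_bounded_borel P (f : borel T -> R) M :
  measurable_fun setT f -> (forall x, `|f x| <= M) ->
  P.-integrable setT (EFin \o f).
Proof.
move=> mf fM; apply: measurable_bounded_integrable => //.
  by rewrite (le_lt_trans (probability_le1 _ _)) ?ltry.
exists M; split; first exact: num_real.
by move=> x Mx z _; exact: le_trans (ltW Mx).
Qed.

Lemma measurable_superlevel f : continuous f ->
  measurable ([set x | 1 <= f x] : set (borel T)).
Proof.
move=> fc; have := continuous_borel fc measurableT (measurable_itv `[1, +oo[).
rewrite setTI; congr measurable.
by apply/seteqP; split=> x /=; rewrite in_itv/= andbT.
Qed.

Lemma bounded_fun01 f : (forall x, 0 <= f x <= 1) -> bounded_fun f.
Proof.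
move=> f01; exists 1; split=> [|c c1 x _]; first exact: num_real.
by have /andP[f0 f1] := f01 x; rewrite /= ger0_norm// (le_trans f1)// ltW.
Qed.

(** The number of integers from 1 to [K] strictly below [y], within 1 of [y] on [[0, K]]: a
    layer-cake sum. Strictness makes the levels of a continuous function open. *)
Let staircase (K : nat) (y : R) : R :=
  \sum_(i < K) (if (i.+1%:R < y)%R then 1 else 0).

Lemma staircase_le K y : 0 <= y -> staircase K y <= y.
Proof.
move=> y0; elim: K => [|K IH]; first by rewrite /staircase big_ord0.
have [Ky|yK] := ltP K.+1%:R y; last first.
  by rewrite /staircase big_ord_recr/= ltNge yK addr0.
rewrite /staircase (eq_bigr (fun=> 1)) => [|i _].
  by rewrite sumr_const card_ord ltW.
by rewrite ifT// (le_lt_trans _ Ky)// ler_nat.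
Qed.

Lemma staircase_ge K y : y <= K%:R -> y - 1 <= staircase K y.
Proof.
elim: K => [|K IH] yK.
  by rewrite /staircase big_ord0 subr_le0 (le_trans yK).
have [yK'|Ky] := leP y K%:R.
  rewrite /staircase big_ord_recr/= (le_trans (IH yK'))// lerDl.
  by case: ifP.
rewrite lerBlDr (le_trans yK)// /staircase big_ord_recr/= -natr1 lerD//.
rewrite (eq_bigr (fun=> 1)) ?sumr_const ?card_ord.
  by rewrite -[leLHS]addr0 lerD//; case: ifP.
by move=> i _; rewrite ifT// (le_lt_trans _ Ky)// ler_nat.
Qed.

Lemma Rintegral_sum_indic P K (V : 'I_K -> set (borel T)) (c : R) :
  (forall i, measurable (V i)) -> 0 <= c ->
  \int[P]_x (\sum_i c * \1_(V i) x) = \sum_i c * fine (P (V i)).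
Proof.
move=> mV c0; rewrite /Rintegral.
under eq_integral do rewrite -sumEFin.
have mc i : measurable_fun setT (fun x : borel T => (c * \1_(V i) x)%:E).
  by apply/measurable_EFinP; apply: measurable_funM.
rewrite ge0_integral_sum//; last by move=> i x _; rewrite lee_fin mulr_ge0.
rewrite -sum_fine => [|i _].
  apply: eq_bigr => i _; under eq_integral do rewrite EFinM.
  rewrite ge0_integralZl_EFin//; last first.
    by apply/measurable_EFinP; exact: measurable_indic.
  by rewrite integral_indic// setIT fineM// fin_num_measure.
under eq_integral do rewrite EFinM.
rewrite ge0_integralZl_EFin//; last first.
  by apply/measurable_EFinP; exact: measurable_indic.
by rewrite integral_indic// setIT fin_numM// fin_num_measure.
Qed.

Let levels f K (i : 'I_K) : set (borel T) := [set x | i.+1%:R < K%:R * f x].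

Lemma open_levels f K i : continuous f -> open (@levels f K i : set T).
Proof.
move=> fc; rewrite (_ : levels _ _ = (fun x => K%:R * f x) @^-1` `]i.+1%:R, +oo[).
  move: (K%:R) => k; have : continuous (fun x => k * f x).
    by move=> x; apply: (@continuousM R T (cst k) f x); [exact: cvg_cst|exact: fc].
  by move/continuousP; apply; exact: interval_open.
by apply/seteqP; split=> x /=; rewrite in_itv/= andbT.
Qed.

Lemma Rintegral_levels P f K : (0 < K)%N -> continuous f ->
  (forall x, 0 <= f x <= 1) ->
  \sum_(i < K) K%:R^-1 * fine (P (@levels f K i)) <= \int[P]_x f x <=
  \sum_(i < K) K%:R^-1 * fine (P (@levels f K i)) + K%:R^-1.
Proof.
move=> K0 fc f01.
have K0R : 0 < K%:R :> R by rewrite ltr0n.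
have mL (i : 'I_K) : measurable (@levels f K i).
  by apply: sub_sigma_algebra; exact: open_levels.
rewrite -Rintegral_sum_indic ?invr_ge0//.
have sE x : \sum_(i < K) K%:R^-1 * \1_(@levels f K i) x =
    K%:R^-1 * staircase K (K%:R * f x).
  rewrite mulr_sumr; apply: eq_bigr => i _; congr (_ * _).
  by rewrite indicE /levels; case: ifP => h; [rewrite mem_set|rewrite memNset//= h].
have s_le x : \sum_(i < K) K%:R^-1 * \1_(@levels f K i) x <= f x.
  rewrite sE mulrC ler_pdivrMr// [f x * _]mulrC staircase_le// mulr_ge0//.
  by have /andP[] := f01 x.
have s_ge x : f x <= \sum_(i < K) K%:R^-1 * \1_(@levels f K i) x + K%:R^-1.
  rewrite sE -[X in _ + X]mulr1 -mulrDr mulrC ler_pdivlMr// mulrC -lerBlDr.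
  apply: staircase_ge; rewrite ler_piMr//.
  by have /andP[] := f01 x.
have s_ge0 x : 0 <= \sum_(i < K) K%:R^-1 * \1_(@levels f K i) x.
  by apply: sumr_ge0 => i _; rewrite mulr_ge0// invr_ge0.
have mf := continuous_borel fc.
have intf : P.-integrable setT (EFin \o (f : borel T -> R)).
  apply: (@integrable_bounded_borel _ _ 1) => // x.
  by have /andP[f0 f1] := f01 x; rewrite ger0_norm.
have ints : P.-integrable setT
    (EFin \o (fun x : borel T => \sum_(i < K) K%:R^-1 * \1_(@levels f K i) x)).
  apply: (@integrable_bounded_borel _ _ 1) => [|x].
    by apply: measurable_sum => i; apply: measurable_funM.
  by rewrite ger0_norm// (le_trans (s_le x))//; have /andP[] := f01 x.
have intc : P.-integrable setT (EFin \o (fun=> K%:R^-1 : R)).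
  by apply: (@integrable_bounded_borel _ _ `|K%:R^-1|) => //; exact: measurable_cst.
apply/andP; split; first by apply: le_Rintegral.
apply: (@le_trans _ _ (\int[P]_x (\sum_(i < K) K%:R^-1 * \1_(@levels f K i) x + K%:R^-1))).
  apply: le_Rintegral => //; exact: (integrableD _ ints intc).
rewrite RintegralD// Rintegral_cst// [X in fine X](_ : _ = 1%E) ?mulr1//.
exact: probability_setT.
Qed.

Lemma lower_bound_integral (P : nat -> probability (borel T) R) Q f (e : R) :
  (forall V : set T, open V -> forall e : R, 0 < e ->
    \forall j \near \oo, fine (Q V) <= fine (P j V) + e) ->
  continuous f -> (forall x, 0 <= f x <= 1) -> 0 < e ->
  \forall j \near \oo, \int[Q]_x f x <= \int[P j]_x f x + e.
Proof.
move=> PQ fc f01 e0.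
have e20 : 0 < e / 2 by rewrite divr_gt0.
pose K := (Num.truncn (e / 2)^-1).+1.
have Ke : K%:R^-1 <= e / 2.
  rewrite -[leRHS]invrK lef_pV2 ?posrE ?invr_gt0// ltW//.
  exact: Num.Theory.truncnS_gt.
have : \forall j \near \oo, forall i : 'I_K,
    fine (Q (@levels f K i)) <= fine (P j (@levels f K i)) + e / 2.
  by apply: filter_forall => i; apply: PQ => //; exact: open_levels.
apply: filterS => j Pj.
have /andP[_ Qf] := Rintegral_levels Q (ltn0Sn _ : (0 < K)%N) fc f01.
have /andP[Pf _] := Rintegral_levels (P j) (ltn0Sn _ : (0 < K)%N) fc f01.
apply: le_trans Qf _; rewrite [in leRHS](splitr e) addrA lerD//.
(* The errors [e / 2] of the [K] levels have weight [1 / K] each and add up to [e / 2]; the other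
   half pays for the discretisation. *)
apply: (@le_trans _ _ (\sum_(i < K) K%:R^-1 * (fine (P j (@levels f K i)) + e / 2))).
  by apply: ler_sum => i _; rewrite ler_wpM2l ?invr_ge0.
under eq_bigr do rewrite mulrDr; rewrite big_split/= lerD//.
rewrite sumr_const card_ord -[leLHS]mulr_natl mulrA.
by rewrite [X in X * _]mulfV ?mul1r// pnatr_eq0.
Qed.

(* One half of the portmanteau theorem. *)
Lemma weak_cvg_open (P : nat -> probability (borel T) R) Q :
  (forall V : set T, open V -> forall e : R, 0 < e ->
    \forall j \near \oo, fine (Q V) <= fine (P j V) + e) ->
  weak_cvg P Q.
Proof.
move=> PQ f fc [M [_ fM]].
pose B := `|M| + 1.
have B0 : 0 < B by rewrite ltr_wpDl.
have fB x : `|f x| <= B by apply: fM => //; rewrite /B (le_lt_trans (ler_norm M))// ltrDl.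
have c2 : 0 < (2 * B)^-1 by rewrite invr_gt0 mulr_gt0.
(* Affine copies of [f] and [- f] with values in [[0, 1]]: the one-sided bound for both gives the
   two-sided one. *)
pose g (b : bool) x := (2 * B)^-1 * (B + (-1) ^+ b * f x).
have g01 b x : 0 <= g b x <= 1.
  have : `|(-1) ^+ b * f x| <= B by rewrite normrM normrX normrN1 expr1n mul1r.
  rewrite ler_norml => /andP[h1 h2]; rewrite /g mulr_ge0//; last first.
    by rewrite -lerBlDl sub0r.
    exact: ltW.
  by rewrite mulrC ler_pdivrMr ?mulr_gt0// mul1r mulr_natl mulr2n lerD2l.
have gc b : continuous (g b).
  move=> x; apply: (@continuousM R T (cst (2 * B)^-1) (fun x => B + (-1) ^+ b * f x) x).
    exact: cvg_cst.
  apply: (@continuousD _ _ _ (cst B) (fun x => (-1) ^+ b * f x) x); first exact: cvg_cst.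
  by apply: (@continuousM R T (cst ((-1) ^+ b)) f x); [exact: cvg_cst|exact: fc].
have mf := continuous_borel fc.
have gE P' b : \int[P']_x g b x = (2 * B)^-1 * (B + (-1) ^+ b * \int[P']_x f x).
  have intf : P'.-integrable setT (EFin \o (f : borel T -> R)).
    exact: (integrable_bounded_borel _ mf fB).
  have intsf : P'.-integrable setT (EFin \o (fun x : borel T => (-1) ^+ b * f x)).
    apply: (@integrable_bounded_borel _ _ B); first exact: measurable_funM.
    by move=> x; rewrite normrM normrX normrN1 expr1n mul1r.
  have intB : P'.-integrable setT (EFin \o (fun x : borel T => B)).
    apply: (@integrable_bounded_borel _ _ `|B|) => //; exact: measurable_cst.
  rewrite RintegralZl//; last exact: (integrableD _ intB intsf).
  rewrite RintegralD// RintegralZl// Rintegral_cst//; congr (_ * (_ + _)).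
  by rewrite [X in fine X](_ : _ = 1%E) ?mulr1//; exact: probability_setT.
apply/cvgrPdist_le => /= e e0.
have e' : 0 < (2 * B)^-1 * e by rewrite mulr_gt0.
near=> j.
have H b : \int[Q]_x g b x <= \int[P j]_x g b x + (2 * B)^-1 * e.
  by case: b; near: j; apply: lower_bound_integral.
have := H false; have := H true; rewrite !gE -!mulrDr !ler_pM2l//.
rewrite expr0 expr1 !mulN1r mul1r ler_distl => h1 h2.
by move: h1 h2; set q := Rintegral _ _ _; set p := Rintegral _ _ _; lra.
Unshelve. all: by end_near. Qed.

End weak_convergence.

(** * Uniqueness of weak limits *)

Section weak_limit_unique.
Context (R : realType).
Implicit Types (P Q : probability (borel (pconf R)) R).

Let upset (l : seq (test_fun R * R)) : set (pconf R) :=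
  \big[setI/setT]_(p <- l) [set mu | p.2 < pintegral mu p.1].

Let upset_mem l mu : upset l mu <-> forall p, List.In p l -> p.2 < pintegral mu p.1.
Proof.
rewrite /upset; elim: l => [|p l IH]; first by rewrite big_nil.
rewrite big_cons; split=> [[h1 /IH h2] q [<-//|]|h]; first exact: h2.
by split=> /=; [apply: h; left|apply/IH => q ql; apply: h; right].
Qed.

Let G : set (set (pconf R)) := range upset.

(** Open sets are arbitrary unions of such sets, whereas a sigma-algebra offers countable ones. The
    detour is through the cell counts: they are measurable for [G], and by [measurable_pconf] they
    control the Borel sets. *)
Let G_generates : @measurable _ (borel (pconf R)) = <<s G>>.
Proof.
apply/seteqP; split; last first.
  apply: smallest_sub; first exact: sigma_algebra_measurable.
  move=> _ [l _ <-]; rewrite /upset; elim: l => [|p l IH]; first by rewrite big_nil.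
  rewrite big_cons; apply: measurableI => //.
  have := @measurable_pintegral R p.1 measurableT `]p.2, +oo[%classic (measurable_itv _).
  rewrite setTI; congr measurable.
  by apply/seteqP; split=> mu /=; rewrite in_itv/= andbT.
have mid : measurable_fun setT (id : g_sigma_algebraType G -> borel (pconf R)).
  apply: measurable_pconf => i; apply: measurable_pconf_eval => [f|]; last first.
    exact: measurable_celln.
  apply: (measurability _ (RGenOInfty.measurableE R)) => _ [_ [x ->] <-].
  rewrite setTI; apply: sub_sigma_algebra; exists [:: (f, x)] => //.
  rewrite /upset big_cons big_nil setIT.
  by apply/seteqP; split=> mu /=; rewrite in_itv/= andbT.
by move=> A mA; have := mid measurableT A mA; rewrite setTI.
Qed.

Let approx (l : seq (test_fun R * R)) (k : nat) (mu : pconf R) : R :=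
  \prod_(p <- l) ramp k (pintegral mu p.1) p.2.

Let approx_continuous l k : continuous (approx l k).
Proof.
rewrite /approx; elim: l => [|p l IH].
  by under eq_fun do rewrite big_nil; exact: cst_continuous.
under eq_fun do rewrite big_cons.
apply: continuous_mulr => //.
apply: continuous_minr; first exact: cst_continuous.
apply: continuous_mulr; first exact: cst_continuous.
apply: continuous_maxr; first exact: cst_continuous.
move=> x; apply: (@continuousB R R _ (fun mu => pintegral mu p.1) (cst p.2) x).
  exact: pintegral_continuous.
exact: cst_continuous.
Qed.

Let approx01 l k mu : 0 <= approx l k mu <= 1.
Proof.
rewrite /approx; elim: l => [|p l /andP[IH0 IH1]].
  by rewrite big_nil ler01 lexx.
rewrite big_cons mulr_ge0 ?ramp_ge0//=.
by rewrite mulr_ile1 ?ramp_ge0 ?ramp_le1.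
Qed.

Let approx_homo l mu : {homo (approx l ^~ mu) : m n / (m <= n)%N >-> m <= n}.
Proof.
move=> m n mn; rewrite /approx; elim: l => [|p l IH]; first by rewrite !big_nil.
rewrite !big_cons ler_pM ?ramp_ge0//; last exact: ramp_homo.
by have /andP[] := approx01 l m mu.
Qed.

Let approx_near l mu : upset l mu -> \forall k \near \oo, approx l k mu = 1.
Proof.
move=> /upset_mem; rewrite /approx; elim: l => [|p l IH] h.
  by apply: nearW => k; rewrite big_nil.
near=> k; rewrite big_cons (near (ramp_near1 (h p (or_introl erefl))) k)// mul1r.
by near: k; apply: IH => q ql; apply: h; right.
Unshelve. all: by end_near. Qed.

Let approx_eq0 l mu : ~ upset l mu -> forall k, approx l k mu = 0.
Proof.
move=> nl k; have : exists2 p, List.In p l & pintegral mu p.1 <= p.2.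
  apply: contrapT => h; apply: nl; apply/upset_mem => p pl.
  by rewrite ltNge; apply/negP => hp; apply: h; exists p.
rewrite /approx => -[p + hp]; elim: l {nl} => // q l IH [->|/IH pl].
  by rewrite big_cons ramp_eq0// mul0r.
by rewrite big_cons pl mulr0.
Qed.

Let approx_cvg P l :
  (\int[P]_x approx l k x)%:E @[k --> \oo] --> P (upset l).
Proof.
have mapprox k : measurable_fun setT (approx l k : borel (pconf R) -> R).
  exact: continuous_borel (@approx_continuous l k).
have mU : measurable (upset l : set (borel (pconf R))).
  by rewrite G_generates; apply: sub_sigma_algebra; exists l.
have E k : (\int[P]_x approx l k x)%:E = (\int[P]_x (approx l k x)%:E)%E.
  rewrite /Rintegral fineK//; apply: integrable_fin_num => //.
  apply: (@integrable_bounded_borel R _ P _ 1) => // x.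
  by have /andP[h0 h1] := approx01 l k x; rewrite ger0_norm.
under eq_fun do rewrite E.
rewrite (_ : P (upset l) = (\int[P]_x (limn (fun k => (approx l k x)%:E)))%E).
  apply: cvg_monotone_convergence => //.
  - by move=> k; apply/measurable_EFinP.
  - by move=> k x _; rewrite lee_fin; have /andP[] := approx01 l k x.
  - by move=> x _ m n mn; rewrite lee_fin; exact: approx_homo.
transitivity (\int[P]_x (\1_(upset l : set (borel (pconf R))) x)%:E)%E.
  by rewrite integral_indic// setIT.
apply: eq_integral => x _; apply/esym/cvg_lim => //.
rewrite indicE; case: (boolP (x \in _)) => [/set_mem xl|/negP xl].
  apply: cvg_near_cst; have := approx_near xl.
  by apply: filterS => k ->.
by apply: cvg_near_cst; apply: nearW => k; rewrite approx_eq0//; move/mem_set.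
Qed.

(** Both limits integrate the continuous functions [approx l k] alike; these increase to the
    indicator of [upset l], and the sets [upset l] form a generating pi-system. *)
Lemma weak_limit_unique (p : nat -> probability (borel (pconf R)) R) P Q :
  weak_cvg p P -> weak_cvg p Q -> forall A, measurable A -> P A = Q A.
Proof.
move=> pP pQ A mA.
apply: (@measure_unique _ R (borel (pconf R)) G (fun=> setT) _ _ _ _ P Q) => //.
- move=> _ _ [l _ <-] [m _ <-]; exists (l ++ m) => //.
  by rewrite /upset big_cat.
- by move=> _; exists [::] => //; rewrite /upset big_nil.
- by rewrite bigcup_const//; exists 0%N.
- move=> _ [l _ <-].
  apply: (etrans (esym (cvg_lim (@ereal_hausdorff R) (@approx_cvg P l)))).
  apply: (etrans _ (cvg_lim (@ereal_hausdorff R) (@approx_cvg Q l))).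
  congr (lim (_ @ \oo)); apply/funext => k; congr EFin.
  have bd : bounded_fun (approx l k).
    exists 1; split; first exact: num_real.
    move=> x x1 mu _ /=; have /andP[h0 h1] := approx01 l k mu.
    by rewrite ger0_norm// (le_trans h1)// ltW.
  have cP := pP _ (@approx_continuous l k) bd.
  have cQ := pQ _ (@approx_continuous l k) bd.
  by rewrite -(cvg_lim (@Rhausdorff R) cP) -(cvg_lim (@Rhausdorff R) cQ).
- by move=> _; rewrite (le_lt_trans (probability_le1 _ _)) ?ltry.
Qed.

End weak_limit_unique.

(** * Kolmogorov extension *)

Section uniform.
Context (R : realType).

(** Passes to the half-open interval, the endpoint being a null set; the word intervals and the
    squares are half-open. *)
Lemma uniform_probE (a b : R) (ab : a < b) (A : set (measurableTypeR R)) :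
  measurable A -> uniform_prob ab A =
  (((b - a)^-1)%:E * lebesgue_measure (A `&` `[a, b[%classic))%E.
Proof.
move=> mA; rewrite /uniform_prob integral_uniform_pdf.
rewrite (eq_integral (fun=> ((b - a)^-1)%:E)); last first.
  by move=> x; rewrite inE/= => -[_]; rewrite in_itv/= /uniform_pdf => ->.
rewrite integral_cst//; last exact: measurableI.
congr (_ * _)%E.
rewrite -(@setUitv1 _ R (BLeft a) b true) ?bnd_simp ?(ltW ab)// setIUr measureU//=.
- rewrite [X in (_ + X)%E](_ : _ = 0%E) ?adde0//.
  apply/eqP; rewrite -measure_le0 -(lebesgue_measure_set1 b).
  by apply: measureIr.
- by apply: measurableI.
- by apply: measurableI.
- by apply/seteqP; split=> // x [[_]] /= /[swap] -[_ ->]; rewrite in_itv/= ltxx andbF.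
Qed.

End uniform.

Section bits.
Context (R : realType).

Definition cylinder (w : seq bool) : set (nat -> bool) :=
  [set y | mkseq y (size w) = w].

(** Two cylinders are nested or disjoint, so adding the empty set makes the family stable under
    intersection. *)
Definition cylinders : set (set (nat -> bool)) := set0 |` range cylinder.

Notation bits := (g_sigma_algebraType cylinders).

Lemma cylinder_nil : cylinder [::] = setT.
Proof. by apply/seteqP; split. Qed.

Lemma measurable_cylinder w : measurable (cylinder w : set bits).
Proof. by apply: sub_sigma_algebra; right; exists w. Qed.

Lemma cylinderI v w : (size v <= size w)%N ->
  cylinder v `&` cylinder w = if take (size v) w == v then cylinder w else set0.
Proof.
move=> vw; have tk y : cylinder w y -> mkseq y (size v) = take (size v) w.
  by move=> <-; rewrite /mkseq -map_take take_iota (minn_idPl vw).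
case: eqP => wv; apply/seteqP; split=> y //.
- by case.
- by move=> wy; split=> //; rewrite /cylinder/= (tk _ wy).
- by move=> [vy wy]; apply: wv; rewrite -(tk _ wy).
Qed.

Lemma cylinders_setI : setI_closed cylinders.
Proof.
move=> _ _ [->|[v _ <-]] [->|[w _ <-]]; rewrite ?set0I ?setI0; try by left.
wlog vw : v w / (size v <= size w)%N.
  by move=> H; have [/H//|/ltnW/H] := leqP (size v) (size w); rewrite setIC.
by rewrite cylinderI//; case: eqP => _; [right; exists w|left].
Qed.

Lemma bits_measure_unique (P Q : probability bits R) :
  (forall w, P (cylinder w) = Q (cylinder w)) ->
  forall A, measurable A -> P A = Q A.
Proof.
move=> PQ; apply: (@measure_unique _ R bits cylinders (fun=> setT)) => //.
- exact: cylinders_setI.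
- by move=> _; right; exists [::] => //; exact: cylinder_nil.
- by rewrite bigcup_const//; exists 0%N.
- by move=> _ [->|[w _ <-]]; [rewrite !measure0|exact: PQ].
- by move=> _; rewrite (le_lt_trans (probability_le1 _ _)) ?ltry.
Qed.

Lemma cylinder_rcons w : cylinder w =
  cylinder (rcons w false) `|` cylinder (rcons w true).
Proof.
have E b y : cylinder (rcons w b) y <-> cylinder w y /\ y (size w) = b.
  rewrite /cylinder/= size_rcons /mkseq -addn1 iotaD map_cat/= cats1; split.
    by move/rcons_inj => -[].
  by move=> [-> ->].
apply/seteqP; split=> y; last by move=> [|] /E[].
by move=> wy; case yw : (y (size w)); [right|left]; apply/E.
Qed.

Lemma cylinder_rcons_disj w :
  cylinder (rcons w false) `&` cylinder (rcons w true) = set0.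
Proof.
rewrite cylinderI ?size_rcons// take_oversize ?size_rcons//.
by case: eqP => // /rcons_inj[].
Qed.

Lemma measurable_bitP d (T : measurableType d) (h : T -> bits) :
  (forall i, measurable [set t | h t i]) -> measurable_fun setT h.
Proof.
move=> mh; apply: (@measurability _ _ _ bits setT h cylinders) => //.
move=> _ [_ [->|[w _ <-]] <-].
  by rewrite preimage_set0 setI0.
rewrite setTI (_ : h @^-1` _ = \bigcap_(i in `I_(size w))
    (if nth false w i then [set t | h t i] else ~` [set t | h t i])).
  apply: fin_bigcap_measurable => // i _; case: ifP => _ //; exact: measurableC.
apply/seteqP; split=> t /=; rewrite /cylinder/=.
  move=> <- i iw; rewrite nth_mkseq//; last by move: iw; rewrite /= size_mkseq.
  by case: ifP => //= /negbT/negP.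
move=> H; apply: (@eq_from_nth _ false); first by rewrite size_mkseq.
move=> i; rewrite size_mkseq => iw; have := H i iw; rewrite nth_mkseq//.
by case: ifP => //= _ /negP/negbTE.
Qed.

Lemma measurable_bit i : measurable ([set y | y i] : set bits).
Proof.
have -> : ([set y | y i] : set bits) = \bigcup_(w : seq bool)
  (if nth false w i && (size w == i.+1) then cylinder w else set0).
  apply/seteqP; split=> [y yi|y [w _]].
    exists (mkseq y i.+1) => //.
    rewrite nth_mkseq//= size_map size_iota eqxx (_ : y i = true)//.
    by rewrite /cylinder/= size_map size_iota.
  case: ifP => // /andP[wi /eqP sw]; rewrite /cylinder/= => wE.
  by move: wi; rewrite -wE nth_mkseq// sw.
apply: (@countable_bigcupT_measurable _ bits) => [|w]; first exact: countableP.
by case: ifP => _; [exact: measurable_cylinder|exact: measurable0].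
Qed.

Section kolmogorov.
Variable p : seq bool -> R.
Hypotheses (p_ge0 : forall w, 0 <= p w) (p_nil : p [::] = 1).
Hypothesis p_rcons : forall w, p w = p (rcons w false) + p (rcons w true).

(** The word is read backwards because it is extended at its end; the right child starts where the
    left one stops. *)
Fixpoint rstart (r : seq bool) : R :=
  if r is b :: r' then rstart r' + (if b then p (rcons (rev r') false) else 0)
  else 0.
(* The words of length n index consecutive intervals of lengths p w partitioning
   [0, 1[; the interval of w is split between its two children. *)
Definition start w := rstart (rev w).

Let start_rcons w b :
  start (rcons w b) = start w + (if b then p (rcons w false) else 0).
Proof. by rewrite /start rev_rcons/= revK. Qed.

Definition word_itv w x := start w <= x < start w + p w.

Let word_itv_rcons w b x : word_itv (rcons w b) x =
  word_itv w x && (b == (start w + p (rcons w false) <= x)).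
Proof.
have := p_ge0 (rcons w false); have := p_ge0 (rcons w true).
rewrite /word_itv start_rcons (p_rcons w) addrA; case: b => p1 p0.
  case: (leP (start w + p (rcons w false)) x) => h; last by rewrite [RHS]andbC.
  by rewrite eqxx andbT (le_trans _ h) ?lerDl.
rewrite addr0; case: (leP (start w + p (rcons w false)) x) => h.
  by rewrite [RHS]andbC [LHS]andbC.
by rewrite eqxx !andbT (lt_le_trans h) ?andbT// lerDl.
Qed.

(** The address of [x]: for [x] in [[0, 1[], the word of length [n] whose interval contains [x]. *)
Fixpoint word (x : R) (n : nat) : seq bool :=
  if n is n'.+1 then
    rcons (word x n') (start (word x n') + p (rcons (word x n') false) <= x)
  else [::].

Let size_word x n : size (word x n) = n.
Proof. by elim: n => //= n IH; rewrite size_rcons IH. Qed.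

Let word_itvP (x : R) w : 0 <= x < 1 -> word_itv w x <-> word x (size w) = w.
Proof.
move=> x01; elim/last_ind: w => [|w b IH].
  by rewrite /word_itv /start/= p_nil add0r x01.
rewrite word_itv_rcons size_rcons/=; split.
  by move=> /andP[/IH -> /eqP ->].
move=> /rcons_inj[wE bE]; move: bE; rewrite wE => <-.
by rewrite eqxx andbT; apply/IH.
Qed.

Definition word_bits (x : measurableTypeR R) : bits := fun n => nth false (word x n.+1) n.

Let mkseq_word x n : mkseq (word_bits x) n = word x n.
Proof.
elim: n => [//|n IH]; rewrite /mkseq -addn1 iotaD map_cat/= -/(mkseq _ _) IH.
by rewrite cats1 addn1/= /word_bits/= nth_rcons size_word ltnn eqxx.
Qed.

Lemma measurable_word_bits :
  measurable_fun setT word_bits.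
Proof.
have mword w : measurable ([set x | word x (size w) = w] : set (measurableTypeR R)).
  elim/last_ind: w => [|w b IH]; first by rewrite (_ : mkset _ = setT)//; apply/seteqP.
  rewrite (_ : mkset _ = [set x | word x (size w) = w] `&`
    (if b then `[start w + p (rcons w false), +oo[%classic
     else `]-oo, start w + p (rcons w false)[%classic)).
    by apply: measurableI => //; case: b.
  apply/seteqP; split=> x /=; rewrite size_rcons/=.
    move=> /rcons_inj[wE <-]; split=> //; rewrite wE.
    by case: ifP => h /=; rewrite in_itv/= ?andbT// ltNge h.
  move=> [-> h]; congr rcons; move: h; case: b => /=; rewrite in_itv/= ?andbT//.
  by rewrite ltNge => /negbTE.
apply: (@measurability _ _ _ bits setT word_bits cylinders) => //.
move=> _ [_ [->|[w _ <-]] <-].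
  by rewrite preimage_set0 setI0.
rewrite setTI; have -> : word_bits @^-1` cylinder w = [set x | word x (size w) = w].
  by apply/seteqP; split=> x; rewrite /preimage/cylinder/= mkseq_word.
exact: mword.
Qed.

HB.instance Definition _ :=
  isMeasurableFun.Build _ _ _ _ word_bits measurable_word_bits.

(** The image of Lebesgue measure on [[0, 1[] under the address map: the preimage of a cylinder is
    the interval of its word, of length [p w]. *)
Lemma kolmogorov_bits : exists P : probability bits R,
  forall w, P (cylinder w) = (p w)%:E.
Proof.
exists (distribution [the probability _ _ of uniform_prob (@ltr01 R)] word_bits) => w.
rewrite /distribution /pushforward/=.
have mA : measurable (word_bits @^-1` cylinder w : set (measurableTypeR R)).
  rewrite -[X in measurable X]setTI; apply: measurable_word_bits => //.
  exact: measurable_cylinder.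
rewrite uniform_probE// subr0 invr1 mul1e.
have itv01 (x : R) : word_itv w x -> 0 <= x < 1.
  elim/last_ind: w {mA} => [|w b IH].
    by rewrite /word_itv/start/= p_nil add0r.
  by rewrite word_itv_rcons => /andP[/IH].
have -> : word_bits @^-1` cylinder w `&` `[0, 1[%classic =
    `[start w, start w + p w[%classic.
  apply/seteqP; split=> x /=; rewrite !in_itv/=; rewrite /preimage/cylinder/= mkseq_word.
    by move=> [wE x01]; apply/(word_itvP _ x01).
  by move=> h; have x01 := itv01 _ h; split=> //; apply/(word_itvP _ x01).
rewrite lebesgue_measure_itv/= lte_fin ltrDl.
case: ltP => [_|pw]; first by rewrite -EFinD addrAC subrr add0r.
by congr EFin; apply/eqP; rewrite eq_le p_ge0.
Qed.

End kolmogorov.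
End bits.
Notation bits := (g_sigma_algebraType cylinders).

(** * Coding configurations by bits *)

Section ternary_code.
Context (R : realType).

(** The Cantor expansion, with digits 0 and 2. Omitting the digit 1 leaves a gap around 1/2, so
    distinct sequences have distinct values and the bits are read off by comparison with 1/2. *)
Fixpoint ternary_sum (b : nat -> bool) (n : nat) : R :=
  if n is n'.+1 then
    ((if b 0%N then 2 else 0) + ternary_sum (fun i => b i.+1) n') / 3
  else 0.

Definition ternary (b : nat -> bool) : R := limn (ternary_sum b).

Lemma ternary_sum01 b n : 0 <= ternary_sum b n <= 1.
Proof.
elim: n b => [|n IH] b /=; first by rewrite lexx ler01.
have /andP[h0 h1] := IH (fun i => b i.+1).
by case: (b 0%N); lra.
Qed.

Lemma ternary_sum_homo b : nondecreasing_seq (ternary_sum b).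
Proof.
apply/nondecreasing_seqP => n; elim: n b => [|n IH] b.
  by have /andP[] := ternary_sum01 b 1.
by rewrite /= ler_pM2r ?invr_gt0// lerD2l; exact: IH.
Qed.

Lemma ternary_cvg b : ternary_sum b @ \oo --> ternary b.
Proof.
apply: nondecreasing_is_cvgn; first exact: ternary_sum_homo.
by exists 1 => _ [n _ <-]; have /andP[] := ternary_sum01 b n.
Qed.

Lemma ternary01 b : 0 <= ternary b <= 1.
Proof.
apply/andP; split.
  apply: limr_ge; first exact: ternary_cvg.
  by apply: nearW => n; have /andP[] := ternary_sum01 b n.
apply: limr_le; first exact: ternary_cvg.
by apply: nearW => n; have /andP[] := ternary_sum01 b n.
Qed.

Lemma ternary_rec b :
  ternary b = ((if b 0%N then 2 else 0) + ternary (fun i => b i.+1)) / 3.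
Proof.
apply/cvg_lim => //; rewrite -(cvg_shiftS (ternary_sum b)).
apply: (@cvgM R _ _ _ _ (cst 3^-1)); last exact: cvg_cst.
by apply: cvgD; [exact: cvg_cst|exact: ternary_cvg].
Qed.

Fixpoint digit (n : nat) (t : R) : bool :=
  if n is n'.+1 then digit n' (3 * t - (if 2^-1 <= t then 2 else 0))
  else 2^-1 <= t.

Lemma digit_ternary n b : digit n (ternary b) = b n.
Proof.
have dig0 c : (2^-1 <= ternary c) = c 0%N.
  rewrite ternary_rec; have /andP[h0 h1] := ternary01 (fun i => c i.+1).
  by case: (c 0%N); apply/idP/idP => //; lra.
elim: n b => [|n IH] b; first exact: dig0.
rewrite /= dig0 -[RHS](IH (fun i => b i.+1)); congr digit.
by rewrite ternary_rec; case: (b 0%N); lra.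
Qed.

Lemma measurable_digit n : measurable [set t : measurableTypeR R | digit n t].
Proof.
elim: n => [|n IH].
  rewrite (_ : mkset _ = `[2^-1, +oo[%classic); first exact: measurable_itv.
  by apply/seteqP; split=> x /=; rewrite in_itv/= andbT.
have mf : measurable_fun setT
    (fun t : measurableTypeR R => 3 * t - (if 2^-1 <= t then 2 else 0) : measurableTypeR R).
  apply: measurable_funB; first exact: measurable_funM.
  by apply: measurable_fun_if => //; exact: measurable_fun_ler.
by have := mf measurableT _ IH; rewrite setTI.
Qed.

(** Each coordinate is recorded by its Dedekind cut; [c] selects the coordinate. *)
Definition point_bit (z : R * R) (i : nat) : bool :=
  if unpickle i is Some (c, q) then ratr q < (if c then z.1 else z.2) else false.

(* A Borel injection of the plane into the unit interval. *)
Definition code (z : R * R) : R := ternary (point_bit z).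

(** [esups] at index 0 is the supremum of the whole sequence, here of the rationals in the cut. The
    filler 0 is harmless for nonnegative coordinates. *)
Definition decode_coord (c : bool) (t : R) : R :=
  fine (esups (fun i => if unpickle i is Some (c', q) then
    if (c' == c) && digit i t then (ratr q)%:E else 0%E else 0%E) 0).

Definition decode (t : R) : R * R := (decode_coord true t, decode_coord false t).

Lemma code_ge0 z : 0 <= code z.
Proof. by have /andP[] := ternary01 (point_bit z). Qed.

Lemma code_le1 z : code z <= 1.
Proof. by have /andP[] := ternary01 (point_bit z). Qed.

Lemma decode_coordK c (z : R * R) : 0 <= z.1 -> 0 <= z.2 ->
  decode_coord c (code z) = if c then z.1 else z.2.
Proof.
move=> z1 z2; rewrite /decode_coord; set x := (if c then _ else _).
have x0 : 0 <= x by rewrite /x; case: ifP.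
set u := (X in esups X); suff -> : esups u 0%N = x%:E by [].
have uE i : u i = if unpickle i is Some (c', q) then
    if (c' == c) && (ratr q < x) then (ratr q)%:E else 0%E else 0%E.
  rewrite /u digit_ternary /point_bit; case: unpickle => // -[c' q].
  by case: eqP => // ->.
apply/eqP; rewrite eq_le; apply/andP; split.
  apply: ge_ereal_sup => _ [i _ <-]; rewrite uE.
  case: unpickle => [[c' q]|]; last by rewrite lee_fin.
  by case: ifP => [/andP[_ /ltW]|_]; rewrite lee_fin.
rewrite leNgt; apply/negP => ux.
have u0 : (0 <= esups u 0%N)%E.
  apply: ereal_sup_ge; exists (u (pickle (~~ c, 0 : rat))).
    by exists (pickle (~~ c, 0 : rat)).
  by rewrite uE pickleK; case: ifP => // _; rewrite rmorph0.
have [y yE] : exists y, esups u 0%N = y%:E.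
  by exists (fine (esups u 0%N)); rewrite fineK// ge0_fin_numE// (lt_trans ux) ?ltry.
move: ux; rewrite yE lte_fin => /rat_in_itvoo[q]; rewrite in_itv/= => /andP[yq qx].
have : (u (pickle (c, q)) <= esups u 0%N)%E.
  by apply: ereal_sup_ubound; exists (pickle (c, q)).
by rewrite uE pickleK eqxx qx yE lee_fin leNgt yq.
Qed.

Lemma codeK z : quadrant z -> decode (code z) = z.
Proof.
case: z => x y [/=]; rewrite !in_itv/= !andbT => x0 y0.
by rewrite /decode !decode_coordK.
Qed.

Lemma measurable_code : measurable_fun setT (code : R * R -> measurableTypeR R).
Proof.
have mbit i : measurable [set z : R * R | point_bit z i].
  rewrite /point_bit; case: unpickle => [[c q]|]; last first.
    have -> : [set z : R * R | false] = set0 by apply/seteqP; split.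
    exact: measurable0.
  have mc : measurable_fun setT (fun z : R * R => (if c then z.1 else z.2) : measurableTypeR R).
    by case: c; [exact: measurable_fst|exact: measurable_snd].
  have := mc measurableT `]ratr q, +oo[%classic (measurable_itv _).
  rewrite setTI; congr measurable.
  by apply/seteqP; split=> z /=; rewrite in_itv/= andbT.
have msum k n : measurable_fun setT
    (fun z : R * R => ternary_sum (fun i => point_bit z (i + k)%N) n).
  elim: n k => [|n IH] k /=; first exact: measurable_cst.
  apply: measurable_funM => //; apply: measurable_funD.
    apply: measurable_fun_if => //.
    apply: (measurable_fun_bool true); rewrite setTI; have := mbit (0 + k)%N.
    by congr measurable; apply/seteqP; split=> z.
  rewrite (_ : (fun z => _) = fun z => ternary_sum (fun i => point_bit z (i + k.+1)%N) n) //.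
  apply/funext => z; congr ternary_sum; apply/funext => i.
  by rewrite addSnnS.
apply: (@measurable_fun_cvg _ _ R setT
  (fun n z => ternary_sum (point_bit z) n) code) => [n|z _].
  have := msum 0%N n; congr measurable_fun; apply/funext => z.
  by congr ternary_sum; apply/funext => i; rewrite addn0.
exact: ternary_cvg.
Qed.

Lemma measurable_decode : measurable_fun setT (decode : measurableTypeR R -> R * R).
Proof.
suff mc c : measurable_fun setT (decode_coord c : measurableTypeR R -> R).
  exact: measurable_fun_pair.
apply: measurableT_comp; first exact: fine_measurable.
apply: measurable_fun_esups => i.
case: unpickle => [[c' q]|]; last exact: measurable_cst.
case: (c' == c) => /=; last exact: measurable_cst.
apply: measurable_fun_ifT => //=; apply: (measurable_fun_bool true).
by rewrite setTI; have := measurable_digit i.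
Qed.

End ternary_code.

Section bit_encoding.
Context (R : realType).
Implicit Type mu : pconf R.

(** A shell is bounded, so its count is finite, and restriction to a square of integer side keeps or
    drops it as a whole; restriction then acts on bits by [mask]. *)
Definition shell (n : nat) : set (R * R) := square n.+1%:R `\` square n%:R.

Lemma measurable_shell n : measurable (shell n).
Proof. by apply: measurableD; exact: measurable_square. Qed.

Lemma squareE (c : R) : square c = quadrant `&` corner c c.
Proof.
apply/seteqP; split=> z; rewrite /square/quadrant/corner/= !in_itv/= !andbT.
  by move=> [/andP[-> ->] /andP[-> ->]].
by move=> [[-> ->] [-> ->]].
Qed.

Lemma square_subset (c d : R) : c <= d -> square c `<=` square d.
Proof.
move=> cd z; rewrite !squareE => -[qz [z1 z2]].
by split=> //; split; [apply: lt_le_trans cd|apply: lt_le_trans cd].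
Qed.

Lemma shell_quadrant n : shell n `<=` quadrant.
Proof. by move=> z []; rewrite squareE => -[]. Qed.

Lemma trivIset_shell : trivIset setT shell.
Proof.
have H m n : (m < n)%N -> shell m `&` shell n = set0.
  move=> mn; apply/seteqP; split=> // z [[zm _] [_ zn]]; apply: zn.
  by apply: (square_subset _ zm); rewrite ler_nat.
apply/trivIsetP => m n _ _; rewrite neq_ltn => /orP[/H//|/H].
by rewrite setIC.
Qed.

Lemma shell_cover : \bigcup_n shell n = quadrant.
Proof.
apply/seteqP; split=> [z [n _]|z qz]; first exact: shell_quadrant.
have ex : exists n : nat, `[< square n%:R z >].
  exists (maxn (Num.truncn z.1) (Num.truncn z.2)).+1; apply/asboolP.
  rewrite squareE; split=> //.
  by split; rewrite (lt_le_trans (Num.Theory.truncnS_gt _))// ler_nat ltnS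
    (leq_maxl, leq_maxr).
case: (ex_minnP ex) => -[/asboolP|n /asboolP nz nmin].
  rewrite squareE => -[[+ _] [+ _]]; rewrite /= in_itv/= andbT.
  by move=> /le_lt_trans/[apply]; rewrite ltxx.
exists n => //; split=> // nz'.
by have := nmin n; rewrite ltnn asboolT// => /(_ erefl).
Qed.

Lemma shell_square n m : shell n `&` square m%:R = if (n < m)%N then shell n else set0.
Proof.
case: ltnP => nm.
  apply: setIidl => z [zn _]; apply: (square_subset _ zn).
  by rewrite ler_nat.
apply/seteqP; split=> // z [[_ zn'] zm]; apply: zn'.
by apply: (square_subset _ zm); rewrite ler_nat.
Qed.

Lemma pconf_shell_sum mu (A : set (R * R)) : measurable A ->
  mu A = (\sum_(0 <= n <oo) mu (A `&` shell n))%E.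
Proof.
move=> mA; rewrite -pconfIquadrant// -shell_cover setI_bigcupr measure_bigcup//.
- by apply: eq_eseriesl => n; rewrite in_setT.
- by move=> n _; apply: measurableI => //; exact: measurable_shell.
- by apply: trivIset_setIl; exact: trivIset_shell.
Qed.

Definition below (q : R) : set (R * R) := [set z | code z <= q].

Lemma measurable_below q : measurable (below q).
Proof.
have := @measurable_code R measurableT `]-oo, q]%classic (measurable_itv _).
by rewrite setTI.
Qed.

(** Bit [(n, k, q)]: when the points of shell [n] are sorted by code, with multiplicity and from 0
    on, point [k] exists and has code at most [q]. *)
Definition config_bit mu (i : nat) : bool :=
  if unpickle i is Some (n, k, q) then
    (k%:R%:E < mu (shell n `&` below (ratr (q : rat))))%E
  else false.

Lemma config_bitE mu n k q : config_bit mu (pickle (n, k, q)) =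
  (k%:R%:E < mu (shell n `&` below (ratr q)))%E.
Proof. by rewrite /config_bit pickleK. Qed.

Lemma measurable_config_bit :
  measurable_fun setT (config_bit : borel (pconf R) -> bits).
Proof.
apply: measurable_bitP => i; rewrite /config_bit.
case: unpickle => [[[n k] q]|]; last first.
  by have -> : [set mu : borel (pconf R) | false] = set0 by apply/seteqP; split.
have mA : measurable (shell n `&` below (ratr q)).
  by apply: measurableI; [exact: measurable_shell|exact: measurable_below].
have := measurable_eval mA measurableT (emeasurable_itv `]k%:R%:E, +oo[).
rewrite setTI; congr measurable.
by apply/seteqP; split=> mu /=; rewrite in_itv/= andbT.
Qed.

Implicit Type y : nat -> bool.

(* For the bits of a configuration, the k-th point of the n-th shell, in
   increasing order of codes, exists iff its code is at most 2. *)
Definition active (n k : nat) y : Prop :=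
  (forall k', (k' <= k)%N -> y (pickle (n, k', 2%:Q : rat))) /\
  exists k' : nat, ~~ y (pickle (n, k', 2%:Q : rat)).

(** [einfs] at index 0 is the infimum of the rationals whose bit is set, the code of the point; when
    none is set, [fine] turns the infinite value into 0. *)
Definition time (n k : nat) y : R :=
  fine (einfs (fun i => if unpickle i is Some q then
    if y (pickle (n, k, q : rat)) then (ratr q)%:E else +oo%E else +oo%E) 0%N).

Definition position y (i : nat) : R * R :=
  if pickle_inv i is Some (n, k) then decode (time n k y) else (0, 0).

(** Bits that come from no configuration may decode to a point outside its shell. Dropping it,
    together with the bound on [k] implied by [active], makes every bit sequence decode to a locally
    finite configuration. *)
Definition present y : set nat :=
  [set i | if pickle_inv i is Some (n, k) then
    active n k y /\ shell n (decode (time n k y)) else False].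

Definition bits_measure y (A : set (R * R)) : \bar R :=
  counting (position y @^-1` A `&` present y).

Let bits_measure0 y : bits_measure y set0 = 0%E.
Proof. by rewrite /bits_measure preimage_set0 set0I measure0. Qed.

Let bits_measure_ge0 y A : (0 <= bits_measure y A)%E.
Proof. exact: measure_ge0. Qed.

Let bits_measure_sigma_additive y : semi_sigma_additive (bits_measure y).
Proof.
move=> F mF tF mU; rewrite /bits_measure preimage_bigcup setI_bigcupl.
apply: measure_semi_sigma_additive => //.
by apply: trivIset_setIr; move: tF => /trivIsetP tF; apply/trivIsetP => i j _ _ ij;
  rewrite -preimage_setI tF ?preimage_set0.
Qed.

HB.instance Definition _ y := isMeasure.Build _ _ _ (bits_measure y)
  (bits_measure0 y) (@bits_measure_ge0 y) (@bits_measure_sigma_additive y).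

Lemma present_shell y i : present y i ->
  exists n k, [/\ i = pickle (n, k), active n k y & shell n (position y i)].
Proof.
rewrite /present/= /position; case E : (pickle_inv i) => [[n k]|//] [act sh].
by exists n, k; split=> //; have := @pickle_invK (nat * nat)%type i; rewrite E => <-.
Qed.

Lemma bits_measure_quadrant y : bits_measure y (~` quadrant) = 0%E.
Proof.
rewrite /bits_measure [X in counting X](_ : _ = set0) ?measure0//.
apply/seteqP; split=> // i [/= nq /present_shell[n [k [_ _ /shell_quadrant]]]].
exact: nq.
Qed.

Lemma bits_measure_counting y (A : set (R * R)) : measurable A ->
  bits_measure y A = +oo%E \/ exists n : nat, bits_measure y A = n%:R%:E.
Proof.
move=> _; rewrite /bits_measure /counting; case: ifP => _; [right|by left].
by eexists.
Qed.

Lemma bits_measure_locfin y (A : set (R * R)) :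
  measurable A -> bounded_set A -> (bits_measure y A < +oo)%E.
Proof.
move=> _ [M [_ AM]]; rewrite /bits_measure /counting asboolT ?ltry//.
have [K KP] : {K : nat -> nat & forall n k, active n k y -> (k < K n)%N}.
  apply: (@choice _ _ (fun n K => forall k, active n k y -> (k < K)%N)) => n.
  have [[k nk]|nk] := pselect (exists k : nat, ~~ y (pickle (n, k, 2%:Q : rat))).
    exists k => k' [+ _] => /(_ k); rewrite leqNgt.
    by case: ltnP => // kk' /(_ isT); rewrite (negbTE nk).
  by exists 0%N => k [_ []k' nk']; exfalso; apply: nk; exists k'.
(* A point of the quadrant outside the square of side [n >= L] has a coordinate above [M + 1], so
   [A] meets only shells of index below [L]. *)
pose L := (Num.truncn (M + 1)).+1.
apply: (@sub_finite_set _ _ (\bigcup_(n in `I_L) ((fun k => pickle (n, k)) @` `I_(K n)))).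
  move=> i [/= Ai /present_shell[n [k [iE act sh]]]].
  exists n; last by exists k; [exact: KP|rewrite iE].
  move: sh => [+ sh2]; rewrite squareE => -[qz _].
  rewrite /= ltnNge; apply/negP => Ln; apply: sh2; rewrite squareE; split=> //.
  have := AM (M + 1) _ _ Ai; rewrite ltrDl ltr01 => /(_ isT).
  rewrite /= prod_normE/= ge_max => /andP[h1 h2].
  have ML : M + 1 < n%:R.
    rewrite (lt_le_trans (Num.Theory.truncnS_gt _))// ler_nat//.
  by split; rewrite (le_lt_trans _ ML)// (le_trans (ler_norm _)).
apply: bigcup_finite; first exact: finite_II.
by move=> n _; apply: finite_image; exact: finite_II.
Qed.

Definition bits_config y : borel (pconf R) :=
  @PConf R [the {measure set _ -> \bar _} of bits_measure y]
    (bits_measure_quadrant y) (@bits_measure_counting y) (@bits_measure_locfin y).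

End bit_encoding.

Section real_laws.
Context (R : realType).

Lemma real_measure_unique (m1 m2 : {measure set (measurableTypeR R) -> \bar R}) :
  (m1 setT < +oo)%E ->
  (forall x : R, m1 `]x, +oo[%classic = m2 `]x, +oo[%classic) ->
  forall S, measurable S -> m1 S = m2 S.
Proof.
move=> fin1 m12 S mS.
apply: (@measure_unique _ R (measurableTypeR R) (@RGenOInfty.G R)
  (fun n => `](- n%:R), +oo[%classic) _ _ _ _ m1 m2) => //.
- exact: RGenOInfty.measurableE.
- move=> _ _ [x ->] [y ->]; exists (Num.max x y).
  by apply/seteqP; split=> z /=; rewrite !in_itv/= !andbT gt_max => /andP.
- by move=> n; eexists.
- apply/seteqP; split=> // x _; exists (Num.truncn (- x)).+1 => //=.
  by rewrite in_itv/= andbT ltrNl Num.Theory.truncnS_gt.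
- by move=> _ [x ->].
- by move=> n; rewrite (le_lt_trans _ fin1)// le_measure ?inE.
Qed.

Lemma pushforward_real_unique d1 d2 (T1 : measurableType d1) (T2 : measurableType d2)
    (m1 : {measure set T1 -> \bar R}) (m2 : {measure set T2 -> \bar R})
    (f1 : T1 -> measurableTypeR R) (f2 : T2 -> measurableTypeR R) :
  measurable_fun setT f1 -> measurable_fun setT f2 -> (m1 setT < +oo)%E ->
  (forall x : R, m1 (f1 @^-1` `]x, +oo[%classic) = m2 (f2 @^-1` `]x, +oo[%classic)) ->
  forall S, measurable S -> m1 (f1 @^-1` S) = m2 (f2 @^-1` S).
Proof.
move=> mf1 mf2 fin1 m12.
exact: (@real_measure_unique (pushforward m1 f1) (pushforward m2 f2)).
Qed.

Lemma counting_card (A : set nat) n : (A #= `I_n)%card -> counting A = n%:R%:E :> \bar R.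
Proof.
move=> An; rewrite /counting asboolT; last by exists n.
by rewrite (card_fset_set An).
Qed.

End real_laws.

Section bit_decoding.
Context (R : realType).
Implicit Types (mu : pconf R) (y : nat -> bool).

Lemma measurable_time n k : measurable_fun setT (@time R n k : bits -> measurableTypeR R).
Proof.
apply: measurableT_comp; first exact: fine_measurable.
apply: (@measurable_fun_einfs _ bits) => i.
case: unpickle => [q|]; last exact: measurable_cst.
apply: (@measurable_fun_ifT _ _ bits) => //=.
apply: (@measurable_fun_bool _ bits _ _ true).
by rewrite setTI; exact: measurable_bit.
Qed.

Lemma measurable_active n k : measurable ([set y | active n k y] : set bits).
Proof.
have -> : [set y | active n k y] =
    (\bigcap_(k' in [set k' : nat | (k' <= k)%N]) [set y | y (pickle (n, k', 2%:Q : rat))]) `&`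
    ~` (\bigcap_(k' in [set: nat]) [set y | y (pickle (n, k', 2%:Q : rat))]).
  apply/seteqP; split=> y [h1 h2]; split=> //.
    by move: h2 => [k' nk'] h2; move: nk'; rewrite h2.
  by apply: contrapT => h; apply: h2 => k' _ /=; apply/negPn/negP => nk'; apply: h; exists k'.
apply: (@measurableI _ bits); first by apply: (@bigcap_measurable _ bits) => [|k' _];
  [exists 0%N|exact: measurable_bit].
apply: (@measurableC _ bits); apply: (@bigcapT_measurable _ bits) => k'.
exact: measurable_bit.
Qed.

Lemma measurable_bits_config : measurable_fun setT (@bits_config R : bits -> borel (pconf R)).
Proof.
apply: (@measurable_pconf _ _ bits) => j.
set A := celln j; have mA : measurable A by exact: measurable_celln.
pose S i : set bits := [set y | @position R y i \in A /\ @present R y i].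
have mS i : measurable (S i).
  rewrite /S /present /position /=; case: pickle_inv => [[n k]|]; last first.
    rewrite (_ : [set _ | _] = set0)//.
    by apply/seteqP; split=> // y [].
  have -> : [set y : bits | decode (@time R n k y) \in A /\
      active n k y /\ shell n (decode (@time R n k y))] =
    [set y | active n k y] `&` (@time R n k @^-1` (@decode R @^-1` (A `&` shell n))).
    by apply/seteqP; split=> y /= [h1 [h2 h3]]; split=> //;
      [split=> //; exact: set_mem|exact: mem_set].
  apply: (@measurableI _ bits); first exact: measurable_active.
  rewrite -[X in measurable X]setTI; apply: measurable_time => //.
  rewrite -[X in measurable X]setTI; apply: measurable_decode => //.
  by apply: measurableI => //; exact: measurable_shell.
have -> : (fun t : bits => (bits_config R t : pconf R) A) =
    (fun y => \sum_(0 <= i <oo) (\1_(S i) y)%:E)%E.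
  apply/funext => y; rewrite /bits_config/= /bits_measure counting_dirac.
  apply: eq_eseriesr => i _; rewrite diracE indicE; congr (_%:R%:E).
  by congr nat_of_bool; apply/idP/idP => /set_mem[h1 h2]; apply/mem_set; split=> //;
    [exact: mem_set|exact: set_mem].
apply: (@ge0_emeasurable_sum _ bits R setT _ xpredT) => [i x _ _|i _].
  by rewrite lee_fin.
by apply/measurable_EFinP; exact: measurable_indic.
Qed.

Section recover.
Variables (mu : pconf R) (n : nat).
Let y := config_bit mu.
Let F (t : R) := mu (shell n `&` below t).

Let mF (t : R) : measurable (shell n `&` below t).
Proof. by apply: measurableI; [exact: measurable_shell|exact: measurable_below]. Qed.

Let shell_nat (A : set (R * R)) : measurable A -> A `<=` shell n -> exists m : nat, mu A = m%:R%:E.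
Proof.
move=> mA An; apply: (@pconf_nat _ _ _ n.+1%:R n.+1%:R) => // z /An[].
by rewrite squareE => -[].
Qed.

Let F_homo (s t : R) : s <= t -> (F s <= F t)%E.
Proof.
move=> st; apply: le_measure; rewrite ?inE//.
by move=> z [zn zs]; split=> //; exact: le_trans st.
Qed.

Let F_top (t : R) : 1 <= t -> F t = mu (shell n).
Proof.
move=> t1; rewrite /F setIidl// => z _; rewrite /below/=.
exact: le_trans (code_le1 z) t1.
Qed.

Let ratr2 : ratr 2%:Q = 2 :> R.
Proof. by rewrite ratr_nat. Qed.

Let bitE k q : y (pickle (n, k, q)) = (k%:R%:E < F (ratr q))%E.
Proof. exact: config_bitE. Qed.

Let activeE k : active n k y <-> (k%:R%:E < mu (shell n))%E.
Proof.
have E k' : y (pickle (n, k', 2%:Q)) = (k'%:R%:E < mu (shell n))%E.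
  by rewrite bitE ratr2 F_top// ler1n.
split=> [[/(_ k (leqnn k)) + _]|kn]; first by rewrite E.
split=> [k' k'k|].
  by rewrite E (le_lt_trans _ kn)// lee_fin ler_nat.
have [m mn] := shell_nat (@measurable_shell R n) (@subset_refl _ (shell n)).
by exists m; rewrite E mn ltxx.
Qed.

(** [time] is the generalised inverse of the distribution function [F] of the codes in the shell.
    Density of the rationals gives one direction, right continuity of [F] the other. *)
Let timeE k (t : R) : (k%:R%:E < mu (shell n))%E ->
  (time R n k y <= t) = (k%:R%:E < F t)%E.
Proof.
move=> kn; rewrite /time; set u := (X in einfs X).
have uq q : (k%:R%:E < F (ratr q))%E -> (einfs u 0%N <= (ratr q)%:E)%E.
  move=> kq; apply: ereal_inf_le; exists (u (pickle q)); first by exists (pickle q).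
  by rewrite /u pickleK bitE kq.
have u0 : (0 <= einfs u 0%N)%E.
  apply: le_ereal_inf_tmp => _ [i _ <-]; rewrite /u.
  case: unpickle => [q|]; last exact: leey.
  case: ifP => [|_]; last exact: leey.
  rewrite bitE lee_fin leNgt => kq; apply/negP => q0; move: kq.
  rewrite /F (_ : _ `&` _ = set0) ?measure0 ?lte_fin ?ltr0n//.
    by rewrite ltNge ler0n.
  apply/seteqP; split=> // z [_]; rewrite /below/= => zq.
  by have := code_ge0 z; rewrite leNgt (le_lt_trans zq).
have ufin : einfs u 0%N \is a fin_num.
  rewrite ge0_fin_numE// (@le_lt_trans _ _ (ratr 2%:Q : R)%:E) ?ltry//.
  by apply: uq; rewrite ratr2 F_top// ler1n.
rewrite -lee_fin fineK//; apply/idP/idP => [ut|kt]; last first.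
  rewrite leNgt; apply/negP => tu.
  have tu' : t < fine (einfs u 0%N) by rewrite -lte_fin fineK.
  have [q] := rat_in_itvoo tu'; rewrite in_itv/= => /andP[tq qu].
  have : (einfs u 0%N <= (ratr q)%:E)%E by apply: uq; rewrite (lt_le_trans kt)// F_homo// ltW.
  by rewrite leNgt -[X in (_ < X)%E]fineK// lte_fin qu.
(* [F s] is an integer exceeding [k]; the resulting bound by [k.+1] survives the limit as [s]
   decreases to [t], which the strict inequality would not. *)
have Fs (s : R) : t < s -> (k.+1%:R%:E <= F s)%E.
  move=> ts; have : (einfs u 0%N < s%:E)%E by rewrite (le_lt_trans ut) ?lte_fin.
  move=> /ereal_inf_lt[_ [i _ <-]]; rewrite /u.
  case: unpickle => [q|]; last by rewrite ltNge leey.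
  case: ifP; last by rewrite ltNge leey.
  rewrite bitE lte_fin => kq qs.
  have [m mE] := shell_nat (mF s) (@subIsetl _ _ _).
  have : (k%:R%:E < F s)%E by rewrite (lt_le_trans kq)// F_homo// ltW.
  by rewrite /F mE lte_fin lee_fin ltr_nat ler_nat.
have Fcvg : F (t + m.+1%:R^-1) @[m --> \oo] --> F t.
  have -> : F t = mu (\bigcap_m (shell n `&` below (t + m.+1%:R^-1))).
    congr (mu _); apply/seteqP; split=> [z [zn zt] m _|z zm].
      by split=> //; rewrite /below/= (le_trans zt)// lerDl.
    split; first by have [] := zm 0%N I.
    rewrite /below/=; apply/ler_addgt0Pr => e e0.
    have [_] := zm (Num.truncn e^-1) I; rewrite /below/= => /le_trans; apply.
    rewrite lerD2l -[leRHS]invrK lef_pV2 ?posrE ?invr_gt0// ltW//.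
    exact: Num.Theory.truncnS_gt.
  apply: nonincreasing_cvg_mu => //.
  - have [m ->] := shell_nat (mF (t + 1%:R^-1)) (@subIsetl _ _ _).
    by rewrite ltry.
  - exact: bigcapT_measurable.
  - move=> m m' mm'; apply/subsetPset => z [zn zt]; split=> //.
    by rewrite /below/= (le_trans zt)// lerD2l lef_pV2 ?posrE// ler_nat.
have : (k.+1%:R%:E <= F t)%E.
  rewrite -(cvg_lim _ Fcvg)//; apply: lime_ge.
    by apply/cvg_ex; exists (F t).
  by apply: nearW => m; apply: Fs; rewrite ltrDl.
by apply: lt_le_trans; rewrite lte_fin ltr_nat.
Qed.


(** The codes of the points and the decoded times are compared as measures on the line: beyond [x]
    each has mass [N - m], with [N] points in the shell and [m] of them of code at most [x]. The
    preimage of [A] under [decode] leads back to the plane, since [decode] inverts [code] on the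
    quadrant. *)
Lemma bits_config_shell (A : set (R * R)) : measurable A -> A `<=` shell n ->
  (bits_config R y : pconf R) A = mu A.
Proof.
move=> mA An.
have [N muN] := shell_nat (@measurable_shell R n) (@subset_refl _ (shell n)).
pose D : set nat := (fun k => pickle (n, k)) @` `I_N.
pose f2 (i : nat) : R :=
  if pickle_inv i is Some (n', k) then time R n' k y else 0.
have mD : measurable D by [].
have E : forall S, measurable S ->
    mrestr mu (measurable_shell n) (@code R @^-1` S) = mrestr (@counting nat R) mD (f2 @^-1` S).
  apply: (@pushforward_real_unique R _ _ _ _ _ _ (@code R) f2) => //.
  - exact: measurable_code.
  - by change (mu (setT `&` shell n) < +oo)%E; rewrite setTI muN ltry.
  move=> x.
  change (mu (@code R @^-1` `]x, +oo[%classic `&` shell n) =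
    counting (f2 @^-1` `]x, +oo[%classic `&` D)).
  have [m mE] := shell_nat (mF x) (@subIsetl _ _ _).
  have mN : (m <= N)%N.
    have : (mu (shell n `&` below x) <= mu (shell n))%E by apply: measureIl;
      [exact: measurable_shell|exact: measurable_below].
    by rewrite muN mE lee_fin ler_nat.
  transitivity ((N - m)%:R%:E : \bar R).
    have -> : @code R @^-1` `]x, +oo[%classic `&` shell n = shell n `\` (shell n `&` below x).
      apply/seteqP; split=> z /=; rewrite in_itv/= andbT.
        by move=> [xz zn]; split=> // -[_]; rewrite /below/= leNgt xz.
      move=> [zn nz]; split=> //; rewrite ltNge; apply/negP => zx.
      by apply: nz.
    have fin : (mu (shell n) < +oo)%E by rewrite muN ltry.
    have -> : mu (shell n `\` (shell n `&` below x)) = (mu (shell n) - F x)%E.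
      by rewrite (measureD (@measurable_shell R n) (mF x) fin) setIA setIid.
    by rewrite muN /F mE natrB.
  apply/esym/counting_card.
  have -> : f2 @^-1` `]x, +oo[%classic `&` D = (fun k => pickle (n, k)) @` (`I_N `\` `I_m).
    have tE k : (k < N)%N -> (f2 (pickle (n, k)) <= x) = (k < m)%N.
      move=> kN; rewrite /f2 pickleK_inv timeE; last by rewrite muN lte_fin ltr_nat.
      by rewrite /F mE lte_fin ltr_nat.
    apply/seteqP; split=> i.
      move=> [xi [k kN ik]]; move: xi; rewrite -ik.
      by rewrite /preimage/= in_itv/= andbT ltNge tE// => /negP mk; exists k.
    move=> [k [kN mk] <-]; split; last by exists k.
    by rewrite /preimage/= in_itv/= andbT ltNge tE//; apply/negP.
  apply: card_eq_trans (card_IID).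
  by apply: inj_card_eq => k k' _ _ /(pcan_inj pickleK)[].
have mdA : measurable (@decode R @^-1` A : set (measurableTypeR R)).
  by rewrite -[X in measurable X]setTI; exact: measurable_decode.
have := E _ mdA; rewrite /mrestr.
have -> : @code R @^-1` (@decode R @^-1` A) `&` shell n = A.
  apply/seteqP; split=> z /=.
    by move=> [+ /shell_quadrant zq]; rewrite /preimage/= codeK.
  by move=> zA; split; [rewrite /preimage/= codeK//; exact: shell_quadrant (An _ zA)|exact: An].
move=> ->; rewrite /bits_config/= /bits_measure; congr counting.
apply/seteqP; split=> i.
  move=> [/= iA]; rewrite /present/=; move: iA; rewrite /position /preimage/=.
  case iE : (pickle_inv i) => [[n' k]|//] iA [act sh].
  have nn' : n' = n.
    apply: (@trivIset_shell R n' n I I).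
    by exists (decode (time R n' k y)); split=> //; exact: An.
  move: iE iA act sh; rewrite nn' => iE iA /activeE + _.
  rewrite muN lte_fin ltr_nat => kN; split; first by rewrite /f2 iE.
  by exists k => //; have := @pickle_invK (nat * nat)%type i; rewrite iE.
move=> [+ [k kN ik]]; rewrite -ik /preimage/= /f2 /position /present/= pickleK_inv => kA.
split=> //; split; last exact: An.
by apply/activeE; rewrite muN lte_fin ltr_nat.
Qed.

End recover.
Lemma config_bitK mu (A : set (R * R)) : measurable A ->
  (bits_config R (config_bit mu) : pconf R) A = mu A.
Proof.
move=> mA; rewrite !pconf_shell_sum//; apply: eq_eseriesr => n _.
apply: bits_config_shell; last exact: subIsetr.
by apply: measurableI => //; exact: measurable_shell.
Qed.

(* Keeps the bits describing the square of side m. *)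
Definition mask m y (i : nat) : bool :=
  if @unpickle (nat * nat * rat)%type i is Some (n, _, _) then (n < m)%N && y i
  else false.

Lemma mask_pickle m y (n k : nat) (q : rat) :
  mask m y (pickle (n, k, q)) = (n < m)%N && y (pickle (n, k, q)).
Proof. by rewrite /mask pickleK. Qed.

Lemma config_bit_restrict m mu :
  config_bit (restrict_square m%:R mu : pconf R) = mask m (config_bit mu).
Proof.
apply/funext => i; rewrite /config_bit /mask; case: unpickle => [[[n k] q]|//].
rewrite /restrict_square/= /mrestr setIAC shell_square.
by case: ltnP => // _; rewrite set0I measure0 lte_fin ltNge ler0n.
Qed.

(** Points decoded in shell [n] use only bits of first index [n], and a shell lies inside the square
    or is disjoint from it. *)
Lemma bits_config_mask m y (A : set (R * R)) :
  (restrict_square m%:R (bits_config R y) : pconf R) A =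
  (bits_config R (mask m y) : pconf R) A.
Proof.
rewrite /restrict_square/= /mrestr /bits_measure; congr counting.
have tE n k : (n < m)%N -> time R n k (mask m y) = time R n k y.
  move=> nm; rewrite /time; congr (fine (einfs _ _)); apply/funext => i.
  by case: unpickle => // q; rewrite mask_pickle nm.
have aE n k : active n k (mask m y) <-> (n < m)%N /\ active n k y.
  rewrite /active; have [nm|mn] := ltnP n m; last first.
    split=> [[/(_ 0%N isT) + _]|[]//]; by rewrite mask_pickle ltnNge mn.
  have E k' : mask m y (pickle (n, k', 2%:Q)) = y (pickle (n, k', 2%:Q)).
    by rewrite mask_pickle nm.
  split=> [[h1 [k' h2]]|[_ [h1 [k' h2]]]].
    split=> //; split=> [l lk|]; first by have := h1 l lk; rewrite E.
    by exists k'; move: h2; rewrite E.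
  split=> [l lk|]; first by rewrite E; exact: h1.
  by exists k'; rewrite E.
apply/seteqP; split=> i; rewrite /position /present /preimage/=;
  case: pickle_inv => [[n k]|]; try by move=> [].
  move=> [[tA tm] [act sh]].
  have nm : (n < m)%N.
    by rewrite ltnNge; apply/negP => mn; move: (conj sh tm) => /=;
      rewrite -[_ /\ _]/((shell n `&` square m%:R) _) shell_square ltnNge mn.
  by rewrite tE//; split=> //; split=> //; apply/aE.
move=> [tA [/aE[nm act] sh]]; move: tA sh; rewrite tE// => tA sh; split=> //; split=> //.
suff [] : (shell n `&` square m%:R) (decode (time R n k y)) by [].
by rewrite shell_square nm.
Qed.

End bit_decoding.

Definition bits_of_config (R : realType) (mu : borel (pconf R)) : bits :=
  config_bit (mu : pconf R).

Definition config_of_bits (R : realType) (y : bits) : borel (pconf R) :=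
  bits_config R y.

Definition mask_bits m (y : bits) : bits := mask m y.

HB.instance Definition _ (R : realType) :=
  isMeasurableFun.Build _ _ _ _ (@bits_of_config R) (@measurable_config_bit R).

HB.instance Definition _ (R : realType) :=
  isMeasurableFun.Build _ _ _ _ (@config_of_bits R) (@measurable_bits_config R).

Lemma measurable_mask m : measurable_fun setT (mask_bits m).
Proof.
apply: (@measurable_bitP _ bits) => i; rewrite /mask_bits /mask.
case: unpickle => [[[n k] q]|]; last first.
  by have -> : [set y : bits | false] = set0 by apply/seteqP; split.
case: (n < m)%N => /=; last first.
  by have -> : [set y : bits | false] = set0 by apply/seteqP; split.
exact: measurable_bit.
Qed.

HB.instance Definition _ m :=
  isMeasurableFun.Build _ _ _ _ (mask_bits m) (@measurable_mask m).

(** * Gluing the limits on squares *)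

Section projective_limit.
Context (R : realType).

(** [D] is a finite disjoint union of cylinders: splitting along the next bit ends at words of
    length [m], whose cylinders lie inside [D] or outside it. *)
Lemma bits_cvg (P : nat -> probability bits R) (Q : probability bits R) m (D : set bits) :
  (forall w, fine (P j (cylinder w)) @[j --> \oo] --> fine (Q (cylinder w))) ->
  measurable D -> (forall y y', mkseq y m = mkseq y' m -> D y -> D y') ->
  fine (P j D) @[j --> \oo] --> fine (Q D).
Proof.
move=> PQ mD Dm.
suff H : forall d w, (size w + d = m)%N ->
    fine (P j (D `&` cylinder w)) @[j --> \oo] --> fine (Q (D `&` cylinder w)).
  by have := H m [::] (add0n m); rewrite cylinder_nil setIT.
elim=> [|d IH] w; first rewrite addn0.
  move=> wm; have [[y [Dy wy]]|D0] := pselect (exists y, D y /\ cylinder w y).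
    rewrite setIidr// => y' wy'; apply: Dm Dy; rewrite -wm.
    by move: wy wy'; rewrite /cylinder/= => -> ->.
  rewrite (_ : D `&` cylinder w = set0); last first.
    by apply/seteqP; split=> // y [Dy wy]; apply: D0; exists y.
  by rewrite measure0; under eq_fun do rewrite measure0; exact: cvg_cst.
move=> wm.
have split_ (P' : probability bits R) : fine (P' (D `&` cylinder w)) =
    fine (P' (D `&` cylinder (rcons w false))) + fine (P' (D `&` cylinder (rcons w true))).
  have mc b : measurable (D `&` cylinder (rcons w b) : set bits).
    by apply: (@measurableI _ bits) => //; exact: measurable_cylinder.
  rewrite cylinder_rcons setIUr measureU//; last first.
    by rewrite setIACA cylinder_rcons_disj setI0.
  by rewrite fineD// fin_num_measure.
rewrite split_; under eq_fun do rewrite split_.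
by apply: cvgD; apply: IH; rewrite size_rcons addSnnS.
Qed.

(** The first [m] bits involve finitely many shells, all within one large square; indices that code
    no triple are unset on both sides. *)
Lemma mask_mkseq m : exists M, forall mu : pconf R,
  mkseq (mask M.+1 (config_bit mu)) m = mkseq (config_bit mu) m.
Proof.
exists (\max_(i < m) (if @unpickle (nat * nat * rat)%type i is Some (n, k, q) then n.+1 else 0))%N.
move=> mu; apply: (@eq_from_nth _ false); rewrite !size_mkseq// => i im.
rewrite !nth_mkseq// /mask.
have := @leq_bigmax _ (fun i : 'I_m => if @unpickle (nat * nat * rat)%type i is Some (n, k, q)
  then n.+1 else 0)%N (Ordinal im).
rewrite /config_bit /=; by case: unpickle => [[[n k] q]|//] /leqW ->.
Qed.

(* Kolmogorov extension along the squares of integer side. *)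
Lemma projective_limit (P Z : nat -> probability (borel (pconf R)) R) :
  (forall M C, measurable C ->
    fine (P j (restrict_square M.+1%:R @^-1` C)) @[j --> \oo] --> fine (Z M C)) ->
  exists Q : probability (borel (pconf R)) R, forall M C, measurable C ->
    Q (restrict_square M.+1%:R @^-1` C) = Z M C.
Proof.
move=> PZ.
pose PB j : probability bits R := distribution (P j) (@bits_of_config R).
have mB (D : set bits) : measurable D ->
    measurable (@bits_of_config R @^-1` D : set (borel (pconf R))).
  by move=> mD; rewrite -[X in measurable X]setTI; exact: measurable_config_bit.
have restrict_bit M (D : set bits) :
    (restrict_square M.+1%:R : borel (pconf R) -> borel (pconf R)) @^-1`
      (@bits_of_config R @^-1` D) = @bits_of_config R @^-1` (mask_bits M.+1 @^-1` D).
  by apply/seteqP; split=> mu; rewrite /preimage/bits_of_config/mask_bits/= config_bit_restrict.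
(* By [mask_mkseq] a cylinder is an event on a single square, so the limit exists. *)
pose p w : R := limn (fun j => fine (PB j (cylinder w))).
have pP w : fine (PB j (cylinder w)) @[j --> \oo] --> p w.
  have [M HM] := mask_mkseq (size w).
  have := PZ M _ (mB _ (measurable_cylinder w)).
  rewrite restrict_bit (_ : _ @^-1` _ = @bits_of_config R @^-1` cylinder w); last first.
    by apply/seteqP; split=> mu; rewrite /preimage/cylinder/bits_of_config/mask_bits/= HM.
  by move=> h; apply/cvg_ex; exists (fine (Z M (@bits_of_config R @^-1` cylinder w))).
have p_ge0 w : 0 <= p w.
  by apply: limr_ge; [exact: pP|apply: nearW => j; exact: fine_ge0].
have p_nil : p [::] = 1.
  apply/cvg_lim => //; apply: cvg_near_cst; apply: nearW => j.
  by rewrite cylinder_nil probability_setT.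
have p_rcons w : p w = p (rcons w false) + p (rcons w true).
  apply/cvg_lim => //.
  rewrite (_ : (fun j => _) = fun j => fine (PB j (cylinder (rcons w false))) +
    fine (PB j (cylinder (rcons w true)))); first exact: cvgD.
  apply/funext => j; rewrite -fineD ?fin_num_measure//; try exact: measurable_cylinder.
  rewrite -measureU//; [by rewrite -cylinder_rcons|exact: measurable_cylinder
    |exact: measurable_cylinder|exact: cylinder_rcons_disj].
have [L LE] := kolmogorov_bits p_ge0 p_nil p_rcons.
exists (distribution L (@config_of_bits R)) => M C mC.
have mD : measurable (@config_of_bits R @^-1` C : set bits).
  by rewrite -[X in measurable X]setTI; exact: measurable_bits_config.
transitivity (distribution L (mask_bits M.+1) (@config_of_bits R @^-1` C)).
  rewrite /distribution/pushforward; congr (L _); apply/seteqP; split=> y /=.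
    by apply: (pconf_eq_borel _ mC).1 => A mA; exact: bits_config_mask.
  by apply: (pconf_eq_borel _ mC).2 => A mA; exact: bits_config_mask.
transitivity (distribution (Z M) (@bits_of_config R) (@config_of_bits R @^-1` C)); last first.
  rewrite /distribution/pushforward; congr (Z M _); apply/seteqP; split=> mu /=.
    by apply: (pconf_eq_borel _ mC).1 => A mA; exact: config_bitK.
  by apply: (pconf_eq_borel _ mC).2 => A mA; exact: config_bitK.
(* What remains is to compare two laws of masked bits on cylinders. Both masses are limits of one
   sequence: by [bits_cvg] for [L], by [PZ] for [Z M]. *)
apply: bits_measure_unique mD => w.
have mM : measurable (mask_bits M.+1 @^-1` cylinder w : set bits).
  by rewrite -[X in measurable X]setTI; apply: measurable_mask => //; exact: measurable_cylinder.
have cvg1 : fine (PB j (mask_bits M.+1 @^-1` cylinder w)) @[j --> \oo] -->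
    fine (L (mask_bits M.+1 @^-1` cylinder w)).
  apply: (@bits_cvg PB L (size w)) => //.
    by move=> v; rewrite LE; exact: pP.
  move=> y y' yy'; rewrite /preimage/cylinder/= => yw; rewrite -{2}yw.
  apply: (@eq_from_nth _ false); rewrite !size_mkseq// => i iw.
  have := congr1 (nth false ^~ i) yy'; rewrite !nth_mkseq// /mask_bits /mask.
  by case: unpickle => // -[[n k] q] ->.
have cvg2 : fine (PB j (mask_bits M.+1 @^-1` cylinder w)) @[j --> \oo] -->
    fine (Z M (@bits_of_config R @^-1` cylinder w)).
  have := PZ M _ (mB _ (measurable_cylinder w)).
  by rewrite restrict_bit.
have E := cvg_unique (@Rhausdorff R) cvg1 cvg2.
have m2 := mB _ (measurable_cylinder w).
transitivity ((fine (L (mask_bits M.+1 @^-1` cylinder w)))%:E).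
  by rewrite fineK//; exact: fin_num_measure.
by rewrite E fineK//; exact: fin_num_measure.
Qed.

End projective_limit.

(** * Sampling and restriction to a square *)

Section finite_sums.
Context (R : realType) d (T : measurableType d).

Lemma measure_sum_fin (I : finType) (mu : {measure set T -> \bar R}) (F : I -> set T) :
  (forall i, measurable (F i)) -> trivIset setT F ->
  (mu (\bigcup_i F i) = \sum_i mu (F i))%E.
Proof.
move=> mF tF.
have IE : [set` index_enum I] = [set: I].
  by apply/seteqP; split=> // i _ /=; rewrite mem_index_enum.
rewrite measure_fin_bigcup//; last by rewrite -IE; exact: finite_seq.
by rewrite -IE -fsbig_seq// index_enum_uniq.
Qed.

Lemma integral_fin (I : finType) (mu : {measure set T -> \bar R}) (X : T -> I)
    (f : I -> \bar R) :
  (forall i, measurable (X @^-1` [set i])) -> (forall i, 0 <= f i)%E ->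
  (\int[mu]_x f (X x) = \sum_i f i * mu (X @^-1` [set i]))%E.
Proof.
move=> mX f0.
have fE x : f (X x) = (\sum_i f i * (\1_(X @^-1` [set i]) x)%:E)%E.
  rewrite (bigD1 (X x))//= indicE mem_set// mule1 big1 ?adde0// => i /eqP iX.
  by rewrite indicE memNset ?mule0// => /= iX'; apply: iX; rewrite -iX'.
under eq_integral do rewrite fE.
have m1 i : measurable_fun setT (fun x => (\1_(X @^-1` [set i]) x)%:E : \bar R).
  by apply/measurable_EFinP; exact: measurable_indic.
rewrite ge0_integral_sum//.
- apply: eq_bigr => i _; rewrite ge0_integralZl//.
  by rewrite integral_indic// setIT.
- move=> i; apply: emeasurable_funM => //; exact: measurable_cst.
- by move=> i x _; rewrite mule_ge0// lee_fin.
Qed.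
End finite_sums.

Section sampling_identity.
Context (R : realType).

(** The image of [f] has to contain only the vertices of [Q] with a neighbour in [Q], as the others
    contribute no edge point. For this reason discarding isolated vertices does not change the
    labeling. *)
Lemma lbl_measure_sub (G H : graph) (f : 'I_(nverts H) -> 'I_(nverts G))
    (u : (nverts G).-tuple (measurableTypeR R)) (Q : pred 'I_(nverts G)) A :
  injective f -> (forall i j, adj (f i) (f j) = adj i j) ->
  (forall i j, adj i j -> Q i -> Q j -> i \in codom f) -> (forall i, Q (f i)) ->
  (\sum_(p | adj p.1 p.2 && (Q p.1 && Q p.2)) \d_(edge_point u p) A =
   lbl_measure (subtuple f u) A :> \bar R)%E.
Proof.
move=> finj fadj fcod fQ.
pose f2 (q : 'I_(nverts H) * 'I_(nverts H)) := (f q.1, f q.2).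
rewrite /lbl_measure [RHS](eq_bigr (fun q => \d_(edge_point u (f2 q)) A)); last first.
  by move=> q _; rewrite /edge_point !tnth_mktuple.
rewrite -[LHS]big_filter -[RHS]big_filter.
rewrite -[RHS](big_map f2 xpredT (fun p => \d_(edge_point u p) A)).
apply: perm_big; apply: uniq_perm.
- by rewrite filter_uniq// index_enum_uniq.
- rewrite map_inj_uniq ?filter_uniq ?index_enum_uniq//.
  by move=> [a b] [c d] [/finj -> /finj ->].
move=> [i j]; rewrite mem_filter mem_index_enum andbT /=.
apply/idP/mapP => [/and3P[ij Qi Qj]|[[a b]]].
  have /codomP[a ia] := fcod _ _ ij Qi Qj.
  have /codomP[b jb] : j \in codom f by apply: fcod Qj Qi; rewrite adj_sym.
  exists (a, b); last by rewrite /f2 /= -ia -jb.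
  by rewrite mem_filter mem_index_enum andbT /= -fadj -ia -jb.
by rewrite mem_filter /= => /andP[ab _] [-> ->]; rewrite fadj ab !fQ.
Qed.

Lemma Lbl_isomorphic (G H : graph) (s : R) C : isomorphic G H ->
  measurable C -> Lbl G s C = Lbl H s C.
Proof.
move=> [f bf fadj] mC.
rewrite /Lbl /distribution /pushforward.
have mL : measurable (@labeling R G @^-1` C).
  by rewrite -[X in measurable X]setTI; exact: measurable_labeling.
apply: (etrans (esym (iid_injective (uniform_law s) (bij_inj bf) mL))).
have E (u : (nverts H).-tuple (measurableTypeR R)) A :
    lbl_measure (subtuple f u) A = lbl_measure u A.
  have cod (i j : 'I_(nverts H)) : adj i j -> predT i -> predT j -> i \in codom f.
    by move=> _ _ _; case: bf => g _ gK; rewrite -[i]gK codom_f.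
  rewrite -(@lbl_measure_sub H G f u predT A (bij_inj bf) fadj cod)//.
  by apply: eq_bigl => p; rewrite !andbT.
congr (iid _ _ _); apply/seteqP; split=> u /=.
  by apply: (pconf_eq_borel _ mC).1 => A mA; exact: E.
by apply: (pconf_eq_borel _ mC).2 => A mA; exact: E.
Qed.

Lemma repr_unlabel (G : graph) :
  isomorphic (repr (unlabel G : {eq_quot iso_equiv})) G.
Proof.
have /eqmodP : (repr (unlabel G : {eq_quot iso_equiv}) = G %[mod {eq_quot iso_equiv}])%qT.
  by rewrite reprK.
by move/asboolP.
Qed.

Lemma Lbl_repr (G : graph) (s : R) C : measurable C ->
  Lbl (repr (unlabel G : {eq_quot iso_equiv})) s C = Lbl G s C.
Proof. by move=> mC; apply: Lbl_isomorphic => //; exact: repr_unlabel. Qed.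

Section kept.
Variables (G : graph) (b : (nverts G).-tuple bool).

Let S : {set 'I_(nverts G)} := [set i | tnth b i]%SET.

Definition kept := rm_isolated (induced S).

Definition kept_emb (i : 'I_(nverts kept)) : 'I_(nverts G) :=
  @enum_val _ (mem S) (@enum_val _
    (mem [set i : 'I_(nverts (induced S)) | [exists j, adj i j]]%SET) i).

Lemma kept_emb_inj : injective kept_emb.
Proof. by move=> i j /enum_val_inj/enum_val_inj. Qed.

Lemma kept_emb_adj i j : adj (kept_emb i) (kept_emb j) = adj i j.
Proof. by []. Qed.

Lemma kept_emb_mem i : tnth b (kept_emb i).
Proof. by have := enum_valP (enum_val i : 'I_(nverts (induced S))); rewrite inE. Qed.

Lemma kept_emb_codom i j : adj i j -> tnth b i -> tnth b j -> i \in codom kept_emb.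
Proof.
move=> ij bi bj; have Si : i \in S by rewrite inE.
have Sj : j \in S by rewrite inE.
pose i1 : 'I_(nverts (induced S)) := enum_rank_in Si i.
pose j1 : 'I_(nverts (induced S)) := enum_rank_in Sj j.
have i1P : i1 \in [set i : 'I_(nverts (induced S)) | [exists j, adj i j]]%SET.
  by rewrite inE; apply/existsP; exists j1; rewrite /adj/= !enum_rankK_in.
apply/codomP; exists (enum_rank_in i1P i1).
by rewrite /kept_emb enum_rankK_in// enum_rankK_in.
Qed.

Lemma kept_adj i : exists j : 'I_(nverts kept), adj i j.
Proof.
have := enum_valP (i : 'I_#|[set i : 'I_(nverts (induced S)) | [exists j, adj i j]]%SET|).
rewrite inE => /existsP[j ij].
have : j \in [set i : 'I_(nverts (induced S)) | [exists j, adj i j]]%SET.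
  by rewrite inE; apply/existsP; exists (enum_val i); rewrite adj_sym.
by move=> jP; exists (enum_rank_in jP j); rewrite /adj/= enum_rankK_in.
Qed.

(** An edge point lies in the square iff both ends are kept. Comparing labels with [s] is enough
    because [clamp] sends negative labels to 0, which is in [[0, s[]. *)
Lemma restrict_square_kept (s : R) (u : (nverts G).-tuple (measurableTypeR R)) C :
  0 < s -> (forall i, (tnth u i < s :> R) = tnth b i) -> measurable C ->
  C (restrict_square s (labeling u)) <-> C (labeling (subtuple kept_emb u)).
Proof.
move=> s0 ub mC; apply: pconf_eq_borel => // A mA /=.
rewrite -(@lbl_measure_sub G kept kept_emb u (fun i => tnth b i)).
- rewrite /mrestr/= /lbl_measure [RHS]big_mkcondr/=; apply: eq_bigr => -[i j] ij.
  have cl x : (0 <= clamp x < s) = (x < s).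
    by rewrite clamp_ge0/= /clamp gt_max s0.
  rewrite diracE -!ub /=; case: ifP => [/andP[us vs]|us].
    rewrite diracE; congr (_%:R%:E); congr nat_of_bool; apply/idP/idP => /set_mem.
      by move=> [? _]; exact: mem_set.
    move=> Ap; apply/mem_set; split=> //; split; rewrite /= in_itv/= cl//.
  by rewrite memNset// => -[_ []]; rewrite /= !in_itv/= !cl => us' vs'; move: us; rewrite us' vs'.
- exact: kept_emb_inj.
- exact: kept_emb_adj.
- exact: kept_emb_codom.
- exact: kept_emb_mem.
Qed.

End kept.

End sampling_identity.

Section restriction_identity.
Context (R : realType).

Lemma uniform_lawE (s : R) (A : set (measurableTypeR R)) : 0 < s -> measurable A ->
  uniform_law s A = ((s^-1)%:E * lebesgue_measure (A `&` `[0%R, s[%classic))%E.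
Proof.
move=> s0 mA; rewrite /uniform_law; case: pselect => // s0' /=.
by rewrite uniform_probE// subr0.
Qed.

(** The conditioning hypothesis of [iid_subtuple] for the label of a kept vertex. *)
Lemma uniform_law_lt (s t : R) (A : set (measurableTypeR R)) : 0 < s -> s <= t -> measurable A ->
  uniform_law t (`]-oo, s[%classic `&` A) = ((s / t)%:E * uniform_law s A)%E.
Proof.
move=> s0 st mA; have t0 := lt_le_trans s0 st.
rewrite !uniform_lawE//; last by apply: measurableI.
rewrite muleA -EFinM mulrAC mulfV ?gt_eqF// mul1r; congr (_ * lebesgue_measure _)%E.
apply/seteqP; split=> x /=; rewrite !in_itv/=.
  by move=> [[xs xA] /andP[-> _]].
by move=> [xA /andP[-> xs]]; rewrite (lt_le_trans xs st).
Qed.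

Lemma uniform_law_ge (s t : R) : 0 < s -> s <= t ->
  uniform_law t (~` `]-oo, s[%classic) = (1 - s / t)%:E.
Proof.
move=> s0 st; have t0 := lt_le_trans s0 st.
rewrite probability_setC//; have := @uniform_law_lt s t setT s0 st measurableT.
rewrite setIT => ->; rewrite (_ : uniform_law s setT = 1%E) ?mule1//.
exact: probability_setT.
Qed.

Lemma bernoulli_set1 (p : R) b : 0 <= p <= 1 ->
  bernoulli_prob p [set b] = (if b then p else 1 - p)%:E.
Proof. by move=> p01; rewrite /bernoulli_prob p01 fsbig_set1. Qed.

Definition weight n (p : R) (b : n.-tuple bool) : R :=
  \prod_(i < n) (if tnth b i then p else 1 - p).

Lemma iid_bernoulli_set1 (p : R) n (b : n.-tuple bool) : 0 <= p <= 1 ->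
  iid (bernoulli_prob p) n [set b] = (weight p b)%:E.
Proof.
move=> p01.
have -> : [set b] = [set t | forall i, [set tnth b i] (tnth t i)].
  by apply/seteqP; split=> [t -> i//|t bt]; apply: eq_from_tnth => i; exact: bt.
have mb i : measurable [set tnth b i] by [].
rewrite (iid_box _ mb) /weight -prodEFin.
by apply: eq_bigr => i _; exact: bernoulli_set1.
Qed.

Lemma measurable_ugraph (A : set (borel ugraph)) : measurable A.
Proof. by apply: sub_sigma_algebra; exact: discrete_open. Qed.

Lemma Lbl_mix_SmplD (G : graph) (s : R) C : 0 <= s / side R G <= 1 -> measurable C ->
  Lbl_mix s (SmplD G s) C = (\sum_b (weight (s / side R G) b)%:E * Lbl (@kept G b) s C)%E.
Proof.
move=> p01 mC; rewrite /Lbl_mix /SmplD /Smpl.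
rewrite min_l; last by have /andP[] := p01.
rewrite ge0_integral_distribution//; last by move=> _ A _; rewrite setTI; exact: measurable_ugraph.
rewrite (@integral_fin R _ ((nverts G).-tuple bool) ((nverts G).-tuple bool) _ id
  (fun b => Lbl (repr (@kept_graph G b : {eq_quot iso_equiv})) s C)).
- apply: eq_bigr => b _; rewrite muleC; congr (_ * _)%E; first exact: iid_bernoulli_set1.
  exact: Lbl_repr.
- by move=> b; exact: measurable_tuple_bool.
- by move=> b; exact: measure_ge0.
Qed.

Lemma embed_restrict (G : graph) (s : R) C : 0 < s -> s <= side R G -> measurable C ->
  embed R G (restrict_square s @^-1` C) = Lbl_mix s (SmplD G s) C.
Proof.
move=> s0 sL mC; have L0 := lt_le_trans s0 sL.
have p01 : 0 <= s / side R G <= 1.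
  by apply/andP; split; [rewrite divr_ge0 ?ltW|rewrite ler_pdivrMr// mul1r].
rewrite Lbl_mix_SmplD// /embed /Lbl /distribution /pushforward.
set n := nverts G; set L := side R G.
pose E : set (n.-tuple (measurableTypeR R)) := @labeling R G @^-1` (restrict_square s @^-1` C).
have mE : measurable E.
  rewrite -[X in measurable X]setTI; apply: measurable_labeling => //.
  by rewrite -[X in measurable X]setTI; exact: measurable_restrict_square.
(* [b] records which labels lie below [s]. The events [W b] partition the label space, and on each
   of them the restricted labeling is that of the fixed graph [kept b]. *)
pose D (b : n.-tuple bool) (i : 'I_n) : set (measurableTypeR R) :=
  if tnth b i then `]-oo, s[%classic else ~` `]-oo, s[%classic.
have mD b i : measurable (D b i).
  by rewrite /D; case: ifP => _ //; exact: measurableC.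
pose W b : set (n.-tuple (measurableTypeR R)) := [set u | forall i, D b i (tnth u i)].
have mW b : measurable (W b) by exact: measurable_tuple_box.
have WP b u : W b u <-> forall i, (tnth u i < s :> R) = tnth b i.
  split=> H i; have := H i; rewrite /D.
    by case: ifP => _ /=; rewrite in_itv/= => // /negP/negbTE.
  by case: ifP => _ /=; rewrite in_itv/= => ->.
have mEW b : measurable (E `&` W b) by exact: measurableI.
transitivity (\sum_b iid (uniform_law L) n (E `&` W b))%E.
  rewrite -measure_sum_fin//; last first.
    move=> b b' _ _ [u [[_ /WP ub] [_ /WP ub']]]; apply: eq_from_tnth => i.
    by rewrite -ub.
  congr (iid _ _ _); apply/seteqP; split=> [u Eu|u [b _ []]//].
  exists [tuple (tnth u i < s :> R) | i < n] => //; split=> //.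
  by apply/WP => i; rewrite tnth_mktuple.
apply: eq_bigr => b _.
have mL : measurable (@labeling R (kept b) @^-1` C).
  by rewrite -[X in measurable X]setTI; exact: measurable_labeling.
have cge i : 0 <= (if tnth b i then s / L else 1 - s / L).
  by case: ifP => _; have /andP[h1 h2] := p01; rewrite ?subr_ge0.
(* The masses of the conditions [D b i] multiply to the Bernoulli weight of [b], with keeping
   probability [s / L]. *)
rewrite /weight -(@iid_subtuple R _ _ _ n (@kept_emb G b) (uniform_law L) (uniform_law s)
  (D b) (fun i => if tnth b i then s / L else 1 - s / L))//.
- congr (iid _ _ _); apply/seteqP; split=> u.
    by move=> [Eu Wu]; split=> //; exact: (restrict_square_kept s0 ((WP b u).1 Wu) mC).1 Eu.
  by move=> [Wu Cu]; split=> //; exact: (restrict_square_kept s0 ((WP b u).1 Wu) mC).2 Cu.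
- exact: kept_emb_inj.
- move=> i; rewrite /D; case: ifP => _; last exact: uniform_law_ge.
  have := @uniform_law_lt s L setT s0 sL measurableT; rewrite setIT => ->.
  by rewrite [X in (_ * X)%E](_ : _ = 1%E) ?mule1//; exact: probability_setT.
- by move=> j B mB; rewrite /D kept_emb_mem; exact: uniform_law_lt.
Qed.

End restriction_identity.

(** * From convergent samples to convergent labelings *)

Section sampling_to_embed.
Context (R : realType).

Section mixture.
Variables (r : R) (eta : probability (borel ugraph) R).

Let mix0 : Lbl_mix r eta set0 = 0%E.
Proof. by rewrite /Lbl_mix integral0_eq// => H _; rewrite measure0. Qed.

Let mix_ge0 C : (0 <= Lbl_mix r eta C)%E.
Proof. by apply: integral_ge0 => H _; exact: measure_ge0. Qed.

Let mix_sigma_additive : semi_sigma_additive (Lbl_mix r eta).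
Proof.
move=> F mF tF mU; apply: cvg_toP.
  by apply: ereal_nondecreasing_is_cvgn => m n mn; apply: lee_sum_nneg_natr.
rewrite /Lbl_mix -integral_nneseries//; last first.
  by move=> n _ B _; exact: measurable_ugraph.
apply: eq_integral => H _; rewrite measure_bigcup//.
by apply: eq_eseriesl => i; rewrite in_setT.
Qed.

HB.instance Definition _ := isMeasure.Build _ _ _ (Lbl_mix r eta)
  mix0 mix_ge0 mix_sigma_additive.

Let mixT : Lbl_mix r eta setT = 1%E.
Proof.
rewrite /Lbl_mix (eq_integral (cst 1%E)); last by move=> H _; exact: probability_setT.
by rewrite integral_cst// mul1e; exact: probability_setT.
Qed.

HB.instance Definition _ :=
  Measure_isProbability.Build _ _ _ (Lbl_mix r eta) mixT.

End mixture.

Lemma ugraph_continuous (f : ugraph -> R) : continuous f.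
Proof. by apply/continuousP => A _; exact: discrete_open. Qed.

(** The mass of [C] is the integral of one bounded function of the graph, continuous by
    discreteness. *)
Lemma Lbl_mix_cvg (r : R) (S : nat -> probability (borel ugraph) R) eta C :
  weak_cvg S eta -> measurable C ->
  fine (Lbl_mix r (S j) C) @[j --> \oo] --> fine (Lbl_mix r eta C).
Proof.
move=> Seta mC.
pose f (H : ugraph) : R := fine (Lbl (repr (H : {eq_quot iso_equiv})) r C).
have E mu : fine (Lbl_mix r mu C) = \int[mu]_x f x.
  rewrite /Rintegral /Lbl_mix; congr fine; apply: eq_integral => H _.
  by rewrite /f fineK// fin_num_measure.
under eq_fun do rewrite E; rewrite E.
apply: Seta; first exact: ugraph_continuous.
exists 1; split; first exact: num_real.
move=> x x1 H _; rewrite /= ger0_norm; last exact: fine_ge0.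
apply: le_trans (ltW x1); rewrite -lee_fin fineK ?fin_num_measure//.
exact: probability_le1.
Qed.

Lemma side_near (G : nat -> graph) (s : R) : edges (G j) @[j --> \oo] --> \oo ->
  \forall j \near \oo, s <= side R (G j).
Proof.
move=> hG; have : \forall j \near \oo, ((Num.truncn (s ^+ 2)).+1 <= edges (G j))%N.
  exact: hG _ (nbhs_infty_ge _).
apply: filterS => j Nj; rewrite /side.
have [s0|s0] := leP s 0; first exact: le_trans (sqrtr_ge0 _).
rewrite -(ger0_norm (ltW s0)) -sqrtr_sqr ler_wsqrtr//.
rewrite (le_trans (ltW (Num.Theory.truncnS_gt _)))//.
rewrite (@le_trans _ _ (edges (G j))%:R) ?ler_nat//.
by rewrite mulr_natl mulr2n lerDl.
Qed.

Lemma inner_restrict N (V : set (pconf R)) : exists M : nat,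
  (restrict_square M.+1%:R : borel (pconf R) -> borel (pconf R)) @^-1` inner N V = inner N V.
Proof.
have [c cP] : {c : nat -> nat & forall i, @celln R i `<=` corner (c i)%:R (c i)%:R}.
  by apply: (@choice _ _ (fun i n => @celln R i `<=` corner n%:R n%:R)); exact: celln_corner.
exists (\max_(i < N) c i)%N.
have E mu i : (i < N)%N ->
    (restrict_square (\max_(i < N) c i)%N.+1%:R mu : pconf R) (celln i) = (mu : pconf R) (celln i).
  move=> iN; rewrite -(@pconfIquadrant R (mu : pconf R) (celln i) (@measurable_celln R i)).
  rewrite /restrict_square/= /mrestr; congr ((mu : pconf R) _).
  rewrite squareE; apply/seteqP; split=> [z [zi [zq _]]//|z [zi zq]]; split=> //; split=> //.
  have [z1 z2] := cP i _ zi.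
  have ci : (c i)%:R <= (\max_(i < N) c i)%N.+1%:R :> R.
    by rewrite ler_nat leqW// (@leq_bigmax _ (fun i : 'I_N => c i) (Ordinal iN)).
  by split; [exact: lt_le_trans ci|exact: lt_le_trans ci].
apply/seteqP; split=> mu /= h nu munu; apply: h => i iN.
  by rewrite E// munu.
by rewrite -munu// E.
Qed.

Lemma measurable_inner N (V : set (pconf R)) : measurable (inner N V : set (borel (pconf R))).
Proof.
apply: (@measurable_preimage_inner R _ (borel (pconf R)) id) => i.
exact: measurable_eval (measurable_celln i).
Qed.

Lemma weak_cvg_restrict (P : nat -> probability (borel (pconf R)) R)
    (Q : probability (borel (pconf R)) R) :
  (forall M C, measurable C -> fine (P j (restrict_square M.+1%:R @^-1` C)) @[j --> \oo] -->
    fine (Q (restrict_square M.+1%:R @^-1` C))) ->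
  weak_cvg P Q.
Proof.
move=> PQ; apply: weak_cvg_open => V oV e e0.
have e20 : 0 < e / 2 by rewrite divr_gt0.
have mI N : measurable (inner N V : set (borel (pconf R))) by exact: measurable_inner.
have mV : measurable (V : set (borel (pconf R))) by exact: sub_sigma_algebra.
have : Q (inner N V) @[N --> \oo] --> Q V.
  rewrite [X in _ --> Q X](inner_bigcup oV); apply: nondecreasing_cvg_mu => //.
    exact: bigcupT_measurable.
  exact: inner_homo.
have -> : Q V = (fine (Q V))%:E by rewrite fineK ?fin_num_measure.
move=> /fine_cvgP[_ /cvgrPdist_lt/(_ _ e20)[N _ /(_ N (leqnn N))]] QN.
have [M MP] := inner_restrict N V.
have := PQ M _ (mI N); rewrite MP => /cvgrPdist_lt/(_ _ e20).
apply: filterS => j Pj.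
have PV : fine (P j (inner N V)) <= fine (P j V).
  apply: fine_le; rewrite ?fin_num_measure//.
  by apply: le_measure; rewrite ?inE// => mu; apply.
move: QN Pj; rewrite /= !ltr_distl; set a := fine (Q V); set b := fine (Q _).
by set c := fine (P j _) in PV *; move=> /andP[h1 h2] /andP[h3 h4]; lra.
Qed.

Lemma restrict_square_comp (r s : R) C : r <= s -> measurable C ->
  (restrict_square s : borel (pconf R) -> borel (pconf R)) @^-1` (restrict_square r @^-1` C) =
  restrict_square r @^-1` C.
Proof.
move=> rs mC.
have E mu A : measurable A -> (restrict_square r (restrict_square s mu) : pconf R) A =
    (restrict_square r mu : pconf R) A.
  move=> mA; rewrite /restrict_square/= /mrestr -setIA; congr ((mu : pconf R) (_ `&` _)).
  by apply: setIidl; exact: square_subset.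
apply/seteqP; split=> mu /=.
  by apply: (pconf_eq_borel _ mC).1 => A mA; exact: E.
by apply: (pconf_eq_borel _ mC).2 => A mA; exact: E.
Qed.

(** Restriction to a square is not vaguely continuous, so convergence of the restricted laws is
    recorded beside weak convergence. For real [r] it follows because an event on that square is
    also an event on the next integer square. *)
Lemma embed_cvg (G : nat -> graph) (eta : nat -> probability (borel ugraph) R) :
  edges (G j) @[j --> \oo] --> \oo ->
  (forall n, weak_cvg (fun j => SmplD (G j) n.+1%:R) (eta n)) ->
  exists Q : probability (borel (pconf R)) R,
    weak_cvg (fun j => embed R (G j)) Q /\
    forall r C, measurable C ->
      fine (embed R (G j) (restrict_square r @^-1` C)) @[j --> \oo] -->
      fine (Q (restrict_square r @^-1` C)).
Proof.
move=> hG Geta.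
have PZ M C : measurable C ->
    fine (embed R (G j) (restrict_square M.+1%:R @^-1` C)) @[j --> \oo] -->
    fine (Lbl_mix M.+1%:R (eta M) C).
  move=> mC; have := @Lbl_mix_cvg M.+1%:R _ _ _ (Geta M) mC; apply: cvg_trans.
  apply: near_eq_cvg; near=> j; rewrite embed_restrict//.
  by near: j; exact: side_near.
have [Q QE] := @projective_limit R (fun j => embed R (G j))
  (fun M => [the probability _ _ of Lbl_mix M.+1%:R (eta M)]) PZ.
have PQ M C : measurable C ->
    fine (embed R (G j) (restrict_square M.+1%:R @^-1` C)) @[j --> \oo] -->
    fine (Q (restrict_square M.+1%:R @^-1` C)).
  by move=> mC; rewrite QE//; exact: PZ.
exists Q; split; first exact: weak_cvg_restrict.
move=> r C mC; have mC' : measurable (restrict_square r @^-1` C : set (borel (pconf R))).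
  by rewrite -[X in measurable X]setTI; exact: measurable_restrict_square.
have := PQ (Num.truncn r) _ mC'; rewrite restrict_square_comp//.
exact: ltW (Num.Theory.truncnS_gt _).
Unshelve. all: by end_near. Qed.

Lemma sampling_convergent_embed (G : nat -> graph) : edges (G j) @[j --> \oo] --> \oo ->
  sampling_convergent R G -> weakly_convergent (fun j => embed R (G j)).
Proof.
move=> hG SG.
have [eta etaP] : {eta : nat -> probability (borel ugraph) R &
    forall n, weak_cvg (fun j => SmplD (G j) n.+1%:R) (eta n)}.
  apply: (@choice _ _ (fun n eta => weak_cvg (fun j => SmplD (G j) n.+1%:R) eta)) => n.
  exact: SG.
by have [Q [QP _]] := embed_cvg hG etaP; exists Q.
Qed.

(** On Borel sets [zeta] coincides with the limit [Q] obtained by extension; the masses of [A] under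
    the restricted labelings then tend to both sides. *)
Lemma Lbl_mix_limit (G : nat -> graph) (eta : R -> probability (borel ugraph) R)
    (zeta : probability (borel (pconf R)) R) :
  edges (G j) @[j --> \oo] --> \oo ->
  (forall r : R, 0 <= r -> weak_cvg (fun j => SmplD (G j) r) (eta r)) ->
  weak_cvg (fun j => embed R (G j)) zeta ->
  forall r : R, 0 < r ->
  forall A : set (borel (pconf R)), measurable A ->
  Lbl_mix r (eta r) A = pushforward zeta (restrict_square r) A.
Proof.
move=> hG Geta Gzeta r r0 A mA.
have [Q [QP QE]] := embed_cvg hG (fun n => Geta _ (ler0n R n.+1)).
have mA' : measurable (restrict_square r @^-1` A : set (borel (pconf R))).
  by rewrite -[X in measurable X]setTI; exact: measurable_restrict_square.
rewrite /pushforward (weak_limit_unique Gzeta QP mA').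
have cvg1 := QE r A mA.
have cvg2 : fine (embed R (G j) (restrict_square r @^-1` A)) @[j --> \oo] -->
    fine (Lbl_mix r (eta r) A).
  have := @Lbl_mix_cvg r _ _ _ (Geta r (ltW r0)) mA; apply: cvg_trans.
  apply: near_eq_cvg; near=> j; rewrite embed_restrict//.
  by near: j; exact: side_near.
have E := cvg_unique (@Rhausdorff R) cvg2 cvg1.
transitivity ((fine (Lbl_mix r (eta r) A))%:E).
  by rewrite fineK//; exact: (fin_num_measure [the probability _ _ of Lbl_mix r (eta r)]).
by rewrite E fineK//; exact: fin_num_measure.
Unshelve. all: by end_near. Qed.

End sampling_to_embed.

(** * Samples recovered from labelings *)

Section discrete_limit.
Context (R : realType).

(** Symmetrised, so that every Boolean matrix yields a graph. *)
Definition matrix_graph n (g : {ffun 'I_n * 'I_n -> bool}) : graph :=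
  @Graph n (fun i j => g (i, j) && g (j, i)) (fun i j => andbC (g (i, j)) (g (j, i))).

Lemma unlabel_eq G H : isomorphic G H -> unlabel G = unlabel H.
Proof.
by move=> GH; apply/eqmodP => /=; apply/asboolP.
Qed.

Lemma unlabel_repr (H : ugraph) : unlabel (repr (H : {eq_quot iso_equiv})) = H.
Proof. exact: reprK. Qed.

Definition small (k : nat) : set ugraph :=
  [set H | (nverts (repr (H : {eq_quot iso_equiv})) <= k)%N].

Lemma finite_small k : finite_set (small k).
Proof.
apply: (@sub_finite_set _ _ (\bigcup_(n in `I_k.+1)
  range (fun g : {ffun 'I_n * 'I_n -> bool} => unlabel (matrix_graph g)))).
  move=> H; rewrite /small/=; set G := repr _ => Gk; exists (nverts G) => //.
  exists [ffun p => adj p.1 p.2] => //; rewrite -[RHS]unlabel_repr -/G.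
  apply: unlabel_eq; exists id; first by exists id.
  by move=> i j; rewrite [RHS]/= !ffunE /= [X in _ && X]adj_sym andbb.
apply: bigcup_finite; first exact: finite_II.
by move=> n _; apply: finite_image; exact: finite_finset.
Qed.

Section limit_law.
Variable S : nat -> probability (borel ugraph) R.
Hypothesis S_cvg : forall A, cvg (fine (S j A) @[j --> \oo]).
Hypothesis S_tight : forall e : R, 0 < e -> exists2 T, finite_set T &
  \forall j \near \oo, fine (S j (~` T)) <= e.

Definition setwise_limit (A : set (borel ugraph)) : \bar R :=
  (limn (fun j => fine (S j A)))%:E.

Let l A := limn (fun j => fine (S j A)).

Let l_ge0 A : 0 <= l A.
Proof. by apply: limr_ge; [exact: S_cvg|apply: nearW => j; exact: fine_ge0]. Qed.

Let lU A B : A `&` B = set0 -> l (A `|` B) = l A + l B.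
Proof.
move=> AB; apply/cvg_lim => //.
rewrite (_ : (fun j => _) = fun j => fine (S j A) + fine (S j B)); first exact: cvgD.
apply/funext => j.
by rewrite measureU//; [rewrite fineD ?fin_num_measure//; exact: measurable_ugraph
  |exact: measurable_ugraph|exact: measurable_ugraph].
Qed.

Let l0 : l set0 = 0.
Proof. by apply/cvg_lim => //; apply: cvg_near_cst; apply: nearW => j; rewrite measure0. Qed.

Let setwise_limit0 : setwise_limit set0 = 0%E.
Proof. by rewrite /setwise_limit -/(l _) l0. Qed.

Let setwise_limit_ge0 A : (0 <= setwise_limit A)%E.
Proof. by rewrite lee_fin l_ge0. Qed.

(** Finite additivity passes to the limit, and tightness controls the tail: all late [S j] give mass
    at most [e] to the complement of a finite [T], and the graphs of [T] in the union already lie in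
    finitely many pieces. *)
Let setwise_limit_sigma_additive : semi_sigma_additive setwise_limit.
Proof.
move=> F _ tF _; rewrite /setwise_limit -/(l _).
have E n : (\sum_(0 <= i < n) setwise_limit (F i) = (l (\big[setU/set0]_(i < n) F i))%:E)%E.
  elim: n => [|n IH]; first by rewrite big_nil big_ord0 l0.
  rewrite big_nat_recr//= big_ord_recr/= IH lU ?EFinD//.
  by apply/seteqP; split=> // x []; rewrite -bigcup_mkord => -[i /= iN Fi] Fn;
    have := @tF i n I I (ex_intro _ x (conj Fi Fn)) => /eqP; rewrite ltn_eqF.
under eq_fun do rewrite E.
apply: cvg_EFin; first by apply: nearW.
apply/cvgrPdist_le => e e0.
have [T finT TS] := S_tight e0.
have near1 : \forall n \near \oo, forall H, T H ->
    (\bigcup_i F i) H -> (\big[setU/set0]_(i < n) F i) H.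
  have [X XT] := (@finite_seqP ugraph T).1 finT.
  suff : \forall n \near \oo, forall H, H \in X ->
      (\bigcup_i F i) H -> (\big[setU/set0]_(i < n) F i) H.
    by apply: filterS => n h H; rewrite XT; exact: h.
  elim: X {XT} => [|K X IH]; first by apply: nearW.
  have : \forall n \near \oo, (\bigcup_i F i) K -> (\big[setU/set0]_(i < n) F i) K.
    have [[i _ FiK]|nU] := pselect ((\bigcup_i F i) K); last by apply: nearW.
    by exists i.+1 => // n /= ni _; rewrite -bigcup_mkord; exists i.
  by apply: filterS2 IH => n h hK H; rewrite inE => /orP[/eqP ->|/h].
apply: filterS near1 => n nT /=.
have -> : \bigcup_i F i = \big[setU/set0]_(i < n) F i `|`
    (\bigcup_i F i `\` \big[setU/set0]_(i < n) F i).
  by rewrite setDUK// -bigcup_mkord => x [i _ Fi]; exists i.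
rewrite lU; last by rewrite setDE setICA setICr setI0.
rewrite [_ + l _]addrC addrK ger0_norm//.
apply: limr_le; first exact: S_cvg.
apply: filterS TS => j; apply: le_trans; apply: fine_le.
- exact: (fin_num_measure _ _ (@measurable_ugraph _)).
- exact: (fin_num_measure _ _ (@measurable_ugraph _)).
apply: le_measure; rewrite ?inE; try exact: measurable_ugraph.
by move=> H [UH nH] TH; apply: nH; exact: nT.
Qed.

HB.instance Definition _ := isMeasure.Build _ _ _ setwise_limit
  setwise_limit0 setwise_limit_ge0 setwise_limit_sigma_additive.

Let setwise_limitT : setwise_limit setT = 1%E.
Proof.
congr EFin; apply/cvg_lim => //; apply: cvg_near_cst; apply: nearW => j.
by rewrite probability_setT.
Qed.

HB.instance Definition _ :=
  Measure_isProbability.Build _ _ _ setwise_limit setwise_limitT.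

Lemma setwise_tight_weakly_convergent : weakly_convergent S.
Proof.
exists [the probability _ _ of setwise_limit].
apply: weak_cvg_open => V _ e e0.
have /cvgrPdist_le/(_ _ e0) : fine (S j V) @[j --> \oo] --> l V by exact: S_cvg.
apply: filterS => j; rewrite ler_distl => /andP[_].
by rewrite addrC.
Qed.

End limit_law.
End discrete_limit.

(** * Continuous functionals of the grid occupation *)

Section cell_functional.
Context (R : realType).

Lemma pintegral_restrict (s : R) (mu : pconf R) (f : test_fun R) :
  (forall z, quadrant z -> ~ square s z -> f z = 0) ->
  pintegral (restrict_square s mu) f = pintegral mu f.
Proof.
move=> f0.
have E (nu : {measure set (R * R) -> \bar R}) :
    \int[nu]_(z in quadrant) f z = \int[nu]_(z in quadrant `&` square s) f z.
  rewrite [RHS]Rintegral_mkcondr; apply: eq_Rintegral => z /set_mem qz; rewrite patchE.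
  by case: ifPn => // /negP zs; apply: f0 => // sz; apply: zs; exact: mem_set.
rewrite /pintegral !E /Rintegral; congr fine; apply: eq_measure_integral => A mA Aqs.
by rewrite /= /mrestr setIidl// => z /Aqs[].
Qed.

Lemma continuous_sumr (T : topologicalType) (I : finType) (P : pred I) (f : I -> T -> R) :
  (forall i, continuous (f i)) -> continuous (fun x => \sum_(i | P i) f i x).
Proof.
by move=> fc x; apply: cvg_big; [exact: add_continuous|move=> i _; exact: fc].
Qed.

Lemma continuous_prodr (T : topologicalType) (I : finType) (P : pred I) (f : I -> T -> R) :
  (forall i, continuous (f i)) -> continuous (fun x => \prod_(i | P i) f i x).
Proof.
by move=> fc x; apply: cvg_big; [exact: mul_continuous|move=> i _; exact: fc].
Qed.

Lemma continuous_subr (T : topologicalType) (f g : T -> R) :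
  continuous f -> continuous g -> continuous (fun x => f x - g x).
Proof.
by move=> fc gc x; apply: (@continuousB R R T f g); [exact: fc|exact: gc].
Qed.

Section grid.
Variables (s : R) (m : nat).
Hypothesis s0 : 0 < s.
Notation M := m.+1.

Definition gridpos (x : R) : R := x * (M%:R / s).

(** In cell units, a trapezoid of slope [M]: zero outside the open cell and one on [core a], at
    distance at least [1 / M] from its ends. The margin shrinks as [M] grows, so few labels fall
    near grid lines. *)
Definition bump (a : nat) (x : R) : R :=
  Num.min 1 (Num.max 0 (M%:R * Num.min (gridpos x - a%:R) (a.+1%:R - gridpos x))).

Definition core (a : nat) : set R :=
  [set x | a%:R + M%:R^-1 <= gridpos x <= a.+1%:R - M%:R^-1].

Let M0 : 0 < M%:R :> R.
Proof. by rewrite ltr0n. Qed.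

Let gridpos_continuous : continuous gridpos.
Proof. by apply: continuous_mulr => x; [exact: cvg_id|exact: cvg_cst]. Qed.

Lemma bump_continuous a : continuous (bump a).
Proof.
apply: continuous_minr; first by move=> x; exact: cvg_cst.
apply: continuous_maxr; first by move=> x; exact: cvg_cst.
apply: continuous_mulr; first by move=> x; exact: cvg_cst.
apply: continuous_minr.
  by apply: continuous_subr; [exact: gridpos_continuous|exact: cst_continuous].
by apply: continuous_subr; [exact: cst_continuous|exact: gridpos_continuous].
Qed.

Lemma bump_ge0 a x : 0 <= bump a x.
Proof. by rewrite /bump le_min ler01 le_max lexx. Qed.

Lemma bump_eq0 a x : gridpos x <= a%:R \/ a.+1%:R <= gridpos x -> bump a x = 0.
Proof.
move=> h; rewrite /bump (@max_l _ _ 0) ?(@min_r _ _ 1 0) ?ler01//.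
by rewrite pmulr_rle0// ge_min !subr_le0; case: h => ->; rewrite ?orbT.
Qed.

Lemma bump_outside a x : (a < M)%N -> s <= x -> bump a x = 0.
Proof.
move=> aM sx; apply: bump_eq0; right; rewrite /gridpos mulrA ler_pdivlMr// mulrC.
by rewrite ler_pM ?ler_nat// ltW.
Qed.

Lemma bump_core (a c : nat) x : core c x -> bump a x = (a == c)%:R.
Proof.
rewrite /core/= => /andP[cx xc].
have i0 : 0 < M%:R^-1 :> R by rewrite invr_gt0.
have cg : c%:R < gridpos x by apply: lt_le_trans cx; rewrite ltrDl.
have gc : gridpos x < c.+1%:R by apply: le_lt_trans xc _; rewrite ltrBlDr ltrDl.
case: (ltngtP a c) => [ac|ca|->].
- apply: bump_eq0; right; apply: le_trans (ltW cg).
  by rewrite ler_nat.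
- apply: bump_eq0; left; apply: le_trans (ltW gc) _.
  by rewrite ler_nat.
have h : M%:R^-1 <= Num.min (gridpos x - c%:R) (c.+1%:R - gridpos x).
  by rewrite le_min !lerBrDr addrC cx/= addrC -lerBrDr.
rewrite /bump min_l// le_max; apply/orP; right.
by rewrite -(@ler_pM2l _ M%:R) // mulfV ?gt_eqF// in h.
Qed.

Lemma core_itv a : core a =
  `[(a%:R + M%:R^-1) * (s / M%:R), (a.+1%:R - M%:R^-1) * (s / M%:R)]%classic.
Proof.
have sM : 0 < s / M%:R by rewrite divr_gt0.
apply/seteqP; split=> x /=; rewrite /core/= in_itv/= /gridpos;
  have -> : M%:R / s = (s / M%:R)^-1 by rewrite invf_div.
  by rewrite ler_pdivlMr// ler_pdivrMr.
by rewrite ler_pdivlMr// ler_pdivrMr.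
Qed.

Lemma measurable_core a : measurable (core a : set (measurableTypeR R)).
Proof. by rewrite core_itv; exact: measurable_itv. Qed.

Lemma uniform_core (a : nat) : (a < M)%N -> (1 < M)%N ->
  uniform_law s (core a) = ((1 - 2 / M%:R) / M%:R)%:E.
Proof.
move=> aM M1; have sM : 0 < s / M%:R by rewrite divr_gt0.
have i0 : 0 < M%:R^-1 :> R by rewrite invr_gt0.
have i2 : M%:R^-1 <= 2^-1 :> R by rewrite lef_pV2 ?posrE// ler_nat.
have aM' : a.+1%:R <= M%:R :> R by rewrite ler_nat.
have a0 : 0 <= a%:R :> R by [].
rewrite uniform_lawE//; last exact: measurable_core.
rewrite setIidl; last first.
  rewrite core_itv => x /=; rewrite !in_itv/= => /andP[h1 h2]; apply/andP; split.
    by apply: le_trans h1; rewrite mulr_ge0 ?addr_ge0// ltW.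
  apply: le_lt_trans h2 _; rewrite mulrA ltr_pdivrMr// [_ * s]mulrC ltr_pM2l//.
  by rewrite ltrBlDr (le_lt_trans aM')// ltrDl.
rewrite core_itv lebesgue_measure_itv/= lte_fin ltr_pM2r//.
rewrite -[a.+1%:R in X in if X then _ else _]natr1 -[a.+1%:R]natr1.
have -> : (1 - 2 / M%:R) / M%:R = s^-1 * ((a%:R + 1 - M%:R^-1) * (s / M%:R) -
    (a%:R + M%:R^-1) * (s / M%:R)).
  rewrite -mulrBl mulrCA (mulrA s^-1) mulVf ?gt_eqF// mul1r; congr (_ * _).
  by move: M%:R^-1 => i; lra.
(* The core is degenerate only for [M = 2], where the margins fill the cell; the formula then gives
   0 too. *)
case: ltP => h; first by rewrite -EFinB -EFinM.
rewrite mule0; congr EFin; rewrite -mulrBl (_ : _ - _ = 0) ?mul0r ?mulr0//.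
move: h i2; move: M%:R^-1 => i h i2; lra.
Qed.

Definition cell_test (p : 'I_M * 'I_M) : test_fun R :=
  @prod_test R (bump p.1) (bump p.2) s (@bump_continuous p.1) (@bump_continuous p.2)
    (fun x sx => bump_outside (ltn_ord p.1) (ltW sx))
    (fun x sx => bump_outside (ltn_ord p.2) (ltW sx)).

(** Continuous nonemptiness: 0 if no point lies in the open cell, 1 if some point lies in the
    product of the cores. *)
Definition occupied (mu : pconf R) (p : 'I_M * 'I_M) : R :=
  Num.min 1 (pintegral mu (cell_test p)).

Lemma occupied_bounds mu p : 0 <= occupied mu p <= 1.
Proof.
rewrite /occupied ge_min lexx/= andbT le_min ler01/=.
by apply: Rintegral_ge0 => z _; rewrite /= mulr_ge0 ?bump_ge0.
Qed.

Lemma occupied_continuous p : continuous (fun mu => occupied mu p).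
Proof.
apply: (@continuous_minr R (pconf R) (cst 1)); first exact: cst_continuous.
exact: pintegral_continuous.
Qed.

Lemma occupied_restrict mu p : occupied (restrict_square s mu) p = occupied mu p.
Proof.
rewrite /occupied pintegral_restrict// => z [qz1 qz2] nz /=.
have [z1|z1] := leP s z.1; first by rewrite (bump_outside (ltn_ord p.1) z1) mul0r.
have [z2|z2] := leP s z.2; first by rewrite (bump_outside (ltn_ord p.2) z2) mulr0.
exfalso; apply: nz; move: qz1 qz2; rewrite /= !in_itv/= !andbT => qz1 qz2.
by split; rewrite /= in_itv/=; apply/andP.
Qed.

(** The probability of the pattern [g] if each cell is independently declared nonempty with
    probability [occupied mu p]; hence the weights sum to 1. *)
Definition pattern_weight (g : {ffun 'I_M * 'I_M -> bool}) (mu : pconf R) : R :=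
  \prod_p (if g p then occupied mu p else 1 - occupied mu p).

Definition pattern_ugraph (g : {ffun 'I_M * 'I_M -> bool}) : ugraph :=
  unlabel (rm_isolated (matrix_graph g)).

(* A continuous surrogate for the indicator that the nonempty cells of the grid
   form, up to isolated vertices, the adjacency matrix of a graph in A. *)
Definition pattern_mass (A : set ugraph) (mu : pconf R) : R :=
  \sum_(g | `[< A (pattern_ugraph g) >]) pattern_weight g mu.

Lemma pattern_weight_ge0 g mu : 0 <= pattern_weight g mu.
Proof.
apply: prodr_ge0 => p _; have /andP[h0 h1] := occupied_bounds mu p.
by case: ifP; rewrite ?subr_ge0.
Qed.

Lemma pattern_mass_ge0 A mu : 0 <= pattern_mass A mu.
Proof. by apply: sumr_ge0 => g _; exact: pattern_weight_ge0. Qed.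

Lemma pattern_mass_ge A g mu : A (pattern_ugraph g) ->
  pattern_weight g mu <= pattern_mass A mu.
Proof.
move=> Ag; rewrite /pattern_mass (bigD1 g)/=; last exact/asboolP.
by rewrite lerDl; apply: sumr_ge0 => h _; exact: pattern_weight_ge0.
Qed.

Lemma pattern_massC A mu : pattern_mass A mu + pattern_mass (~` A) mu = 1.
Proof.
transitivity (\sum_g pattern_weight g mu).
  rewrite (bigID (fun g => `[< A (pattern_ugraph g) >]))/=; congr (_ + _).
  by apply: eq_bigl => g; apply/asboolP/negP => [nA /asboolP//|nA Ag]; apply: nA; exact/asboolP.
rewrite /pattern_weight.
rewrite -(bigA_distr_bigA (fun p b => if b then occupied mu p else 1 - occupied mu p)).
by apply: big1 => p _; rewrite big_bool/= subrKC.
Qed.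

Lemma pattern_mass_continuous A : continuous (pattern_mass A).
Proof.
apply: continuous_sumr => g; apply: continuous_prodr => p.
case: (g p); first exact: occupied_continuous.
apply: (@continuous_subr (pconf R) (cst 1)); first exact: cst_continuous.
exact: occupied_continuous.
Qed.

Lemma pattern_mass_restrict A mu : pattern_mass A (restrict_square s mu) = pattern_mass A mu.
Proof.
apply: eq_bigr => g _; apply: eq_bigr => p _.
by rewrite occupied_restrict.
Qed.
End grid.
End cell_functional.

(** * Recovering a graph from the grid *)

Section grid_sampling.
Context (R : realType).

Section pattern.
Variables (K : graph) (m : nat) (c : 'I_(nverts K) -> 'I_m.+1).
Hypothesis no_isolated : forall i : 'I_(nverts K), exists j, adj i j.
Hypothesis c_inj : injective c.

Definition pattern : {ffun 'I_m.+1 * 'I_m.+1 -> bool} :=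
  [ffun p => [exists q : 'I_(nverts K) * 'I_(nverts K),
    adj q.1 q.2 && ((c q.1, c q.2) == p)]].

Let pattern_adj i j : pattern (c i, c j) = adj i j.
Proof.
rewrite ffunE; apply/existsP/idP => [[[i' j'] /= /andP[ij /eqP[/c_inj <- /c_inj <-]]]//|ij].
by exists (i, j); rewrite /= ij eqxx.
Qed.

Let patternP a b : pattern (a, b) -> a \in codom c.
Proof.
by rewrite ffunE => /existsP[[i j] /= /andP[_ /eqP[<- _]]]; exact: codom_f.
Qed.

Let mg_adj i j : @adj (matrix_graph pattern) (c i) (c j) = adj i j.
Proof. by rewrite /= !pattern_adj [X in _ && X]adj_sym andbb. Qed.

Let S : {set 'I_m.+1} := [set i : 'I_(nverts (matrix_graph pattern)) | [exists j, adj i j]]%SET.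

Let SE : S = [set c i | i : 'I_(nverts K)]%SET.
Proof.
apply/setP => a; rewrite inE; apply/existsP/imsetP => [[b /andP[ab _]]|[i _ ->]].
  by have /codomP[i ->] := patternP ab; exists i.
by have [j ij] := no_isolated i; exists (c j); rewrite mg_adj.
Qed.

(** Every vertex of [K] has a neighbour, so the nonisolated vertices of the pattern are exactly the
    cells [c i], and [c] becomes an isomorphism. *)
Lemma pattern_ugraphE : pattern_ugraph pattern = unlabel K.
Proof.
apply/esym/unlabel_eq.
have cS i : c i \in S by rewrite SE imset_f.
exists (fun i => enum_rank_in (cS i) (c i) : 'I_(nverts (rm_isolated (matrix_graph pattern)))).
  apply: inj_card_bij; last first.
    by rewrite !card_ord; change (#|S| <= nverts K)%N; rewrite SE card_imset// card_ord.
  move=> i j /(congr1 enum_val); rewrite !enum_rankK_in//; exact: c_inj.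
by move=> i j; rewrite [LHS]/= !enum_rankK_in// -mg_adj.
Qed.

Section core.
Variables (s : R) (s0 : 0 < s) (u : (nverts K).-tuple (measurableTypeR R)).
Hypothesis ucore : forall i, core s m (c i) (tnth u i).

Let clamp_core i : clamp (tnth u i : R) = tnth u i.
Proof.
apply: clamp_id; have /andP[h _] := ucore i.
have : 0 <= gridpos s m (tnth u i).
  by apply: le_trans h; rewrite addr_ge0// invr_ge0.
by rewrite /gridpos pmulr_lge0// divr_gt0.
Qed.

Lemma occupied_pattern p : occupied s0 (labeling u) p = (pattern p)%:R.
Proof.
have -> : occupied s0 (labeling u) p = Num.min 1
    (\sum_(q : 'I_(nverts K) * 'I_(nverts K) | adj q.1 q.2)
      (((c q.1, c q.2) == p)%:R : R)).
  rewrite /occupied; congr (Num.min 1 _).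
  rewrite /pintegral lbl_integral; last first.
    apply: epscontinuous_measurableR.
    apply: (@prod_test_continuous R (bump s m p.1) (bump s m p.2)) => x;
      exact: bump_continuous.
  apply: eq_bigr => q _; rewrite /= !clamp_core !(bump_core _ (ucore _)) -natrM mulnb.
  by case: p => a b; rewrite xpair_eqE /= [c q.1 == a]eq_sym [c q.2 == b]eq_sym.
case: (boolP (pattern p)) => [|np].
  rewrite ffunE => /existsP[q /andP[qa qp]]; rewrite (bigD1 q)//= qp min_l//.
  by rewrite lerDl sumr_ge0.
rewrite big1 ?min_r// => q qa; case: eqP => // qp.
by move: np; rewrite ffunE => /existsP[]; exists q; rewrite qa qp eqxx.
Qed.

Lemma pattern_mass_core (A : set ugraph) :
  A (unlabel K) -> 1 <= pattern_mass m s0 A (labeling u).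
Proof.
rewrite -pattern_ugraphE => /(pattern_mass_ge s0 (labeling u)); apply: le_trans.
rewrite /pattern_weight big1// => p _; rewrite occupied_pattern.
by case: (pattern p); rewrite ?subr0.
Qed.
End core.
End pattern.

Lemma bernoulli_ge (x : R) n : 0 <= x <= 1 -> 1 - n%:R * x <= (1 - x) ^+ n.
Proof.
move=> /andP[x0 x1]; elim: n => [|n IH]; first by rewrite mul0r subr0 expr0.
rewrite exprSr; apply: le_trans (ler_wpM2r _ IH); last by rewrite subr_ge0.
rewrite -natr1; have : 0 <= n%:R * x * x by rewrite !mulr_ge0.
move: (n%:R) => y; lra.
Qed.

Lemma ffact_ge n k j : (j <= k)%N -> ((n - k) ^ j <= n ^_ j)%N.
Proof.
elim: j => // j IH jk; rewrite expnSr ffactnSr; apply: leq_mul; first exact: IH (ltnW jk).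
by apply: leq_sub2l; exact: ltnW.
Qed.

(** With [M = m.+1], the right side is the probability that [k] labels fall into cores of distinct
    cells: injective placements times the probability of each. It is at least
    [((1 - k / M) (1 - 2 / M)) ^+ k], hence at least [(1 - (k + 2) / M) ^+ k], and Bernoulli's
    inequality applies. *)
Lemma ffact_core_ge k m : (k.+2 <= m.+1)%N ->
  1 - (k * k.+2)%:R / m.+1%:R <=
  (m.+1 ^_ k)%:R * ((1 - 2 / m.+1%:R) / m.+1%:R) ^+ k :> R.
Proof.
move=> kM; set M := m.+1 in kM *.
have M0 : 0 < M%:R :> R by rewrite ltr0n.
have i0 : 0 <= M%:R^-1 :> R by rewrite invr_ge0.
have i1 : k.+2%:R / M%:R <= 1 :> R by rewrite ler_pdivrMr// mul1r ler_nat.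
rewrite natrM -mulrA; apply: le_trans (bernoulli_ge k _) _.
  by rewrite i1 divr_ge0.
have k2 : k.+2%:R = k%:R + 2 :> R by rewrite -addn2 natrD.
have h2 : 0 <= 1 - 2 / M%:R :> R.
  rewrite subr_ge0; apply: le_trans i1; rewrite ler_wpM2r// k2 lerDr//.
have hk : 0 <= 1 - k%:R / M%:R :> R.
  rewrite subr_ge0; apply: le_trans i1; rewrite ler_wpM2r// k2 lerDl//.
apply: (@le_trans _ _ (((1 - k%:R / M%:R) * (1 - 2 / M%:R)) ^+ k)).
  apply: lerXn2r; rewrite ?nnegrE ?mulr_ge0// ?subr_ge0//.
  have : 0 <= (k%:R / M%:R) * (2 / M%:R) :> R by rewrite mulr_ge0// divr_ge0.
  rewrite k2 [(_ + 2) * _]mulrDl; move: (k%:R / M%:R) (2 / M%:R) => x y; lra.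
rewrite [leLHS]exprMn (exprMn _ (1 - _)) [leLHS]mulrC [leRHS]mulrCA ler_wpM2l ?exprn_ge0//.
have -> : 1 - k%:R / M%:R = (M - k)%:R / M%:R :> R.
  have kM' : (k <= M)%N by apply: leq_trans kM; rewrite ltnW.
  by rewrite (natrB _ kM') mulrBl mulfV ?gt_eqF.
rewrite exprMn ler_wpM2r ?exprn_ge0// -natrX ler_nat; exact: ffact_ge.
Qed.

(** Sums over the injective placements of the vertices in cells. The corresponding events are
    disjoint, and on each of them the grid determines [K]. *)
Lemma Lbl_pattern_mass (K : graph) (m : nat) (s : R) (s0 : 0 < s) (A : set ugraph) :
  (forall i : 'I_(nverts K), exists j, adj i j) ->
  (nverts K + 2 <= m.+1)%N -> A (unlabel K) ->
  ((1 - (nverts K * (nverts K).+2)%:R / m.+1%:R)%:E <=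
   Lbl K s [set mu | 1 <= pattern_mass m s0 A mu]%R)%E.
Proof.
move=> noiso kM AK; set k := nverts K in kM *.
pose box (c : {ffun 'I_k -> 'I_m.+1}) : set (k.-tuple (measurableTypeR R)) :=
  [set t | forall i, core s m (c i) (tnth t i)].
pose F (c : {ffun 'I_k -> 'I_m.+1}) := if injectiveb c then box c else set0.
have mbox c : measurable (box c).
  apply: (@measurable_tuple_box _ (measurableTypeR R) k (fun i => core s m (c i))) => i.
  exact: measurable_core.
have mF c : measurable (F c) by rewrite /F; case: ifP.
have mX : measurable ([set mu | 1 <= pattern_mass m s0 A mu] : set (borel (pconf R))).
  exact: measurable_superlevel (@pattern_mass_continuous R s m s0 A).
have tF : trivIset setT F.
  move=> c d _ _ [u []]; rewrite /F; case: ifP => // _ uc; case: ifP => // _ ud.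
  apply/ffunP => i; apply: val_inj; apply/eqP.
  (* A bump tells the cores of two cells apart: it is 1 on its own core and 0 on the other. *)
  have := bump_core (c i) (uc i); rewrite (bump_core (c i) (ud i)) eqxx.
  by case: eqP => // _ /eqP; rewrite eq_sym oner_eq0.
have iF c : (iid (uniform_law s) k (F c) = if injectiveb c then
    (((1 - 2 / m.+1%:R) / m.+1%:R) ^+ k)%:E else 0)%E.
  rewrite /F; case: ifP => _; last exact: measure0.
  rewrite (@iid_box _ (measurableTypeR R) R _ k (fun i => core s m (c i))) => [|i];
    last exact: measurable_core.
  rewrite (eq_bigr (fun=> ((1 - 2 / m.+1%:R) / m.+1%:R)%:E)) => [|i _].
    by rewrite prodEFin prodr_const card_ord.
  by rewrite uniform_core// (leq_trans _ kM)// addn2.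
apply: le_trans (_ : (iid (uniform_law s) k (\bigcup_c F c) <= _)%E).
  rewrite measure_sum_fin//; have -> : (\sum_c iid (uniform_law s) k (F c) =
      \sum_(c : {ffun 'I_k -> 'I_m.+1}) if injectiveb c
        then (((1 - 2 / m.+1%:R) / m.+1%:R) ^+ k)%:E else 0)%E.
    by apply: eq_bigr => c _; exact: iF.
  rewrite -big_mkcond/= sumEFin lee_fin sumr_const.
  have -> : #|[pred c : {ffun 'I_k -> 'I_m.+1} | injectiveb c]| = (m.+1 ^_ k)%N.
    by have := card_inj_ffuns 'I_k 'I_m.+1; rewrite !card_ord => <-; rewrite cardsE.
  rewrite -[leRHS]mulr_natl; apply: ffact_core_ge; by rewrite -addn2.
apply: le_measure; rewrite ?inE.
- by apply: fin_bigcup_measurable => //; exact: finite_finset.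
- by rewrite -[X in measurable X]setTI; exact: measurable_labeling.
move=> u [c _]; rewrite /F; case: ifPn => // /injectiveP ci uc.
exact: (pattern_mass_core noiso ci s0 uc AK).
Qed.
End grid_sampling.

(** * Tightness through the mass of the square *)

Section embed_to_sampling.
Context (R : realType).

Lemma probability_le_integral (T : ptopologicalType) (P : probability (borel T) R)
    (C : set (borel T)) (f : T -> R) :
  measurable C -> continuous f -> (forall x, 0 <= f x <= 1) ->
  (forall x, C x -> 1 <= f x) -> fine (P C) <= \int[P]_x f x.
Proof.
move=> mC fc f01 fC; have mf := continuous_borel fc.
have -> : fine (P C) = \int[P]_x (\1_C x : R) by rewrite /Rintegral integral_indic// setIT.
have i1 : P.-integrable setT (EFin \o (\1_C : borel T -> R)).
  apply: (@integrable_bounded_borel R T P _ 1); first exact: measurable_indic.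
  by move=> x; rewrite indicE ger0_norm//; case: (_ \in _).
have i2 : P.-integrable setT (EFin \o (f : borel T -> R)).
  apply: (@integrable_bounded_borel R T P _ 1) => // x.
  by have /andP[f0 f1] := f01 x; rewrite ger0_norm.
apply: (le_Rintegral _ i1 i2) => // x _; rewrite indicE.
case: (boolP (x \in C)) => [|_]; first by rewrite inE; exact: fC.
by have /andP[] := f01 x.
Qed.

Definition saturated (r : R) (k : nat) : set (borel (pconf R)) :=
  [set mu | (k%:R%:E < (mu : pconf R) (square r))%E].

Lemma measurable_saturated r k : measurable (saturated r k).
Proof.
have := measurable_eval (@measurable_square R r).
move=> /(_ measurableT `]k%:R%:E, +oo[%classic (emeasurable_itv _)).
rewrite setTI; congr measurable; apply/seteqP; split=> mu /=; rewrite in_itv/= andbT//.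
Qed.

Lemma saturated_restrict r k :
  (restrict_square r : borel (pconf R) -> borel (pconf R)) @^-1` saturated r k = saturated r k.
Proof.
by apply/seteqP; split=> mu; rewrite /saturated /= /mrestr setIid.
Qed.

Notation square_test r := (corner_test 1 (r + 1) (r + 1)).

(** A ramp of slope 1 ending at [r + 1] equals 1 below [r], so the test function dominates the
    indicator of the square. *)
Lemma square_le (mu : pconf R) (r : R) :
  (mu (square r) <= (pintegral mu (square_test r))%:E)%E.
Proof.
rewrite -integral_corner_test -pconfIquadrant; last exact: measurable_square.
rewrite -integral_indic; [|exact: measurable_quadrant|exact: measurable_square].
apply: ge0_le_integral => //; first exact: measurable_quadrant.
- by apply/measurable_EFinP/measurable_indic; exact: measurable_square.
- exact: measurable_corner_test.
move=> z _; rewrite lee_fin indicE; case: (boolP (z \in square r)); last first.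
  by rewrite corner_test_ge0.
rewrite inE => -[]; rewrite /= !in_itv/= => /andP[_ z1] /andP[_ z2].
have ramp1 (x : R) : x < r -> ramp 1 (r + 1) x = 1.
  move=> xr; rewrite /ramp mul1r min_l// le_max; apply/orP; right.
  by rewrite lerBrDr addrC lerD2r ltW.
by rewrite !ramp1// mulr1.
Qed.

(** A continuous bound for the indicator of [saturated r k.+1]. It tends to 0 at each configuration
    because test integrals are finite, and dominated convergence applies. *)
Definition saturation (r : R) (k : nat) (mu : pconf R) : R :=
  Num.min 1 (pintegral mu (square_test r) * k.+1%:R^-1).

Lemma square_test_ge0 (mu : pconf R) r : 0 <= pintegral mu (square_test r).
Proof. by apply: Rintegral_ge0 => z _; exact: corner_test_ge0. Qed.

Lemma saturation_bounds r k mu : 0 <= saturation r k mu <= 1.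
Proof.
by rewrite /saturation le_min ler01 ge_min lexx/= andbT mulr_ge0 ?square_test_ge0.
Qed.

Lemma saturation_continuous r k : continuous (saturation r k).
Proof.
apply: (@continuous_minr R (pconf R) (cst 1)); first exact: cst_continuous.
apply: (@continuous_mulr R (pconf R) _ (cst k.+1%:R^-1)); last exact: cst_continuous.
exact: pintegral_continuous.
Qed.

Lemma saturated_le r k mu : saturated r k.+1 mu -> 1 <= saturation r k mu.
Proof.
rewrite /saturated/= => /lt_le_trans/(_ (square_le _ _)); rewrite lte_fin => h.
by rewrite /saturation le_min lexx/= ler_pdivlMr ?ltr0n// mul1r ltW.
Qed.

Lemma saturation_integral_cvg (P : probability (borel (pconf R)) R) r :
  \int[P]_mu saturation r k mu @[k --> \oo] --> (0 : R).
Proof.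
have ms k : measurable_fun setT (saturation r k : borel (pconf R) -> R).
  exact: continuous_borel (@saturation_continuous r k).
have [] := @dominated_convergence _ _ _ P setT measurableT
  (fun k mu => (saturation r k mu)%:E) (cst 0%E) (cst 1%E).
- by move=> k; apply/measurable_EFinP.
- exact: measurable_cst.
- apply: aeW => /= mu _; apply: cvg_EFin; first exact: nearW.
  have h : pintegral mu (square_test r) * k.+1%:R^-1 @[k --> \oo] --> (0 : R).
    rewrite -[X in _ --> X](mulr0 (pintegral mu (square_test r))).
    by apply: cvgM; [exact: cvg_cst|exact: cvg_harmonic].
  rewrite -[X in _ --> X](@min_r _ _ 1 0)//.
  have mc : continuous (Num.min (1 : R)).
    by apply: (@continuous_minr R R (cst 1) id) => x; [exact: cvg_cst|exact: cvg_id].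
  exact: cvg_comp h (mc 0).
- by apply/integrableP; split; [exact: measurable_cst|];
    rewrite integral_cst//= normr1 mul1e (le_lt_trans (probability_le1 _ _))// ltry.
- apply: aeW => /= mu k _; have /andP[h0 h1] := saturation_bounds r k mu.
  by rewrite lee_fin ger0_norm.
move=> _ _; rewrite integral_cst// mul0e.
have E k : (\int[P]_mu (saturation r k mu)%:E)%E = (\int[P]_mu saturation r k mu)%:E.
  rewrite /Rintegral fineK//; apply: integrable_fin_num => //.
  apply: (@integrable_bounded_borel R (pconf R) P _ 1) => // mu.
  by have /andP[h0 h1] := saturation_bounds r k mu; rewrite ger0_norm.
by under eq_fun do rewrite E; move/fine_cvgP => [].
Qed.
End embed_to_sampling.

(** * Convergence of the sampling laws *)

Section backward.
Context (R : realType).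

Definition isolated_free : set ugraph :=
  [set H | forall i : 'I_(nverts (repr (H : {eq_quot iso_equiv}))), exists j, adj i j].

Lemma SmplD_isolated_free G (s : R) : SmplD G s (~` isolated_free) = 0%E.
Proof.
have E : @kept_graph G @^-1` (~` isolated_free) = set0.
  apply/seteqP; split=> // b; apply => i.
  have [f [g fK gK] fadj] := repr_unlabel (kept b).
  have [j ij] := kept_adj (f i).
  by exists (g j); rewrite -fadj gK.
rewrite /SmplD /Smpl; change (iid (bernoulli_prob (Num.min (s / side R G) 1)) (nverts G)
  (@kept_graph G @^-1` (~` isolated_free)) = 0%E).
by rewrite E measure0.
Qed.

Lemma Lbl_mix_ge (r : R) (eta : probability (borel ugraph) R) (X : set ugraph)
    (a : R) C : measurable C -> 0 <= a ->
  (forall H, X H -> a%:E <= Lbl (repr (H : {eq_quot iso_equiv})) r C)%E ->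
  (a%:E * eta (X : set (borel ugraph)) <= Lbl_mix r eta C)%E.
Proof.
move=> mC a0 aX; have mX : measurable (X : set (borel ugraph)) by exact: measurable_ugraph.
have mf D : measurable_fun D (fun H : borel ugraph =>
    Lbl (repr (H : {eq_quot iso_equiv})) r C : \bar R).
  by move=> _ A _; exact: measurable_ugraph.
rewrite -(integral_cst eta mX) /Lbl_mix.
apply: (@le_trans _ _ (\int[eta]_(H in X) Lbl (repr (H : {eq_quot iso_equiv})) r C)%E).
  by apply: ge0_le_integral.
by apply: ge0_subset_integral => // H _; exact: measure_ge0.
Qed.

(** Choosing a neighbour of each vertex, possibly itself, injects the vertices into the ordered
    adjacent pairs; almost surely all edge points lie in the square. *)
Lemma Lbl_saturated (K : graph) (r : R) k : 0 < r ->
  (forall i : 'I_(nverts K), exists j, adj i j) -> (k < nverts K)%N ->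
  (1 <= Lbl K r (saturated r k))%E.
Proof.
move=> r0 noiso kK.
pose E : set ((nverts K).-tuple (measurableTypeR R)) :=
  [set u | forall i, `]-oo, r[%classic (tnth u i)].
have mE : measurable E.
  by apply: (@measurable_tuple_box _ (measurableTypeR R) _ (fun=> `]-oo, r[%classic)).
have <- : iid (uniform_law r) (nverts K) E = 1%E.
  rewrite (@iid_box _ (measurableTypeR R) R _ _ (fun=> `]-oo, r[%classic))//.
  rewrite big1// => i _; have := @uniform_law_lt R r r setT r0 (lexx r) measurableT.
  rewrite setIT divff ?gt_eqF// mul1e => ->; exact: probability_setT.
apply: le_measure; rewrite ?inE//.
  rewrite -[X in measurable X]setTI; apply: measurable_labeling => //.
  exact: measurable_saturated.
move=> u uE; have ur i : (tnth u i < r :> R) by have := uE i; rewrite /= in_itv.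
rewrite /saturated /= /lbl_measure.
rewrite (eq_bigr (fun=> 1%E)) => [|p _]; last first.
  by rewrite diracE mem_set//; split; rewrite /= in_itv/= clamp_ge0/= /clamp gt_max r0/= ur.
have [nb nbP] : {nb : 'I_(nverts K) -> 'I_(nverts K) & forall i, adj i (nb i)}.
  by apply: (@choice _ _ (fun i j => adj i j)) => i; exact: noiso.
rewrite sumEFin sumr_const lte_fin ltr_nat (leq_trans kK)//.
have nbi : injective (fun i => (i, nb i)) by move=> i j [].
rewrite -[X in (X <= _)%N]card_ord -(card_imset _ nbi).
by apply/subset_leq_card/fintype.subsetP => _ /imsetP[i _ ->]; exact: nbP.
Qed.

Section limit.
Variables (G : nat -> graph) (s : R) (zeta : probability (borel (pconf R)) R).
Hypothesis hG : edges (G j) @[j --> \oo] --> \oo.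
Hypothesis Gzeta : weak_cvg (fun j => embed R (G j)) zeta.
Hypothesis s0 : 0 < s.

Let S j := SmplD (G j) s.

Let fin (X : set ugraph) j : S j X \is a fin_num.
Proof. apply: fin_num_measure; exact: measurable_ugraph. Qed.

(** [k] is chosen for the single law [zeta]; weak convergence of the integrals of [saturation s k]
    transfers the bound to late [embed R (G j)], where a large sample saturates the square. *)
Lemma SmplD_tight (e : R) : 0 < e ->
  exists k, \forall j \near \oo, fine (S j (~` small k)) <= e.
Proof.
move=> e0; have e20 : 0 < e / 2 by rewrite divr_gt0.
have /cvgrPdist_lt/(_ _ e20)[k _ /(_ k (leqnn k))] := saturation_integral_cvg zeta s.
rewrite sub0r normrN => /ltr_normlW zk.
have bk := bounded_fun01 (saturation_bounds s k).
have := Gzeta (@saturation_continuous R s k) bk.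
move=> /cvgrPdist_lt/(_ _ e20) Pk; exists k.+1.
near=> j.
have sj : s <= side R (G j) by near: j; exact: side_near.
have : `|\int[zeta]_mu saturation s k mu - \int[embed R (G j)]_mu saturation s k mu| < e / 2.
  by near: j.
rewrite ltr_distlC => /andP[_ Pj].
have h1 : fine (S j (~` small k.+1)) <= fine (embed R (G j) (saturated s k.+1)).
  apply: fine_le; [exact: fin|exact: fin_num_measure (measurable_saturated s k.+1)|].
  rewrite -{1}saturated_restrict embed_restrict//; last exact: measurable_saturated.
  apply: (@le_trans _ _ (S j (isolated_free `\` small k.+1))).
    rewrite (_ : ~` small k.+1 = (isolated_free `\` small k.+1) `|`
        (~` isolated_free `\` small k.+1)); last first.
      by rewrite !setDE -setIUl setUv setTI.
    apply: le_trans (measureU2 _ (@measurable_ugraph _) (@measurable_ugraph _)) _.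
    rewrite [X in (_ + X)%E](_ : _ = 0%E) ?adde0//.
    apply/eqP; rewrite -measure_le0 -(SmplD_isolated_free (G j) s); apply: le_measure.
    - by rewrite inE; exact: measurable_ugraph.
    - by rewrite inE; exact: measurable_ugraph.
    - by move=> H [].
  rewrite -[X in (X <= _)%E]mul1e; apply: Lbl_mix_ge => //; first exact: measurable_saturated.
  by move=> H [Hi /negP]; rewrite -ltnNge => Hk; exact: Lbl_saturated.
apply: (le_trans h1).
have h2 := @probability_le_integral R (pconf R) (embed R (G j)) _ _
  (measurable_saturated s k.+1) (@saturation_continuous R s k)
  (saturation_bounds s k) (@saturated_le R s k).
by apply: (le_trans h2); apply/ltW; lra.
Unshelve. all: by end_near. Qed.

Lemma pattern_mass_bounds m A mu : 0 <= pattern_mass m s0 A mu <= 1.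
Proof.
rewrite pattern_mass_ge0/= -(@pattern_massC R s m s0 A mu) lerDl.
exact: pattern_mass_ge0.
Qed.

(** One [e] bounds the chance that the grid fails to recover a small graph, the other the mass of
    samples with more than [k] vertices. *)
Lemma SmplD_le_pattern (e : R) k m (A : set ugraph) j : 0 < e -> (k.+2 <= m.+1)%N ->
  (k * k.+2)%:R / m.+1%:R <= e -> s <= side R (G j) -> fine (S j (~` small k)) <= e ->
  fine (S j A) <= \int[embed R (G j)]_mu pattern_mass m s0 A mu + e + e.
Proof.
move=> e0 km kme sj Sk.
pose C : set (borel (pconf R)) := [set mu | 1 <= pattern_mass m s0 A mu].
have mC : measurable C.
  exact: measurable_superlevel (@pattern_mass_continuous R s m s0 A).
pose X := A `&` small k `&` isolated_free.
have XC : (1 - e) * fine (S j X) <= fine (embed R (G j) C).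
  have [e1|e1] := leP e 1; last first.
    apply: (@le_trans _ _ 0); last exact: fine_ge0.
    by rewrite mulr_le0_ge0 ?fine_ge0// subr_le0 ltW.
  rewrite -lee_fin EFinM fineK ?fin// fineK ?fin_num_measure//.
  have CE : restrict_square s @^-1` C = C.
    by apply/seteqP; split=> mu; rewrite /C /= pattern_mass_restrict.
  rewrite -CE embed_restrict//; apply: Lbl_mix_ge => //; first by rewrite subr_ge0.
  move=> H [[HA Hk] Hi].
  have Hk2 : ((nverts (repr (H : {eq_quot iso_equiv}))) + 2 <= m.+1)%N.
    by rewrite addn2 (leq_trans _ km)// !ltnS.
  apply: le_trans (Lbl_pattern_mass s0 Hi Hk2 _); last by rewrite unlabel_repr.
  rewrite lee_fin lerD2l lerN2; apply: le_trans kme.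
  by rewrite ler_wpM2r// ler_nat leq_mul// !ltnS.
have AX : fine (S j A) <= fine (S j X) + e.
  apply: (@le_trans _ _ (fine (S j X) + fine (S j (~` small k)))); last by rewrite lerD2l.
  rewrite -fineD ?fin//; apply: fine_le; rewrite ?fin_numD ?fin//.
  have -> : S j (~` small k) = (S j (~` small k) + S j (~` isolated_free))%E.
    by rewrite [S j (~` isolated_free)]SmplD_isolated_free adde0.
  apply: (@le_trans _ _ (S j (X `|` (~` small k `|` ~` isolated_free)))).
    apply: le_measure; rewrite ?inE; try exact: measurable_ugraph.
    move=> H HA; have [Hk|] := pselect (small k H); last by right; left.
    by have [Hi|] := pselect (isolated_free H); [left|right; right].
  apply: le_trans (measureU2 _ (@measurable_ugraph _) (@measurable_ugraph _)) _.
  by rewrite leeD2l// measureU2//; exact: measurable_ugraph.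
have CF : fine (embed R (G j) C) <= \int[embed R (G j)]_mu pattern_mass m s0 A mu.
  apply: probability_le_integral => //; first exact: pattern_mass_continuous.
  exact: pattern_mass_bounds.
have SX1 : fine (S j X) <= 1.
  by rewrite -lee_fin fineK ?fin//; apply: probability_le1; exact: measurable_ugraph.
have eX : e * fine (S j X) <= e by rewrite ger_pMr.
move: XC AX CF eX; rewrite mulrBl mul1r.
move: (\int[_]_mu _) (fine (S j X)) (fine (S j A)) (fine (embed R (G j) C)) (e * _).
move=> x1 x2 x3 x4 x5.
lra.
Qed.

Lemma SmplD_setwise_cvg (A : set ugraph) : cvg (fine (S j A) @[j --> \oo]).
Proof.
apply/cauchy_cvgP/cauchy_exP => e' /= e'0.
(* The bounds for [A] and its complement put the mass of [A] within [2 e] of an integral that is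
   eventually within [e] of its limit. The centre depends on [e'] through the grid, so only a Cauchy
   property results. *)
pose e := e' / 4; have e0 : 0 < e by rewrite divr_gt0.
have [k Sk] := SmplD_tight e0.
(* The first summand leaves room for [k] distinct cells with their margins; the second makes the
   loss [k (k + 2) / (m + 1)] at most [e]. *)
pose m := (k.+2 + Num.truncn ((k * k.+2)%:R / e))%N.
have km : (k.+2 <= m.+1)%N by rewrite leqW// leq_addr.
have kme : (k * k.+2)%:R / m.+1%:R <= e.
  rewrite ler_pdivrMr ?ltr0n// mulrC -ler_pdivrMr//.
  apply: le_trans (ltW (Num.Theory.truncnS_gt _)) _.
  by rewrite ler_nat ltnS leq_addl.
exists (\int[zeta]_mu pattern_mass m s0 A mu).
have bF := bounded_fun01 (pattern_mass_bounds m A).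
have := Gzeta (@pattern_mass_continuous R s m s0 A) bF.
move=> /cvgrPdist_lt/(_ _ e0) PF.
near=> j.
have sj : s <= side R (G j) by near: j; exact: side_near.
have Skj : fine (S j (~` small k)) <= e by near: j.
have h1 := SmplD_le_pattern A e0 km kme sj Skj.
have h2 := SmplD_le_pattern (~` A) e0 km kme sj Skj.
have SC : fine (S j (~` A)) = 1 - fine (S j A).
  rewrite probability_setC; last exact: measurable_ugraph.
  by rewrite fineB ?fin.
have FC : \int[embed R (G j)]_mu pattern_mass m s0 (~` A) mu =
    1 - \int[embed R (G j)]_mu pattern_mass m s0 A mu.
  have mF B : measurable_fun setT (pattern_mass m s0 B : borel (pconf R) -> R).
    exact: continuous_borel (@pattern_mass_continuous R s m s0 B).
  have iF B : (embed R (G j)).-integrable setT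
      (EFin \o (pattern_mass m s0 B : borel (pconf R) -> R)).
    apply: (@integrable_bounded_borel R (pconf R) _ _ 1) => // mu.
    by have /andP[h0 _] := pattern_mass_bounds m B mu; rewrite ger0_norm//;
      have /andP[] := pattern_mass_bounds m B mu.
  apply/eqP; rewrite eq_sym subr_eq addrC -RintegralD//.
  under eq_Rintegral do rewrite pattern_massC.
  rewrite Rintegral_cst// mul1r.
  by rewrite [X in fine X](_ : _ = 1%E)//; exact: probability_setT.
have : `|\int[zeta]_mu pattern_mass m s0 A mu -
    \int[embed R (G j)]_mu pattern_mass m s0 A mu| < e by near: j.
rewrite /= -ball_normE/= !ltr_distl => /andP[h3 h4].
move: h1 h2 h3 h4; rewrite SC FC /e.
move: (\int[embed R (G j)]_mu _) (\int[zeta]_mu _) (fine (S j A)) => x y z.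
by move=> h1 h2 h3 h4; apply/andP; split; lra.
Unshelve. all: by end_near. Qed.

Lemma SmplD_pos_weakly_convergent : weakly_convergent S.
Proof.
apply: setwise_tight_weakly_convergent; first exact: SmplD_setwise_cvg.
move=> e e0; have [k Sk] := SmplD_tight e0.
by exists (small k) => //; exact: finite_small.
Qed.
End limit.

(** Settles [s = 0], where there is no grid: almost surely no vertex is kept, so the law does not
    depend on [G]. *)
Lemma SmplD0 G : SmplD G (0 : R) = \d_(unlabel empty_graph : borel ugraph) :> (set _ -> \bar R).
Proof.
apply/funext => A; rewrite /SmplD mul0r /Smpl min_l ?ler01//.
have h0 : distribution (iid (bernoulli_prob (0 : R)) (nverts G)) (@kept_graph G)
    [set unlabel empty_graph : borel ugraph] = 1%E.
  apply/eqP; rewrite eq_le probability_le1/=; last exact: measurable_ugraph.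
  have <- : iid (bernoulli_prob (0 : R)) (nverts G) [set nseq_tuple (nverts G) false] = 1%E.
    rewrite iid_bernoulli_set1 ?lexx ?ler01// /weight big1// => i _.
    by rewrite tnth_nseq subr0.
  apply: le_measure; rewrite ?inE; try exact: measurable_tuple_bool.
  move=> _ ->; apply: unlabel_eq.
  pose b := nseq_tuple (nverts G) false.
  have no (i : 'I_(nverts (kept b))) : False.
    by have := kept_emb_mem i; rewrite tnth_nseq.
  exists (fun i => False_rect _ (no i)); last by move=> i; case: (no i).
  exists (fun i : 'I_0 => False_rect _ (notF (ltn_ord i))) => i; first by case: (no i).
  by case: i.
have mA := @measurable_ugraph A.
rewrite diracE; case: (boolP (_ \in A)) => [|/negP].
  rewrite inE => HA; apply/eqP; rewrite eq_le probability_le1//= -h0.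
  by apply: le_measure; rewrite ?inE//; [exact: measurable_ugraph|move=> _ ->].
move=> HA; apply/eqP; rewrite -measure_le0.
have <- : distribution (iid (bernoulli_prob (0 : R)) (nverts G)) (@kept_graph G)
    (~` [set unlabel empty_graph : borel ugraph]) = 0%E.
  rewrite probability_setC; last exact: measurable_ugraph.
  by rewrite [X in (_ - X)%E]h0 subee.
apply: le_measure; rewrite ?inE//; first exact: measurable_ugraph.
by move=> H AH HE; apply: HA; rewrite -HE; exact: mem_set.
Qed.

Lemma embed_sampling_convergent (G : nat -> graph) : edges (G j) @[j --> \oo] --> \oo ->
  weakly_convergent (fun j => embed R (G j)) -> sampling_convergent R G.
Proof.
move=> hG [zeta Gzeta] s; rewrite le_eqVlt => /orP[/eqP <-|s0]; last first.
  exact: SmplD_pos_weakly_convergent hG Gzeta s0.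
exists (SmplD (G 0) 0) => f fc fb.
rewrite (_ : (fun j => _) = fun=> \int[SmplD (G 0) 0]_x f x); first exact: cvg_cst.
apply/funext => j; rewrite /Rintegral; congr fine; apply: eq_measure_integral => A _ _.
by change (SmplD (G j) (0 : R) A = SmplD (G 0) 0 A); rewrite !SmplD0.
Qed.
End backward.

Theorem lemma3p2 (R : realType) (G : nat -> graph)
    (hG : edges (G j) @[j --> \oo] --> \oo) :
  (sampling_convergent R G <-> weakly_convergent (fun j => embed R (G j))) /\
  (sampling_convergent R G ->
   forall (eta : R -> probability (borel ugraph) R)
     (zeta : probability (borel (pconf R)) R),
   (forall r : R, 0 <= r -> weak_cvg (fun j => SmplD (G j) r) (eta r)) ->
   weak_cvg (fun j => embed R (G j)) zeta ->
   forall r : R, 0 < r ->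
   forall A : set (borel (pconf R)), measurable A ->
     Lbl_mix r (eta r) A = pushforward zeta (restrict_square r) A).
Proof.
split; first by split; [exact: sampling_convergent_embed|exact: embed_sampling_convergent].
by move=> _ eta zeta Geta Gzeta; exact: Lbl_mix_limit hG Geta Gzeta.
Qed.
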